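(* Let $(a_m)_{m\ge0}$ be a sequence converging to $0$ and let $\rho\in\mathbb{R}$. Assume that $(c_{m,n})_{0\le m\le n}$ satisfies Assumption-B with parameters $\rho$ and $(a_m)$. Assume that the $\xi_m$ are i.i.d. standard Gaussian random variables. Then for $$f_{n,\rho}(x)=\sum_{m=0}^n c_{m,n}\,\xi_mx^m$$ we have, as $n\to\infty$, $$\mathbb{E}N_{f_{n,\rho}}(0,1)=\begin{cases}\dfrac{\sqrt{2\rho+1}+o(1)}{2\pi}\log n & \text{if }\rho>-1/2,\\[2mm] \dfrac{1+o(1)}{\pi}\sqrt{\log n} & \text{if }\rho=-1/2,\\[2mm] \Theta(1) & \text{if }\rho<-1/2.\end{cases}$$
   Context: $N_f(S)$ denotes the number of roots of a function $f$ in a set $S$, counted with multiplicity. $\Theta(1)$ denotes a quantity bounded above and below by positive constants independent of $n$. Assumption-B with parameters $\rho\in\mathbb{R}$ and a sequence $(a_m)_{m\ge0}$ with $a_m\to0$: a triangular array $(c_{m,n})_{0\le m\le n}$ of complex numbers satisfies it if $\bigl|m^{-\rho}|c_{m,n}|-1\bigr|\le a_m$ for all $m,n$.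
   Formalization: The coefficients c_{m,n} are assumed real (for complex ones, e.g. c_{m,n}=i^m with rho=0, the claim fails: almost surely no roots), and in Assumption-B the weight m^{-rho} is read as 1 at m=0, where it is undefined or makes the claim false. *)

(* Defs.v *)
From HB Require Import structures.
From mathcomp Require Import all_boot all_order all_algebra.
From mathcomp Require Import all_classical all_reals all_analysis.
From mathcomp Require Export complex.
Set Implicit Arguments.
Unset Strict Implicit.
Unset Printing Implicit Defensive.
Import Order.TTheory GRing.Theory Num.Theory numFieldNormedType.Exports.
Local Open Scope classical_set_scope.
Local Open Scope ring_scope.
Local Open Scope complex_scope.

(* The weight m ^ rho is read as 1 at m = 0, where 0 ^ (- rho) is not
   meaningful; the order on R[i] compares real parts and requires equal
   imaginary parts. *)
Definition assumption_B (R : realType) (rho : R) (a : nat -> R)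
    (c : nat -> nat -> R[i]) : Prop :=
  a @ \oo --> (0 : R) /\
  forall m n : nat, (m <= n)%N ->
    `| (((maxn m 1)%:R `^ (- rho))%:C * `|c m n|) - 1 | <= (a m)%:C.

Definition mutually_independent (d : measure_display) (T : measurableType d)
    (R : realType) (P : probability T R) (xi : nat -> {RV P >-> R}) : Prop :=
  forall (J : seq nat) (A : nat -> set R), uniq J ->
    (forall j, measurable (A j)) ->
    P (\big[setI/setT]_(j <- J) (xi j @^-1` A j)) =
    (\prod_(j <- J) P (xi j @^-1` A j))%E.

Definition iid_standard_gaussian (d : measure_display) (T : measurableType d)
    (R : realType) (P : probability T R) (xi : nat -> {RV P >-> R}) : Prop :=
  mutually_independent xi /\
  forall (m : nat) (A : set R), measurable A ->
    distribution P (xi m) A = normal_prob 0 1 A.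

(* The finite-support sum is the exact count for every nonzero polynomial;
   for the zero polynomial, [mup] and hence the count are 0. *)
Definition nroots (F : fieldType) (p : {poly F}) (S : set F) : nat :=
  \big[addn/0%N]_(z \in S) mup z p.

Definition unit_interval (R : realType) : set R[i] :=
  [set x%:C | x in [set x : R | 0 < x < 1]].

Definition random_poly (d : measure_display) (T : measurableType d)
    (R : realType) (P : probability T R) (c : nat -> nat -> R[i])
    (xi : nat -> {RV P >-> R}) (n : nat) (w : T) : {poly R[i]} :=
  \poly_(m < n.+1) (c m n * (xi m w)%:C).

Definition expected_nroots (d : measure_display) (T : measurableType d)
    (R : realType) (P : probability T R) (c : nat -> nat -> R[i])
    (xi : nat -> {RV P >-> R}) (n : nat) : \bar R :=
  'E_P[(fun w : T => (nroots (random_poly c xi n w) (@unit_interval R))%:R)].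

(* Main.v *)
Require Import Defs.
From HB Require Import structures.
From mathcomp Require Import all_boot all_order all_algebra.
From mathcomp Require Import all_classical all_reals all_analysis.
From mathcomp Require Import measurable_realfun measurable_fun_approximation.
From mathcomp Require Import ring lra zify.
Set Implicit Arguments.
Unset Strict Implicit.
Unset Printing Implicit Defensive.
Import Order.TTheory GRing.Theory Num.Theory numFieldNormedType.Exports.
Local Open Scope classical_set_scope.
Local Open Scope ring_scope.

(* The sign changes of a Gaussian polynomial [f x = \sum_m c_m xi_m x ^ m] are governed by the
   angle between the coefficient vectors of [f x] and [f x'], so that the Kac-Rice
   density can be recovered from a fine grid: by rotation invariance the
   probability of a sign change between neighbouring points is their angle over
   [pi], and a cell containing more roots than its sign change shows forces [f]
   and [f'] to be small together, which has negligible total probability.  With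
   [x = exp (- y / 2)] the density becomes [sqrt (V y) / (2 * pi)], where [V y]
   is the variance of the index [m] under the weights [c_m ^ 2 * exp (- m * y)].
   Summation by parts gives [V y ~ (2 * rho + 1) / y ^ 2] if [rho > - 1 / 2] and
   [V y ~ 1 / (y ^ 2 * ln (1 / y))] if [rho = - 1 / 2], uniformly for [y] small and [n * y]
   large, while [V y = O(y ^ (2 * kap - 2))], with some [kap > 0], if [rho < - 1 / 2].
   Integrating over [A / n <= y <= t] yields the main terms.  The rest of the
   interval contributes O(1): [V y <= n ^ 2] covers [y <= A / n], and near [x = 0],
   where the coefficients are arbitrary, Rolle's theorem passes to a derivative
   of fixed order. *)

(** The grid is refined while [n] stays fixed. Tail bounds for the random coefficients, lower bounds
    for Gram determinants and factors such as [expR (n%:R * h)] may therefore depend on [n] in any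
    way: they disappear as the step [h] tends to 0, and uniformity in [n] is asked of [wvar] alone.
    Kac-Rice becomes two inequalities, for a nonincreasing majorant or minorant [g] of the square
    root of [wvar], together with a function [G] whose increments are compared with [g]; no integral
    of the density is formed. The exponential parametrization makes the dot product of the vectors
    at [y + h] and [y - h] a function of [y] alone, and their Gram determinant a double sum of
    squared hyperbolic sines. A bad cell has probability [O(h ^ 3)], against [O(1 / h)] cells. The
    order of the derivative near [x = 0] is an index [k] from which [a m <= 1 / 2] holds: earlier
    coefficients may vanish, whereas [c k] is bounded below and becomes the constant coefficient, so
    that the density decays like [expR (- y / 2)]. *)

Definition push_measure d1 d2 (T1 : measurableType d1) (T2 : measurableType d2)
    (R : realFieldType) (m : {measure set T1 -> \bar R}) (f : T1 -> T2)
    (mf : measurable_fun setT f) : {measure set T2 -> \bar R} :=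
  measure_function_pushforward__canonical__measure_function_Measure m mf.

(** * Gaussian integrals and affine substitutions *)

Section gaussian_measure.
Context {R : realType}.
Notation mu := (@lebesgue_measure R).
Notation gamma := (normal_prob (0 : R) 1).
Notation phi := (normal_pdf (0 : R) 1).
Local Open Scope ereal_scope.

(** The measure is defined by its density, so the Radon-Nikodym derivative has the same integral as
    [phi] on every measurable set and equals it almost everywhere. *)
Lemma integral_gaussE (f : R -> \bar R) : (forall x, 0 <= f x) ->
  measurable_fun [set: R] f ->
  \int[gamma]_x f x = \int[mu]_x (f x * (phi x)%:E).
Proof.
move=> f0 mf.
have dom := @normal_prob_dominates R 0%R 1%R.
rewrite -(Radon_Nikodym_SigmaFinite.change_of_variables dom)//.
have fint := Radon_Nikodym_SigmaFinite.f_integrable dom.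
apply: ae_eq_integral => //.
- apply: emeasurable_funM => //; exact: measurable_int fint.
- apply: emeasurable_funM => //; apply/measurable_EFinP.
  exact: measurable_normal_pdf.
- apply: ae_eqe_mul2l; apply: integral_ae_eq => //.
    by apply/measurable_EFinP; exact: measurable_normal_pdf.
  move=> A _ mA; rewrite -Radon_Nikodym_SigmaFinite.f_integral//.
Qed.

(** Lebesgue measure is determined by its values on half-open intervals; there [c] compensates the
    factor [1 / c] in the length of the preimage. *)
Lemma lebesgue_measure_affine (c d : R) (A : set R) : (0 < c)%R ->
  measurable A ->
  c%:E * mu ((fun x => c * x + d)%R @^-1` A) = mu A.
Proof.
move=> c0 mA.
pose f : measurableTypeR R -> measurableTypeR R := (fun x => c * x + d)%R.
have mf : measurable_fun setT f by apply: measurable_funD => //; apply: measurable_funM.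
pose m := mscale (NngNum (ltW c0)) (push_measure mu mf).
have -> : c%:E * mu ((fun x => c * x + d)%R @^-1` A) = m A by [].
apply/esym/lebesgue_measure_unique => //= _ [[a b]] _ <-.
rewrite /m /mscale/= /push_measure/= /pushforward.
have -> : f @^-1` `]a, b]%classic = `]((a - d) / c)%R, ((b - d) / c)%R]%classic.
  apply/seteqP; split => x /=; rewrite !in_itv/= /f;
  by rewrite ltr_pdivrMr// ler_pdivlMr// ltrBlDr lerBrDr mulrC.
rewrite !lebesgue_measure_itv/= !lte_fin ltr_pM2r ?invr_gt0// ltrD2r.
case: ifPn => _; last by rewrite mule0.
by rewrite -EFinM -EFinB -mulrBl mulrCA divff ?gt_eqF// mulr1 opprB addrA subrK.
Qed.

Lemma integral_affine_pos (c d : R) (f : R -> \bar R) : (0 < c)%R ->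
  (forall x, 0 <= f x) -> measurable_fun [set: R] f ->
  c%:E * \int[mu]_x f (c * x + d)%R = \int[mu]_x f x.
Proof.
move=> c0 f0 mf.
pose g : measurableTypeR R -> measurableTypeR R := (fun x => c * x + d)%R.
have mg : measurable_fun setT g by apply: measurable_funD => //; apply: measurable_funM.
have := @ge0_integral_pushforward _ _ _ _ _ g mg mu setT f measurableT mf.
rewrite preimage_setT => /(_ (fun y _ => f0 y)) /= <-.
rewrite -(@ge0_integral_mscale _ _ _ (push_measure mu mg) setT measurableT (NngNum (ltW c0)) f mf)//.
apply: eq_measure_integral => /= A mA _.
exact: lebesgue_measure_affine.
Qed.

Lemma integral_opp (f : R -> \bar R) : (forall x, 0 <= f x) ->
  measurable_fun [set: R] f -> \int[mu]_x f (- x)%R = \int[mu]_x f x.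
Proof.
move=> f0 mf.
have mg : measurable_fun setT (-%R : measurableTypeR R -> measurableTypeR R) by [].
have := @ge0_integral_pushforward _ _ _ _ _ _ mg mu setT f measurableT mf.
rewrite preimage_setT => /(_ (fun y _ => f0 y)) /= <-.
apply: eq_measure_integral => /= A mA _; exact: lebesgue_measureN.
Qed.

Lemma integral_affine (c d : R) (f : R -> \bar R) : c != 0%R ->
  (forall x, 0 <= f x) -> measurable_fun [set: R] f ->
  (`|c|)%:E * \int[mu]_x f (c * x + d)%R = \int[mu]_x f x.
Proof.
move=> c0 f0 mf; have [cp|cn] := ltP 0%R c.
  by rewrite gtr0_norm//; exact: integral_affine_pos.
have {cn} cn : (c < 0)%R by rewrite lt_neqAle c0.
rewrite ltr0_norm//.
rewrite -(@integral_opp (fun x => f (c * x + d)%R)) //; last first.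
  by apply: measurableT_comp => //; apply: measurable_funD => //; exact: measurable_funM.
under eq_integral do rewrite mulrN -mulNr.
by apply: integral_affine_pos => //; rewrite oppr_gt0.
Qed.

End gaussian_measure.

(** * Rotation invariance in the plane *)

Section gaussian_rotation.
Context {R : realType}.
Notation mu := (@lebesgue_measure R).
Notation gamma := (normal_prob (0 : R) 1).
Notation phi := (normal_pdf (0 : R) 1).
Local Open Scope ereal_scope.

Lemma normal_pdf_rotation (c s x y : R) : (c ^+ 2 + s ^+ 2 = 1)%R ->
  (phi (c * x + s * y) * phi (- s * x + c * y) = phi x * phi y)%R.
Proof.
move=> cs; rewrite !normal_pdfE ?oner_neq0//.
rewrite mulrACA [RHS]mulrACA /normal_fun !subr0 -!expRD; congr (_ * expR _)%R.
rewrite -!mulrDl -!opprD; congr (- _ / _)%R.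
transitivity ((c ^+ 2 + s ^+ 2) * (x ^+ 2 + y ^+ 2))%R; first by ring.
by rewrite cs mul1r.
Qed.

Lemma measurable_fun_pair_comp d (T : measurableType d) (K : R * R -> \bar R)
    (f g : T -> R) : measurable_fun setT K -> measurable_fun setT f ->
  measurable_fun setT g -> measurable_fun setT (fun z => K (f z, g z)).
Proof. by move=> mK mf mg; apply: (measurableT_comp mK); exact: measurable_fun_pair. Qed.

(** For [c != 0] a rotation splits into one-variable substitutions: [w = - s * x + c * y] at fixed
    [x], then, after exchanging the integrals, [u = (x + s * w) / c] at fixed [w]. Their factors
    [1 / |c|] and [|c|] cancel. For [c = 0] it is a swap of coordinates up to signs. *)
Lemma lebesgue_rotation (c s : R) (K : R * R -> \bar R) :
  (c ^+ 2 + s ^+ 2 = 1)%R -> (forall z, 0 <= K z) ->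
  measurable_fun setT K ->
  \int[mu]_x \int[mu]_y K (c * x + s * y, - s * x + c * y)%R =
  \int[mu]_x \int[mu]_y K (x, y).
Proof.
move=> cs K0 mK.
have mKc := measurable_fun_pair_comp mK.
have swapK : \int[mu]_x \int[mu]_y K (y, x) = \int[mu]_x \int[mu]_y K (x, y).
  exact/esym/(fubini_tonelli (m1 := mu) (m2 := mu)).
have mG : measurable_fun setT (fun x : measurableTypeR R => \int[mu]_u K (u, x)).
  exact: (measurable_fun_fubini_tonelli_G (m1 := mu)).
have [c0|c0] := eqVneq c 0%R.
  have s1 : (s ^+ 2 = 1)%R by move: cs; rewrite c0 expr0n add0r.
  have s0 : s != 0%R by apply: contra_eq_neq s1 => ->; rewrite expr0n eq_sym oner_neq0.
  have ns1 : (`|s| = 1)%R by move/eqP: s1; rewrite sqrf_eq1 => /orP[]/eqP->; rewrite ?normrN normr1.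
  transitivity (\int[mu]_x \int[mu]_u K (u, - s * x + 0)%R).
    apply: eq_integral => x _.
    rewrite -(@integral_affine R s 0%R (fun u => K (u, - s * x + 0)%R) s0)//; last exact: mKc.
    by rewrite ns1 mul1e; apply: eq_integral => y _; rewrite c0 !mul0r add0r !addr0.
  rewrite -swapK -[RHS](@integral_affine R (- s)%R 0%R) ?oppr_eq0//.
    by rewrite normrN ns1 mul1e.
  by move=> x; apply: integral_ge0.
have inn x : \int[mu]_y K (c * x + s * y, - s * x + c * y)%R =
    (`|c|^-1)%:E * \int[mu]_w K ((x + s * w) / c, w)%R.
  rewrite -(@integral_affine R c (- s * x) (fun w => K ((x + s * w) / c, w)%R) c0)//; last first.
    apply: mKc => //; apply: measurable_funM => //.
    by apply: measurable_funD => //; exact: measurable_funM.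
  rewrite muleA -EFinM mulVf ?normr_eq0// mul1e; apply: eq_integral => y _.
  congr (K (_, _)); last by rewrite addrC.
  apply: (canRL (mulfK c0)).
  transitivity ((c ^+ 2 + s ^+ 2) * x + s * c * y - s ^+ 2 * x)%R; first by ring.
  by rewrite cs; ring.
have mpos : measurable_fun setT (fun z : measurableTypeR R * measurableTypeR R => K ((z.1 + s * z.2) / c, z.2)%R).
  apply: mKc => //; apply: measurable_funM => //.
  by apply: measurable_funD => //; exact: measurable_funM.
under eq_integral do rewrite inn.
rewrite ge0_integralZl//; last 2 first.
- exact: (measurable_fun_fubini_tonelli_F (m2 := mu) _ mpos (fun _ => K0 _)).
- by move=> x _; apply: integral_ge0.
rewrite (fubini_tonelli (m1 := mu) (m2 := mu)
  (fun z : measurableTypeR R * measurableTypeR R => K ((z.1 + s * z.2) / c, z.2)%R))//=.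
rewrite -ge0_integralZl//; last 2 first.
- exact: (measurable_fun_fubini_tonelli_G (m1 := mu) _ mpos (fun _ => K0 _)).
- by move=> x _; apply: integral_ge0.
rewrite -swapK; apply: eq_integral => w _.
rewrite -(@integral_affine R c^-1 (s * w / c) (fun u => K (u, w)))//; last 2 first.
- by rewrite invr_eq0.
- exact: mKc.
by rewrite normfV; congr (_ * _); apply: eq_integral => x _; rewrite mulrDl [(x / c)%R]mulrC.
Qed.

(** The product density is itself invariant by [normal_pdf_rotation], so it can be moved into the
    integrand [K] and the Lebesgue case applies. *)
Lemma gaussian_rotation (c s : R) (H : R * R -> \bar R) :
  (c ^+ 2 + s ^+ 2 = 1)%R -> (forall z, 0 <= H z) ->
  measurable_fun setT H ->
  \int[gamma]_x \int[gamma]_y H (c * x + s * y, - s * x + c * y)%R =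
  \int[gamma]_x \int[gamma]_y H (x, y).
Proof.
move=> cs H0 mH.
have mphi : measurable_fun [set: R] phi by exact: measurable_normal_pdf.
have step (G : R * R -> \bar R) : (forall z, 0 <= G z) -> measurable_fun [set: R * R] G ->
    \int[gamma]_x \int[gamma]_y G (x, y) =
    \int[mu]_x \int[mu]_y (G (x, y) * (phi x * phi y)%:E).
  move=> G0 mG; rewrite integral_gaussE; last 2 first.
  - by move=> x; apply: integral_ge0.
  - exact: (measurable_fun_fubini_tonelli_F (m2 := gamma) G).
  apply: eq_integral => x _; rewrite integral_gaussE; last 2 first.
  - by [].
  - exact: measurable_fun_pair_comp.
  rewrite -ge0_integralZr//; last 3 first.
  - apply: emeasurable_funM; first exact: measurable_fun_pair_comp.
    exact/measurable_EFinP.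
  - by move=> y _; rewrite mule_ge0// lee_fin normal_pdf_ge0.
  - by rewrite lee_fin normal_pdf_ge0.
  by apply: eq_integral => y _; rewrite -muleA -EFinM mulrC.
pose G z := H (c * z.1 + s * z.2, - s * z.1 + c * z.2)%R.
have mG : measurable_fun [set: R * R] G.
  by apply: measurable_fun_pair_comp => //; apply: measurable_funD => //; exact: measurable_funM.
transitivity (\int[gamma]_x \int[gamma]_y G (x, y)); first by [].
have G0 z : 0 <= G z by exact: H0.
rewrite [LHS](step G G0 mG).
apply/esym; etransitivity; first exact: (step H H0 mH).
apply/esym.
pose K z := H z * (phi z.1 * phi z.2)%:E.
transitivity (\int[mu]_x \int[mu]_y K (c * x + s * y, - s * x + c * y)%R).
  apply: eq_integral => x _; apply: eq_integral => y _.
  by rewrite /K /G /= normal_pdf_rotation.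
have K0 z : 0 <= K z by rewrite mule_ge0// lee_fin mulr_ge0// normal_pdf_ge0.
have mK : measurable_fun setT K.
  apply: emeasurable_funM => //; apply/measurable_EFinP/measurable_funM;
  exact: measurableT_comp.
exact: (lebesgue_rotation cs K0 mK).
Qed.

End gaussian_rotation.

Lemma measurable_idR (R : realType) :
  measurable_fun setT (idfun : measurableTypeR R -> R).
Proof. by move=> _ B mB; rewrite setTI. Qed.

(** * Joint law of two linear forms in the Gaussian variables *)

Section independence.
Context d (T : measurableType d) (R : realType) (P : probability T R)
  (xi : nat -> {RV P >-> R}).
Hypothesis xi_indep : mutually_independent xi.
Hypothesis xi_law : forall (m : nat) (A : set R), measurable A ->
    distribution P (xi m) A = normal_prob 0 1 A.
Notation gamma := (normal_prob (0 : R) 1).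
Local Open Scope ereal_scope.

Definition lincomb n (u : nat -> R) (w : T) : R := (\sum_(m < n) u m * xi m w)%R.

Lemma measurable_lincomb n u : measurable_fun setT (lincomb n u).
Proof. by apply: measurable_sum => i; apply: measurable_funM. Qed.

(** A pi-system that generates the events depending on the first [n] variables; independence is
    given only for such product events. *)
Let cyl n : set (set T) :=
  [set C | exists A : nat -> set R, (forall j, measurable (A j)) /\
     C = \big[setI/setT]_(j <- iota 0 n) (xi j @^-1` A j)].

Let preimage_measurable j (A : set R) : measurable A -> measurable (xi j @^-1` A).
Proof. by move=> mA; rewrite -[X in measurable X]setTI; exact: measurable_funP. Qed.

(** As functions of [C] both sides are finite measures, the restriction of [P] to an event and a
    multiple of [P]. They agree on the pi-system [cyl n], hence on what it generates. *)
Let cyl_indep n (B : set R) (C : set T) : measurable B -> <<s cyl n >> C ->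
  P (C `&` xi n @^-1` B) = P C * P (xi n @^-1` B).
Proof.
move=> mB sC; set D := xi n @^-1` B.
have mD : measurable D by exact: preimage_measurable.
have PD : (0 <= fine (P D))%R by rewrite fine_ge0.
have cylm : cyl n `<=` measurable.
  move=> _ [A [mA ->]]; rewrite big_seq; apply: bigsetI_measurable => j _.
  exact: preimage_measurable.
have -> : P (C `&` D) = mrestr P mD C by [].
have -> : P C * P D = mscale (NngNum PD) P C.
  by rewrite /mscale/= muleC fineK// fin_num_measure.
apply: (g_sigma_algebra_measure_unique (cyl n) cylm (fun=> setT)) => //=.
- move=> _; exists (fun=> setT); split=> //.
  by rewrite big1// => j _; rewrite preimage_setT.
- exact: bigcup_const.
- move=> _ _ [A1 [mA1 ->]] [A2 [mA2 ->]]; exists (fun j => A1 j `&` A2 j); split.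
    by move=> j; exact: measurableI.
  by rewrite -big_split/=; apply: eq_bigr => j _; rewrite preimage_setI.
- move=> _ [A [mA ->]]; rewrite /mrestr /mscale/= fineK ?fin_num_measure// muleC.
  (* Adding [B] as the constraint on coordinate [n] turns the intersection into a single product
     event over [0, ..., n]. *)
  pose A' j := if (j < n)%N then A j else B.
  have mA' j : measurable (A' j) by rewrite /A'; case: ifP.
  have E : \big[setI/setT]_(j <- iota 0 n) (xi j @^-1` A j) =
           \big[setI/setT]_(j <- iota 0 n) (xi j @^-1` A' j).
    by apply: eq_big_seq => j; rewrite mem_iota add0n /A' => /andP[_ ->].
  have An : D = xi n @^-1` A' n by rewrite /A' ltnn.
  rewrite E An -[X in P (_ `&` X)](big_seq1 (@setI T) n (fun j => xi j @^-1` A' j)).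
  rewrite -[X in P (_ `&` X)]setIT.
  have un : uniq (iota 0 n ++ [:: n]).
    by rewrite cats1 rcons_uniq mem_iota add0n ltnn andbF iota_uniq.
  have := xi_indep un mA'; rewrite !big_cat/= !big_seq1 setIT => ->.
  by rewrite xi_indep// iota_uniq.
- by move=> _; rewrite /mrestr setTI (le_lt_trans (probability_le1 _ _)) ?ltry.
Qed.

Let U n u v (w : T) : R * R := (lincomb n u w, lincomb n v w).

Let mU n u v : measurable_fun setT (U n u v).
Proof. by apply: measurable_fun_pair; exact: measurable_lincomb. Qed.

Let cyl_U n u v (A : set (R * R)) : measurable A -> <<s cyl n >> (U n u v @^-1` A).
Proof.
move=> mA.
have mx (i : 'I_n) : measurable_fun setT (xi i : g_sigma_algebraType (cyl n) -> R).
  move=> _ B mB; rewrite setTI; apply: sub_sigma_algebra.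
  exists (fun j => if j == i :> nat then B else setT); split; first by move=> j; case: ifP.
  rewrite (bigD1_seq (val i)) ?iota_uniq//=; last by rewrite mem_iota/= add0n.
  by rewrite eqxx big1 ?setIT// => j /negbTE ->; rewrite preimage_setT.
have ml w : measurable_fun setT (lincomb n w : g_sigma_algebraType (cyl n) -> R).
  by apply: measurable_sum => i; apply: measurable_funM.
have := measurable_fun_pair (ml u) (ml v).
by move=> /(_ measurableT A mA); rewrite setTI.
Qed.

Lemma integral_gauss_law m (f : R -> \bar R) : (forall x, 0 <= f x) ->
  measurable_fun [set: R] f ->
  \int[distribution P (xi m)]_x f x = \int[gamma]_x f x.
Proof.
move=> f0 mf.
have mid := @measurable_idR R.
have := @ge0_integral_pushforward _ _ _ _ _ _ mid gamma setT f measurableT mf.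
rewrite preimage_setT => /(_ (fun y _ => f0 y)) /= <-.
by apply: (@eq_measure_integral _ _ _ setT (push_measure gamma mid)) => /= A mA _; rewrite xi_law.
Qed.

(** The two partial sums involve only variables below [n], so the joint law with [xi n] agrees with
    a product measure on rectangles and is that product; Tonelli's theorem separates the last
    variable. *)
Lemma integral_indep n u v (h : R * R * R -> \bar R) : (forall z, 0 <= h z) ->
  measurable_fun setT h ->
  \int[P]_w h (lincomb n u w, lincomb n v w, xi n w) =
  \int[gamma]_z \int[P]_w h (lincomb n u w, lincomb n v w, z).
Proof.
move=> h0 mh.
pose U' : {RV P >-> (R * R)%type} := HB.pack (U n u v) (isMeasurableFun.Build _ _ _ _ (U n u v) (mU n u v)).
have mV : measurable_fun setT (fun w => (U n u v w, xi n w)).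
  by apply: measurable_fun_pair => //; exact: mU.
pose m1 := distribution P U'; pose m2 := distribution P (xi n).
transitivity (\int[(m1 \x m2)%E]_z h z).
  have := @ge0_integral_pushforward _ _ _ _ _ _ mV P setT h measurableT mh.
  rewrite preimage_setT => /(_ (fun y _ => h0 y)) /= <-.
  apply: (@eq_measure_integral _ _ _ _ _ (push_measure P mV)) => /= A mA _.
  apply/esym/(@product_measure_unique _ _ _ _ _ m1 m2 (push_measure P mV)) => //.
  move=> A1 A2 mA1 mA2; apply: cyl_indep => //; exact: cyl_U.
rewrite fubini_tonelli2// integral_gauss_law//; last 2 first.
- by move=> x; apply: integral_ge0.
- exact: (measurable_fun_fubini_tonelli_G (m1 := m1)).
apply: eq_integral => z _; rewrite /fubini_G ge0_integral_distribution//.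
exact: measurableT_comp.
Qed.

Lemma rotation_of_vector (a b : R) : exists c s q : R,
  [/\ c ^+ 2 + s ^+ 2 = 1, 0 <= q, q ^+ 2 = a ^+ 2 + b ^+ 2, a = q * c & b = q * s]%R.
Proof.
have ab0 : (0 <= a ^+ 2 + b ^+ 2)%R by rewrite addr_ge0// sqr_ge0.
pose q := Num.sqrt (a ^+ 2 + b ^+ 2).
have q2 : (q ^+ 2 = a ^+ 2 + b ^+ 2)%R by rewrite sqr_sqrtr.
have [q0|q0] := eqVneq q 0%R.
  exists 1%R, 0%R, q; rewrite q2 sqrtr_ge0.
  move: q2; rewrite q0 expr0n/= => /esym/eqP; rewrite paddr_eq0 ?sqr_ge0// !sqrf_eq0.
  by move=> /andP[/eqP-> /eqP->]; split=> //; ring.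
exists (a / q)%R, (b / q)%R, q; split=> //; rewrite ?sqrtr_ge0//; try by rewrite mulrC divfK.
by rewrite !expr_div_n -mulrDl -q2 divff// sqrf_eq0.
Qed.

Definition dotn n (u v : nat -> R) : R := (\sum_(m < n) u m * v m)%R.

(* Gram-Schmidt: adding the coordinate [xi n] to a pair in triangular form gives three Gaussian variables, and two plane rotations bring the pair back to triangular form. *)
Lemma gaussian_pair_law n u v : exists r s q : R,
  [/\ (0 <= r)%R, (0 <= q)%R, (r ^+ 2 = dotn n u u)%R, (r * s = dotn n u v)%R &
      (s ^+ 2 + q ^+ 2 = dotn n v v)%R] /\
  forall h : R * R -> \bar R, (forall z, 0 <= h z) -> measurable_fun setT h ->
    \int[P]_w h (lincomb n u w, lincomb n v w) =
    \int[gamma]_x \int[gamma]_y h (r * x, s * x + q * y)%R.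
Proof.
elim: n => [|n [r [s [q [[r0 q0 rE rsE sqE] IH]]]]].
  exists 0%R, 0%R, 0%R; rewrite /dotn !big_ord0; split; first by split=> //; ring.
  move=> h h0 mh.
  transitivity (\int[P]_w (cst (h (0, 0)%R) w)).
    by apply: eq_integral => w _; rewrite /lincomb !big_ord0.
  rewrite integral_cst//= probability_setT mule1.
  transitivity (\int[gamma]_x \int[gamma]_y (cst (h (0, 0)%R) y)).
    under eq_integral do rewrite integral_cst//= probability_setT mule1.
    by rewrite integral_cst//= probability_setT mule1.
  by apply: eq_integral => x _; apply: eq_integral => y _; rewrite !mul0r addr0.
set a := u n; set b := v n.
(* With [X], [Y] from the induction and [Z] for [xi n], the first form is now [r X + a Z]. This
   rotation makes it [r'] times one standard variable, [c Z + t X]. *)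
have [c [t [r' [ct r'0 r'E aE rE']]]] := rotation_of_vector a r.
pose s' := (s * t + b * c)%R; pose b' := (s * c - b * t)%R.
(* In the rotated coordinates the second form has coefficient [s'] along the new first axis, [b']
   along the other one, and still [q] along [Y]. A rotation of the last two merges them into
   [q']. *)
have [c2 [t2 [q' [ct2 q'0 q'E bE qE']]]] := rotation_of_vector b' q.
exists r', s', q'; split.
  rewrite /dotn !big_ord_recr/= -!/(dotn n _ _) -rE -rsE -sqE -/a -/b; split=> //.
  - by rewrite r'E; ring.
  - by rewrite /s' rE' aE; ring.
  - rewrite q'E /s' /b'.
    transitivity ((c ^+ 2 + t ^+ 2) * (s ^+ 2 + b ^+ 2) + q ^+ 2)%R; first by ring.
    by rewrite ct; ring.
move=> h h0 mh.
have mhc d' (T' : measurableType d') (f g : T' -> R) : measurable_fun setT f ->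
    measurable_fun setT g -> measurable_fun setT (fun z => h (f z, g z)).
  exact: measurable_fun_pair_comp.
pose k (z : R * R * R) := h (z.1.1 + a * z.2, z.1.2 + b * z.2)%R.
have mk : measurable_fun setT k.
  apply: mhc; apply: measurable_funD; try exact: measurable_funM;
  by apply: measurableT_comp => //; exact: measurableT_comp.
transitivity (\int[P]_w k (lincomb n u w, lincomb n v w, xi n w)).
  by apply: eq_integral => w _; rewrite /k/= /lincomb !big_ord_recr.
rewrite (@integral_indep n u v k (fun _ => h0 _) mk).
(* [Y] is integrated out first, so that the first rotation acts only on the plane of [xi n] and
   [X]. *)
pose K (z : R * R) := \int[gamma]_y h (r' * z.1, s' * z.1 + (b' * z.2 + q * y))%R.
have mK : measurable_fun setT K.
  have m3 : measurable_fun setT (fun z : R * R * measurableTypeR R =>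
      h (r' * z.1.1, s' * z.1.1 + (b' * z.1.2 + q * z.2))%R).
    have m11 : measurable_fun setT (fun z : R * R * measurableTypeR R => z.1.1).
      exact: measurableT_comp.
    have m12 : measurable_fun setT (fun z : R * R * measurableTypeR R => z.1.2).
      exact: measurableT_comp.
    have m2 : measurable_fun setT (fun z : R * R * measurableTypeR R => (z.2 : R)).
      exact: (measurableT_comp (@measurable_idR R) measurable_snd).
    apply: mhc; first exact: measurable_funM.
    apply: measurable_funD; first exact: measurable_funM.
    by apply: measurable_funD; exact: measurable_funM.
  exact: (measurable_fun_fubini_tonelli_F (m2 := gamma) _ m3 (fun _ => h0 _)).
have K0 z : 0 <= K z by apply: integral_ge0.
transitivity (\int[gamma]_z \int[gamma]_x K (c * z + t * x, - t * z + c * x)%R).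
  apply: eq_integral => z _.
  have mkz : measurable_fun setT (fun p => k (p, z)) by exact: measurableT_comp.
  rewrite (IH _ (fun _ => h0 _) mkz).
  apply: eq_integral => x _; apply: eq_integral => y _; rewrite /k/=.
  congr (h (_, _)); first by rewrite {1}rE' aE; ring.
  transitivity ((c ^+ 2 + t ^+ 2) * (s * x + b * z) + q * y)%R; first by rewrite ct mul1r; ring.
  by rewrite /s' /b'; ring.
rewrite [LHS](gaussian_rotation ct K0 mK).
apply: eq_integral => x _.
pose K2 (z : R * R) := h (r' * x, s' * x + q' * z.1)%R.
have mK2 : measurable_fun setT K2.
  by apply: mhc => //; apply: measurable_funD => //; apply: measurable_funM.
transitivity (\int[gamma]_y \int[gamma]_z K2 (c2 * y + t2 * z, - t2 * y + c2 * z)%R).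
  apply: eq_integral => y _; apply: eq_integral => z _; rewrite /K2/=.
  by congr (h (_, _)); rewrite mulrDr !mulrA -bE -qE'.
rewrite [LHS](gaussian_rotation ct2 (fun _ => h0 _) mK2).
apply: eq_integral => y _; rewrite /K2/=.
by rewrite integral_cst//= probability_setT mule1.
Qed.

End independence.

(** * Estimates for one and two standard Gaussian variables *)

Section gaussian_estimates.
Context {R : realType}.
Notation mu := (@lebesgue_measure R).
Notation gamma := (normal_prob (0 : R) 1).
Notation phi := (normal_pdf (0 : R) 1).

Lemma is_derive_continuous (f : R -> R) (x df : R) :
  is_derive x 1 f df -> {for x, continuous f}.
Proof. by move=> [dfx _]; exact/differentiable_continuous/derivable1_diffP. Qed.

Lemma is_derive_gauss (k x : R) :
  is_derive x 1 (fun y : R => expR (- (k * y ^+ 2)))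
    (- (2 * k * x) * expR (- (k * x ^+ 2))).
Proof.
rewrite [X in is_derive _ _ X _](_ : _ = expR \o (fun y => - (k * y ^+ 2)))//.
have h : is_derive x 1 (fun y => - (k * y ^+ 2)) (- (2 * k * x)).
  by apply: is_derive_eq; rewrite /= ?scaler0 ?addr0 ?expr1 /GRing.scale/=; ring.
by rewrite mulrC; exact: (@is_derive1_comp R expR _ x _ _ (is_derive_expR _) h).
Qed.

Lemma cvg_gauss_infty (k : R) : 0 < k ->
  expR (- (k * y ^+ 2)) @[y --> +oo] --> (0 : R).
Proof.
move=> k0; apply: (cvg_comp (fun y => k * y ^+ 2) (fun z => expR (- z))).
  2: exact: cvgr_expR.
apply: gt0_cvgMry => //; exact: cvgr_expr2.
Qed.

Lemma half_div_pi (x t D : R) : x = (2 * pi)^-1 -> 0 < D ->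
  x * t / (D / 2) = t / (pi * D).
Proof. by move=> -> D0; have := @pi_gt0 R; move: pi => p p0; field; rewrite !gt_eqF. Qed.

Local Open Scope ereal_scope.

(** By parity it is twice the integral over the half-line, where [F] below is a primitive. *)
Lemma integral_abs_gauss (k : R) : (0 < k)%R ->
  \int[mu]_y (`|y| * expR (- (k * y ^+ 2)))%:E = (k^-1)%:E.
Proof.
move=> k0.
pose f (y : R) := (`|y| * expR (- (k * y ^+ 2)))%R.
have cf : continuous f.
  move=> y; apply: cvgM; first exact: norm_continuous.
  exact: (is_derive_continuous (is_derive_gauss k y)).
rewrite (@ge0_symfun_integralT _ f); last 3 first.
- by move=> y; rewrite mulr_ge0// expR_ge0.
- exact: cf.
- by move=> y; rewrite /f/= normrN sqrrN.
pose F (y : R) := (- (2 * k)^-1 * expR (- (k * y ^+ 2)))%R.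
have dF (y : R) : is_derive y (1 : R)%R F (y * expR (- (k * y ^+ 2)))%R.
  have h := is_derive_gauss k y.
  apply: is_derive_eq; rewrite /= ?scaler0 ?addr0 /GRing.scale/=.
  by field; rewrite gt_eqF.
have -> : [set x : R | (0 <= x)%R] = `[0%R, +oo[%classic.
  by apply/seteqP; split => x /=; rewrite in_itv/= andbT.
rewrite (@ge0_continuous_FTC2y _ f F 0%R 0%R).
- rewrite -EFinB -EFinM /F expr0n/= mulr0 oppr0 expR0.
  by congr (_%:E); field; rewrite gt_eqF.
- by move=> x _; rewrite mulr_ge0// expR_ge0.
- exact: continuous_subspaceT.
- rewrite -(mulr0 (- (2 * k)^-1)%R); apply: cvgM; first exact: cvg_cst.
  exact: cvg_gauss_infty.
- by move=> x _; have [] := dF x.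
- by apply: cvg_at_right_filter; exact: (is_derive_continuous (dF 0%R)).
- move=> x; rewrite in_itv/= andbT => x0.
  by rewrite derive1E (@derive_val _ _ _ _ _ _ _ (dF x)) /f gtr0_norm.
Qed.

Lemma normal_pdf01E (x : R) : phi x = (phi 0 * expR (- (2^-1 * x ^+ 2)))%R.
Proof.
rewrite !normal_pdfE ?oner_neq0// /normal_fun !subr0 expr0n/= oppr0 mul0r expR0.
by rewrite mulr1; congr (_ * expR _)%R; rewrite mulNr; congr (- _)%R; field.
Qed.

Lemma normal_pdf01_sqr : (phi 0 ^+ 2 = (2 * pi)^-1)%R.
Proof.
rewrite !normal_pdfE ?oner_neq0// /normal_fun subr0 expr0n/= oppr0 mul0r expR0 mulr1.
rewrite /normal_peak exprVn sqr_sqrtr ?expr1n ?mul1r ?mulr_natl//.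
by rewrite mulrn_wge0// pi_ge0.
Qed.

Lemma normal_pdf01_le1 (x : R) : (phi x <= 1)%R.
Proof.
apply: (@le_trans _ _ (phi 0)).
  rewrite normal_pdf01E ler_piMr ?normal_pdf_ge0//.
  by rewrite -[leRHS]expR0 ler_expR oppr_le0 mulr_ge0 ?sqr_ge0.
rewrite -(@ler_pXn2r _ 2) ?nnegrE ?normal_pdf_ge0// normal_pdf01_sqr expr1n invf_le1.
  by have := @pi_ge2 R; lra.
by rewrite mulr_gt0// pi_gt0.
Qed.

Lemma gaussian_itv_le (a b M : R) : (a <= b)%R -> (0 <= M)%R ->
  (forall x, a <= x <= b -> phi x <= M)%R ->
  gamma `[a, b]%classic <= (M * (b - a))%:E.
Proof.
move=> ab M0 phiM; rewrite /normal_prob.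
apply: (@le_trans _ _ (\int[mu]_(x in `[a, b]) (cst M%:E x))).
  apply: ge0_le_integral => //.
  - by move=> x _; rewrite lee_fin normal_pdf_ge0.
  - by apply/measurable_EFinP/measurable_funTS; exact: measurable_normal_pdf.
rewrite integral_cst//= lebesgue_measure_itv/= lte_fin.
by move: ab; rewrite le_eqVlt => /orP[/eqP->|->]; rewrite ?ltxx ?mule0 ?subrr ?mulr0.
Qed.

Lemma gaussian_itv_ge (a b M : R) : (a <= b)%R -> (0 <= M)%R ->
  (forall x, a <= x <= b -> M <= phi x)%R ->
  (M * (b - a))%:E <= gamma `]a, b[%classic.
Proof.
move=> ab M0 phiM; rewrite /normal_prob.
apply: (@le_trans _ _ (\int[mu]_(x in `]a, b[) (cst M%:E x))).
  rewrite integral_cst//= lebesgue_measure_itv/= lte_fin.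
  by move: ab; rewrite le_eqVlt => /orP[/eqP->|->]; rewrite ?ltxx ?mule0 ?subrr ?mulr0.
apply: ge0_le_integral => //.
- by apply/measurable_EFinP/measurable_funTS; exact: measurable_normal_pdf.
- by move=> x /=; rewrite in_itv/= lee_fin => /andP[x1 x2]; apply: phiM; rewrite !ltW.
Qed.

Lemma measurable_expR_sqr (k : R) :
  measurable_fun [set: R] (fun x : R => expR (- (k * x ^+ 2))%R).
Proof.
apply: continuous_measurable_fun => x.
exact: (is_derive_continuous (is_derive_gauss k x)).
Qed.

Lemma measurable_absr : measurable_fun [set: R] (fun x : R => `|x|%R).
Proof. by apply: measurableT_comp. Qed.

Let opp : set (R * R) := [set z | (z.1 * z.2 < 0)%R].

Lemma measurable_sign_change : measurable [set z : R * R | (z.1 * z.2 < 0)%R].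
Proof.
have -> : [set z : R * R | (z.1 * z.2 < 0)%R] =
    (fun z : R * R => z.1 * z.2)%R @^-1` `]-oo, 0%R[%classic.
  by apply/seteqP; split => z /=; rewrite in_itv.
rewrite -[X in measurable X]setTI.
have m : measurable_fun setT (fun z : R * R => z.1 * z.2)%R by exact: measurable_funM.
exact: m.
Qed.

Lemma integral_gauss_abs (k c : R) : (0 <= k)%R -> (0 <= c)%R ->
  \int[gamma]_y (c * `|y| * expR (- (k * y ^+ 2)))%:E =
  (c * phi 0 / (k + 2^-1))%:E.
Proof.
move=> k0 c0.
have mf : measurable_fun [set: R] (fun y : R => `|y| * expR (- (k * y ^+ 2)))%R.
  apply: measurable_funM; first exact: measurable_absr.
  exact: measurable_expR_sqr.
have mg : measurable_fun [set: R] (fun y : R => `|y| * expR (- ((k + 2^-1) * y ^+ 2)))%R.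
  apply: measurable_funM; first exact: measurable_absr.
  exact: measurable_expR_sqr.
rewrite integral_gaussE; last 2 first.
- by move=> y; rewrite lee_fin !mulr_ge0// expR_ge0.
- apply/measurable_EFinP; under eq_fun do rewrite -mulrA.
  exact: measurable_funM.
transitivity (\int[mu]_y ((c * phi 0)%:E * (`|y| * expR (- ((k + 2^-1) * y ^+ 2)))%:E)).
  apply: eq_integral => y _; rewrite normal_pdf01E -!EFinM; congr (_%:E).
  rewrite mulrDl opprD expRD; ring.
rewrite ge0_integralZl//.
- rewrite integral_abs_gauss; last by rewrite ltr_wpDl// invr_gt0.
  by rewrite -EFinM.
- exact/measurable_EFinP.
- by rewrite lee_fin mulr_ge0// normal_pdf_ge0.
Qed.

(** For fixed [y] the event puts [x] strictly between 0 and [- t * y]. On this interval, of length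
    [t * |y|], the density lies between [phi (t * y)] and [phi 0]. Integrating over [y] brackets the
    exact value [arctan t / pi] by two bounds with the same first order at [t = 0], which is all
    that a fine grid requires. *)
Lemma gaussian_sign_change (t : R) : (0 <= t)%R ->
  (t / (pi * (1 + t ^+ 2)))%:E <=
    \int[gamma]_x \int[gamma]_y (\1_opp (x, x + t * y))%:E <= (t / pi)%:E.
Proof.
move=> t0.
pose h (z : R * R) := (\1_opp (z.1, z.1 + t * z.2)%R)%:E : \bar R.
have mh : measurable_fun setT h.
  have mp : measurable_fun setT (fun z : R * R => (z.1, z.1 + t * z.2)%R).
    by apply: measurable_fun_pair => //; apply: measurable_funD => //; exact: measurable_funM.
  apply/measurable_EFinP.
  exact: (measurableT_comp (measurable_indic measurable_sign_change) mp).
have h0 z : 0 <= h z by rewrite lee_fin.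
rewrite [X in _ <= X <= _](_ : _ = \int[gamma]_y \int[gamma]_x h (x, y)); last first.
  exact: (fubini_tonelli (m1 := gamma) (m2 := gamma) h).
pose S (y : R) : set R := [set x | (x * (x + t * y) < 0)%R].
have mS y : measurable (S y).
  rewrite /S (_ : [set x | _] = (fun x => (x, x + t * y)%R) @^-1` opp)//.
  have m : measurable_fun [set: R] (fun x : R => (x, x + t * y)%R).
    by apply: measurable_fun_pair => //; exact: measurable_funD.
  by rewrite -[X in measurable X]setTI; apply: m => //; exact: measurable_sign_change.
have inn y : \int[gamma]_x h (x, y) = gamma (S y).
  transitivity (\int[gamma]_x (\1_(S y) x)%:E); first by [].
  have := @integral_indic _ (measurableTypeR R) R gamma setT measurableT (S y) (mS y).
  by rewrite setIT.
have mg : measurable_fun setT (fun y : measurableTypeR R => gamma (S y)).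
  rewrite -(_ : (fun y => \int[gamma]_x h (x, y)) = (fun y => gamma (S y))).
    exact: (measurable_fun_fubini_tonelli_G (m1 := gamma) h mh h0).
  exact/funext.
under eq_integral do rewrite inn.
have phiD (x : R) : phi x = (phi 0 * expR (- (2^-1 * x ^+ 2)))%R by exact: normal_pdf01E.
pose a (y : R) := Num.min 0%R (- (t * y))%R; pose b (y : R) := Num.max 0%R (- (t * y))%R.
have ab y : (a y <= b y)%R by rewrite /a /b; case: (leP 0%R (- (t * y))%R) => // /ltW.
have abE y : (b y - a y = t * `|y|)%R.
  have -> : (t * `|y| = `|- (t * y)|)%R by rewrite normrN normrM (ger0_norm t0).
  rewrite /a /b; case: (leP 0%R (- (t * y))%R) => H.
    by rewrite ger0_norm// subr0.
  by rewrite ltr0_norm// sub0r.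
have pi0 := @pi_gt0 R.
have p2 := normal_pdf01_sqr.
apply/andP; split.
  have <- : \int[gamma]_y ((phi 0 * t) * `|y| * expR (- (2^-1 * t ^+ 2 * y ^+ 2)))%:E =
      (t / (pi * (1 + t ^+ 2)))%:E.
    rewrite integral_gauss_abs ?mulr_ge0 ?sqr_ge0 ?normal_pdf_ge0//; congr (_%:E).
    transitivity (phi 0 ^+ 2 * t / (2^-1 * t ^+ 2 + 2^-1))%R; first by ring.
    have -> : (2^-1 * t ^+ 2 + 2^-1 = (1 + t ^+ 2) / 2)%R by field.
    have D0 : (0 < 1 + t ^+ 2)%R by rewrite ltr_pwDl// sqr_ge0.
    exact: half_div_pi.
  apply: ge0_le_integral => //.
  - by move=> y _; rewrite lee_fin !mulr_ge0 ?expR_ge0 ?normal_pdf_ge0.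
  - apply/measurable_EFinP; apply: measurable_funM.
      by apply: measurable_funM => //; exact: measurable_absr.
    exact: measurable_expR_sqr.
  - move=> y _; apply: (@le_trans _ _ (gamma `]a y, b y[%classic)); last first.
      apply: le_measure; rewrite ?inE; [exact: measurable_itv|exact: mS|move=> x /=]; rewrite in_itv/= /S /a /b /=.
      case: (leP 0%R (- (t * y))%R) => H /andP[x1 x2]; nra.
    rewrite (_ : (phi 0 * t * _ * _ = phi (t * y) * (b y - a y))%R); last first.
      have -> : (2^-1 * t ^+ 2 * y ^+ 2 = 2^-1 * (t * y) ^+ 2)%R by ring.
      by rewrite abE (phiD (t * y)%R); ring.
    apply: gaussian_itv_ge => //; first exact: normal_pdf_ge0.
    move=> x; rewrite /a /b => xab; rewrite (phiD x) (phiD (t * y)%R).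
    rewrite ler_wpM2l ?normal_pdf_ge0// ler_expR lerN2 ler_wpM2l//.
    by move: xab; case: (leP 0%R (- (t * y))%R) => H /andP[x1 x2]; nra.
have <- : \int[gamma]_y ((phi 0 * t) * `|y| * expR (- (0 * y ^+ 2)))%:E = (t / pi)%:E.
  rewrite integral_gauss_abs ?mulr_ge0 ?sqr_ge0 ?normal_pdf_ge0//; congr (_%:E).
  transitivity (phi 0 ^+ 2 * t / (0 + 2^-1))%R; first by ring.
  have -> : (0 + 2^-1 = 1 / 2 :> R)%R by rewrite add0r mul1r.
  by rewrite (half_div_pi _ p2 ltr01) mulr1.
apply: ge0_le_integral => //.
- apply/measurable_EFinP; apply: measurable_funM.
    by apply: measurable_funM => //; exact: measurable_absr.
  exact: measurable_expR_sqr.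
- move=> y _; rewrite mul0r oppr0 expR0 mulr1 -mulrA -abE.
  apply: (@le_trans _ _ (gamma `[a y, b y]%classic)).
    apply: le_measure; rewrite ?inE; [exact: mS|exact: measurable_itv|move=> x /=]; rewrite in_itv/= /S /a /b /=.
    case: (leP 0%R (- (t * y))%R) => H x1; apply/andP; split; nra.
  apply: gaussian_itv_le => //; first exact: normal_pdf_ge0.
  move=> x _; rewrite phiD ler_piMr ?normal_pdf_ge0// -[leRHS]expR0 ler_expR.
  by rewrite oppr_le0 mulr_ge0// sqr_ge0.
Qed.

End gaussian_estimates.

(** * Sign changes and small values of linear forms *)

Section lincomb_probabilities.
Context d (T : measurableType d) (R : realType) (P : probability T R)
  (xi : nat -> {RV P >-> R}).
Hypothesis xi_iid : iid_standard_gaussian xi.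
Notation gamma := (normal_prob (0 : R) 1).
Notation L := (lincomb xi).

Let mLpair n u v (A : set (R * R)) : measurable A ->
  measurable [set w | A (L n u w, L n v w)].
Proof.
move=> mA.
have m : measurable_fun setT (fun w => (L n u w, L n v w)).
  by apply: measurable_fun_pair; exact: measurable_lincomb.
by rewrite -[X in measurable X]setTI; exact: m.
Qed.

Lemma prob_lincomb_pair n u v : exists r s q : R,
  [/\ 0 <= r, 0 <= q, r ^+ 2 = dotn n u u, r * s = dotn n u v &
      s ^+ 2 + q ^+ 2 = dotn n v v] /\
  forall A : set (R * R), measurable A ->
    (P [set w | A (L n u w, L n v w)] =
    \int[gamma]_x \int[gamma]_y (\1_A (r * x, s * x + q * y)%R)%:E)%E.
Proof.
have [ind law] := xi_iid.
have [r [s [q [H E]]]] := gaussian_pair_law ind law n u v.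
exists r, s, q; split => // A mA.
rewrite -(E (fun z => (\1_A z)%:E))//; last first.
  by apply/measurable_EFinP; exact: measurable_indic.
have mB := mLpair n u v mA.
by have := @integral_indic _ T R P setT measurableT _ mB; rewrite setIT.
Qed.

Lemma measurable_lincomb_sign_change n u v :
  measurable [set w | L n u w * L n v w < 0].
Proof. exact: (mLpair n u v (@measurable_sign_change R)). Qed.

(** Gram determinant: its square root over [dotn n u v] is the tangent of the angle between the
    vectors. *)
Definition gram n (u v : nat -> R) := dotn n u u * dotn n v v - dotn n u v ^+ 2.

(** In triangular form the product of the two values is [r * s] times [x * (x + q / s * y)]. The
    factor [r * s] is the positive dot product, and [q / s] is the tangent. *)
Lemma prob_sign_change n u v : 0 < dotn n u v ->
  let t := Num.sqrt (gram n u v) / dotn n u v in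
  ((t / (pi * (1 + t ^+ 2)))%:E <= P [set w | (L n u w * L n v w < 0)%R] <=
   (t / pi)%:E)%E.
Proof.
move=> uv0 /=.
have [r [s [q [[r0 q0 rE rsE sqE] E]]]] := prob_lincomb_pair n u v.
have rp : 0 < r by rewrite lt_neqAle r0 andbT; apply: contraTneq uv0 => rr; rewrite -rsE -rr mul0r ltxx.
have sp : 0 < s by move: uv0; rewrite -rsE pmulr_rgt0.
have -> : Num.sqrt (gram n u v) / dotn n u v = q / s.
  rewrite /gram -rE -rsE -sqE (_ : _ - _ = (r * q) ^+ 2); last by ring.
  by rewrite sqrtr_sqr ger0_norm ?mulr_ge0//; field; rewrite !gt_eqF.
rewrite (E _ (@measurable_sign_change R)).
rewrite [X in (_ <= X <= _)%E](_ : _ = \int[gamma]_x \int[gamma]_y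
   (\1_[set z : R * R | (z.1 * z.2 < 0)%R] (x, x + q / s * y)%R)%:E)%E.
  by apply: gaussian_sign_change; rewrite divr_ge0// ltW.
apply: eq_integral => x _; apply: eq_integral => y _; congr (_%:E).
rewrite !indicE; congr (_%:R).
have H : (r * x * (s * x + q * y) < 0) = (x * (x + q / s * y) < 0).
  have -> : r * x * (s * x + q * y) = (r * s) * (x * (x + q / s * y)).
    by field; rewrite gt_eqF.
  by rewrite pmulr_rlt0// mulr_gt0.
by congr nat_of_bool; apply/idP/idP; rewrite !inE/= H.
Qed.

Lemma measurable_square_box (a b : R) :
  measurable [set z : R * R | `|z.1| <= a /\ `|z.2| <= b].
Proof.
rewrite (_ : [set z | _] = `[- a, a]%classic `*` `[- b, b]%classic).
  exact: measurableX.
by apply/seteqP; split => z /=; rewrite !in_itv/= !ler_norml.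
Qed.

Lemma measurable_lincomb_box n u v a b :
  measurable [set w | `|L n u w| <= a /\ `|L n v w| <= b].
Proof. exact: (mLpair n u v (measurable_square_box a b)). Qed.

Let mstrip (e k f : R) : measurable [set y : R | `|e + k * y| <= f].
Proof.
have m : measurable_fun [set: R] (fun y : R => e + k * y) by exact: measurable_funD.
rewrite (_ : [set y | _] = (fun y : R => e + k * y) @^-1` `[- f, f]%classic).
  by rewrite -[X in measurable X]setTI; exact: m.
by apply/seteqP; split => y /=; rewrite in_itv/= ler_norml.
Qed.

Let gauss_strip (q c b : R) : 0 < q -> 0 <= b ->
  (gamma [set y | `|c + q * y| <= b]%R <= (2 * b / q)%:E)%E.
Proof.
move=> q0 b0.
have -> : [set y | `|c + q * y| <= b]%R = `[((- b - c) / q)%R, ((b - c) / q)%R]%classic.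
  apply/seteqP; split => y /=; rewrite in_itv/= ler_norml ler_pdivrMr// ler_pdivlMr//;
  by move=> /andP[h1 h2]; apply/andP; split; lra.
apply: (@le_trans _ _ (1 * ((b - c) / q - (- b - c) / q))%:E).
  apply: gaussian_itv_le => //; first by rewrite ler_pM2r ?invr_gt0//; lra.
  by move=> x _; exact: normal_pdf01_le1.
by rewrite lee_fin mul1r -mulrBl ler_pM2r ?invr_gt0//; lra.
Qed.

(** In triangular form the first constraint confines [x] to an interval of length [2 * a / r], and
    for each [x] the second confines [y] to one of length [2 * b / q]. The density is at most 1, and
    [r * q] is the square root of the Gram determinant. *)
Lemma prob_small_box n u v a b : 0 <= a -> 0 <= b -> 0 < gram n u v ->
  (P [set w | (`|L n u w| <= a)%R /\ (`|L n v w| <= b)%R] <=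
   (4 * a * b / Num.sqrt (gram n u v))%:E)%E.
Proof.
move=> a0 b0 g0.
have [r [s [q [[r0 q0 rE rsE sqE] E]]]] := prob_lincomb_pair n u v.
have gE : gram n u v = (r * q) ^+ 2 by rewrite /gram -rE -rsE -sqE; ring.
have rq : 0 < r * q.
  rewrite lt_neqAle mulr_ge0// andbT; apply: contraTneq g0 => h.
  by rewrite gE -h expr0n ltxx.
have rp : 0 < r by rewrite lt_neqAle r0 andbT; apply: contraTneq rq => <-; rewrite mul0r ltxx.
have qp : 0 < q by rewrite lt_neqAle q0 andbT; apply: contraTneq rq => <-; rewrite mulr0 ltxx.
rewrite gE sqrtr_sqr gtr0_norm//.
rewrite (E _ (measurable_square_box a b)).
set A := [set y : R | `|0 + r * y| <= a].
apply: (@le_trans _ _ (\int[gamma]_x ((2 * b / q)%:E * (\1_A x)%:E))%E).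
  apply: ge0_le_integral => //.
  - by move=> x _; apply: integral_ge0 => y _; rewrite lee_fin.
  - have mm : measurable_fun setT (fun z : R * R =>
        (\1_[set z : R * R | `|z.1| <= a /\ `|z.2| <= b] (r * z.1, s * z.1 + q * z.2))%:E : \bar R).
      apply/measurable_EFinP.
      have mp : measurable_fun setT (fun z : R * R => (r * z.1, s * z.1 + q * z.2)).
        by apply: measurable_fun_pair => //; [exact: measurable_funM|apply: measurable_funD; exact: measurable_funM].
      exact: (measurableT_comp (measurable_indic (measurable_square_box a b)) mp).
    apply: (measurable_fun_fubini_tonelli_F (m2 := gamma) _ mm).
    by move=> z; rewrite lee_fin.
  - apply: emeasurable_funM => //; apply/measurable_EFinP; apply: measurable_indic.
    exact: mstrip.
  - move=> x _.
    apply: (@le_trans _ _ (\int[gamma]_y ((\1_A x)%:E * (\1_[set y | `|s * x + q * y| <= b]%R y)%:E))%E).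
      apply: ge0_le_integral => //.
      + apply/measurable_EFinP.
        have mp : measurable_fun setT (fun y : R => (r * x, s * x + q * y)).
          by apply: measurable_fun_pair => //; apply: measurable_funD => //; exact: measurable_funM.
        exact: (measurableT_comp (measurable_indic (measurable_square_box a b)) mp).
      + apply: emeasurable_funM => //; apply/measurable_EFinP; apply: measurable_indic.
        exact: mstrip.
      + move=> y _; rewrite -EFinM lee_fin !indicE -natrM mulnb ler_nat.
        case: (boolP (_ \in _)) => //; rewrite inE/= => -[h1 h2].
        by rewrite !mem_set// /A/= add0r.
    rewrite ge0_integralZl//; last first.
      by apply/measurable_EFinP; apply: measurable_indic; exact: mstrip.
    rewrite muleC; apply: lee_wpmul2r; first by rewrite lee_fin.
    rewrite (_ : integral _ _ _ = gamma [set y | `|s * x + q * y| <= b]%R).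
      exact: gauss_strip.
    have := @integral_indic _ (measurableTypeR R) R gamma setT measurableT _ (mstrip (s * x) q b).
    by rewrite setIT.
rewrite ge0_integralZl//; last 2 first.
- by apply/measurable_EFinP; apply: measurable_indic; exact: mstrip.
- by rewrite lee_fin divr_ge0 ?mulr_ge0.
have := @integral_indic _ (measurableTypeR R) R gamma setT measurableT _ (mstrip 0 r a).
rewrite setIT => ->.
apply: (@le_trans _ _ ((2 * b / q)%:E * (2 * a / r)%:E)%E).
  apply: lee_wpmul2l; first by rewrite lee_fin divr_ge0 ?mulr_ge0.
  exact: gauss_strip.
rewrite -EFinM lee_fin le_eqVlt; apply/orP; left; apply/eqP.
by field; rewrite !gt_eqF.
Qed.

Lemma prob_small_ball n u a : 0 <= a -> 0 < dotn n u u ->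
  (P [set w | (`|L n u w| <= a)%R] <= (2 * a / Num.sqrt (dotn n u u))%:E)%E.
Proof.
move=> a0 uu0.
have [r [s [q [[r0 q0 rE rsE sqE] E]]]] := prob_lincomb_pair n u u.
have rp : 0 < r by rewrite lt_neqAle r0 andbT; apply: contraTneq uu0 => h; rewrite -rE -h expr0n ltxx.
rewrite -rE sqrtr_sqr gtr0_norm//.
have mA : measurable [set z : R * R | `|z.1| <= a].
  rewrite (_ : [set z | _] = `[- a, a]%classic `*` setT); first exact: measurableX.
  by apply/seteqP; split => z /=; rewrite !in_itv/= ler_norml//; case.
rewrite (E _ mA).
rewrite [X in (X <= _)%E](_ : _ = gamma [set x : R | `|0 + r * x| <= a]%R).
  exact: gauss_strip.
have := @integral_indic _ (measurableTypeR R) R gamma setT measurableT _ (mstrip 0 r a).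
rewrite setIT => <-; apply: eq_integral => x _.
transitivity (\int[gamma]_y (cst (\1_[set x0 : R | `|0 + r * x0| <= a]%R x)%:E y))%E.
  apply: eq_integral => y _; congr (_%:E); rewrite !indicE; congr (_%:R).
  by congr nat_of_bool; apply/idP/idP; rewrite !inE/= add0r.
by rewrite integral_cst//= probability_setT mule1.
Qed.

Lemma measurable_lincomb_eq0 n u : measurable [set w | L n u w = 0].
Proof.
have -> : [set w | L n u w = 0] = L n u @^-1` [set 0] by [].
by rewrite -[X in measurable X]setTI; apply: measurable_lincomb.
Qed.

Lemma measurable_lincomb_le n u a : measurable [set w | `|L n u w| <= a].
Proof.
have -> : [set w | `|L n u w| <= a] = L n u @^-1` `[- a, a]%classic.
  by apply/seteqP; split => y /=; rewrite in_itv/= ler_norml.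
by rewrite -[X in measurable X]setTI; apply: measurable_lincomb.
Qed.

Lemma prob_lincomb_eq0 n u : 0 < dotn n u u -> P [set w | L n u w = 0] = 0%E.
Proof.
move=> uu0; apply/eqP; rewrite -measure_le0.
apply: (@le_trans _ _ (P [set w | (`|L n u w| <= 0)%R])).
  apply: le_measure; rewrite ?inE.
  - exact: measurable_lincomb_eq0.
  - exact: measurable_lincomb_le.
  - by move=> w /= ->; rewrite normr0.
by apply: (le_trans (prob_small_ball (lexx 0) uu0)); rewrite mulr0 mul0r.
Qed.

End lincomb_probabilities.

Lemma prob_tail d (T : measurableType d) (R : realType) (P : probability T R)
    (F : T -> R) (e : R) : measurable_fun setT F -> 0 < e ->
  exists2 M : R, 0 < M & (P [set w | (M < F w)%R] <= e%:E)%E.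
Proof.
move=> mF e0.
pose X : {RV P >-> R} := HB.pack F (isMeasurableFun.Build _ _ _ _ F mF).
have := @cvg_ccdfy0 _ _ _ _ X.
move=> /fine_cvgP[_] /cvgrPdist_le/(_ _ e0) /=.
move=> [M [Mr HM]].
exists (Num.max 1 (M + 1)); first by rewrite lt_max ltr01.
have M1 : M < Num.max 1 (M + 1) by rewrite lt_max ltrDl ltr01 orbT.
move: (HM _ M1); rewrite sub0r normrN ger0_norm ?fine_ge0//.
move=> h; rewrite -lee_fin fineK ?fin_num_measure// in h.
rewrite (le_trans _ h)// /ccdf /distribution/= /pushforward/=.
rewrite (_ : [set w | _] = F @^-1` `]Num.max 1 (M + 1), +oo[%classic)//.
by apply/seteqP; split => w /=; rewrite in_itv/= andbT.
Qed.

(** * Counting real roots with multiplicity *)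

Section root_counting.
Context {R : realType}.
Implicit Types (p q : {poly R}) (s : seq R).

(** Linear factors are removed by induction on the size. The list [s] holds the roots with
    multiplicity and turns statements on [nroots] into statements on [count]. *)
Lemma real_roots_decomp p : p != 0 -> exists s q,
  p = q * \prod_(z <- s) ('X - z%:P) /\ forall x, ~~ root q x.
Proof.
elim: {p}(size p) {-2}p (leqnn (size p)) => [|n IH] p sp p0.
  by move: sp; rewrite leqn0 size_poly_eq0 (negbTE p0).
have [[x px]|nr] := pselect (exists x, root p x); last first.
  by exists [::], p; rewrite big_nil mulr1; split => // x; apply/negP => px; apply: nr; exists x.
have /factor_theorem[g gE] := px.
have g0 : g != 0 by apply: contraNneq p0 => g0; rewrite gE g0 mul0r.
have [|s [q [qE qr]]] := IH g _ g0.
  by move: sp; rewrite gE size_Mmonic ?monicXsubC// size_XsubC addn2.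
by exists (x :: s), q; split => //; rewrite big_cons mulrCA -qE mulrC -gE.
Qed.

Lemma mup_decomp (F : fieldType) (q : {poly F}) (s : seq F) z : ~~ root q z ->
  mup z (q * \prod_(x <- s) ('X - x%:P)) = count_mem z s.
Proof.
move=> qz; rewrite mupMr//; elim: s => [|x s IH]; first by rewrite big_nil mupNroot ?root1.
rewrite big_cons mupM ?polyXsubC_eq0 ?IH//=; last first.
  by rewrite monic_neq0// monic_prod_XsubC.
by rewrite -['X - _]expr1 mup_XsubCX; case: eqP.
Qed.

Lemma mup0 (F : fieldType) (z : F) : mup z 0 = 0%N.
Proof.
have H : forall i : 'I_(size (0 : {poly F})).+1, i = 0%N :> nat.
  by rewrite size_poly0 => -[[|i]].
by rewrite /mup H.
Qed.

Lemma nroots0 (F : fieldType) (S : set F) : nroots 0 S = 0%N.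
Proof. by rewrite /nroots fsbig1// => z _; rewrite mup0. Qed.

(** The cofactor [q] has no root at a real point, before or after the embedding, so both
    multiplicities are counts of the same list of real roots. *)
Lemma mup_map_real (p : {poly R}) (x : R) :
  mup (x%:C)%C (map_poly (real_complex R) p) = mup x p.
Proof.
have [->|p0] := eqVneq p 0; first by rewrite rmorph0 !mup0.
have [s [q [-> qr]]] := real_roots_decomp p0.
rewrite rmorphM rmorph_prod /= mup_decomp//.
under eq_bigr do rewrite map_polyXsubC.
rewrite -(big_map (real_complex R) xpredT (fun z => 'X - z%:P)) mup_decomp ?fmorph_root//.
rewrite count_map; apply: eq_count => y /=.
by apply/eqP/eqP => [[]|->].
Qed.

Lemma nroots_unit_interval (p : {poly R}) :
  nroots (map_poly (real_complex R) p) (@unit_interval R) = nroots p `]0, 1[.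
Proof.
have -> : unit_interval (R:=R) = (real_complex R) @` `]0, 1[.
  by apply/seteqP; split => [_ [x /= x01 <-]|_ [x + <-]]; [exists x => //=; rewrite in_itv|rewrite /= in_itv => x01; exists x].
rewrite /nroots fsbig_image; last by move=> x y _ _ [].
by apply: eq_fsbigr => x _; rewrite mup_map_real.
Qed.

Lemma mem_set_itv_oc (x y z : R) : (z \in `]x, y]%classic) = (x < z <= y).
Proof. by apply/idP/idP; rewrite inE/= in_itv. Qed.

Lemma nroots_count p q s (S : set R) :
  p = q * \prod_(z <- s) ('X - z%:P) -> (forall x, ~~ root q x) ->
  nroots p S = count (fun z => z \in S) s.
Proof.
move=> pE qr; rewrite /nroots.
have mE z : mup z p = count_mem z s by rewrite pE mup_decomp.
under eq_fsbigr do rewrite mE.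
rewrite (fsbigE [seq z <- undup s | z \in S]) ?filter_uniq ?undup_uniq//=; last 2 first.
- by move=> z /=; rewrite mem_filter => /andP[/set_mem].
- move=> z zS; rewrite mem_filter mem_undup mem_set//= => zs.
  by apply/eqP; rewrite -leqn0 leqNgt -has_count has_pred1.
rewrite big_filter_cond; under eq_bigl do rewrite andbb.
rewrite -sum1_count -[RHS](big_undup_iterop_count addn).
apply: eq_bigr => z _; elim: (count_mem _ _) => // m IH.
by rewrite Monoid.iteropE /= -Monoid.iteropE -IH add1n.
Qed.

Lemma nroots_le_size p (S : set R) : (nroots p S <= (size p).-1)%N.
Proof.
have [->|p0] := eqVneq p 0; first by rewrite nroots0.
have [s [q [pE qr]]] := real_roots_decomp p0.
rewrite (nroots_count _ pE qr) (leq_trans (count_size _ _))//.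
have q0 : q != 0 by apply: contraNneq p0 => q0; rewrite pE q0 mul0r.
rewrite pE size_Mmonic ?monic_prod_XsubC// size_prod_XsubC addnS/=.
by rewrite -(prednK (n := size q)) ?lt0n ?size_poly_eq0// addSn leq_addl.
Qed.

Lemma nroots_setU_le p (A B : set R) :
  (nroots p (A `|` B) <= nroots p A + nroots p B)%N.
Proof.
have [->|p0] := eqVneq p 0; first by rewrite !nroots0.
have [s [q [pE qr]]] := real_roots_decomp p0.
rewrite !(nroots_count _ pE qr) -count_predUI.
rewrite (leq_trans _ (leq_addr _ _))// sub_count// => z /=.
by rewrite in_setU.
Qed.

Lemma nroots_subset p (A B : set R) : A `<=` B -> (nroots p A <= nroots p B)%N.
Proof.
have [->|p0] := eqVneq p 0; first by rewrite !nroots0.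
have [s [q [pE qr]]] := real_roots_decomp p0.
move=> AB; rewrite !(nroots_count _ pE qr) sub_count// => z.
by rewrite !inE; exact: AB.
Qed.

Lemma nroots_partition p (x : nat -> R) K : {homo x : i j / (i <= j)%N >-> i <= j} ->
  nroots p `]x 0%N, x K]%classic = (\sum_(i < K) nroots p `]x i, x i.+1]%classic)%N.
Proof.
move=> xmono.
have [->|p0] := eqVneq p 0.
  by rewrite nroots0 big1// => i _; rewrite nroots0.
have [s [q [pE qr]]] := real_roots_decomp p0.
rewrite !(nroots_count _ pE qr).
under eq_bigr do rewrite (nroots_count _ pE qr).
elim: K => [|K IH].
  by rewrite big_ord0; apply/eqP; rewrite -leqn0 leqNgt -has_count; apply/hasPn => z _; rewrite mem_set_itv_oc; case: leP; rewrite ?andbF.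
rewrite big_ord_recr/= -IH -count_predUI.
rewrite [X in (_ + X)%N](_ : _ = 0%N) ?addn0; last first.
  apply/eqP; rewrite -leqn0 leqNgt -has_count; apply/hasPn => z _ /=.
  by rewrite !mem_set_itv_oc; apply/negP => /andP[/andP[_ h1] /andP[h2 _]]; move: (lt_le_trans h2 h1); rewrite ltxx.
apply: eq_count => z /=; apply/idP/idP; rewrite !mem_set_itv_oc.
  by move=> /andP[h1 h2]; rewrite h1 h2 andbT/=; case: leP.
move=> /orP[/andP[-> h2]|/andP[h1 ->]]; rewrite ?andbT /=.
  by rewrite (le_trans h2)// xmono.
by rewrite (le_lt_trans _ h1)// xmono.
Qed.

Lemma nroots_gt0 p z (S : set R) : p != 0 -> root p z -> S z -> (0 < nroots p S)%N.
Proof.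
move=> p0 pz Sz; have [s [q [pE qr]]] := real_roots_decomp p0.
rewrite (nroots_count _ pE qr) -has_count; apply/hasP; exists z; last by rewrite inE.
move: pz; rewrite pE rootM (negbTE (qr z))/= root_prod_XsubC//.
Qed.

Lemma nroots_sign_change p x y : x <= y -> p.[x] * p.[y] < 0 ->
  (0 < nroots p `]x, y]%classic)%N.
Proof.
move=> xy pxy; have [z zxy pz] := polyrcf.poly_ivtoo xy pxy.
apply: (nroots_gt0 _ pz); last first.
  by move: zxy; rewrite /= !in_itv/= => /andP[-> /ltW].
by apply: contraTneq pxy => ->; rewrite !horner0 mul0r ltxx.
Qed.

(** Without the linear factor of the only root, the cofactor [g] cannot change sign on the cell, as
    a zero of it would be a second root. The linear factor does change sign. *)
Lemma nroots_eq1_sign p x y : p.[x] != 0 -> p.[y] != 0 ->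
  nroots p `]x, y]%classic = 1%N -> p.[x] * p.[y] < 0.
Proof.
move=> px py n1.
have p0 : p != 0 by apply: contraNneq px => ->; rewrite horner0.
have [s [q [pE qr]]] := real_roots_decomp p0.
move: n1; rewrite (nroots_count _ pE qr).
set a := fun z => z \in _; rewrite -size_filter => /eqP.
case E : [seq z <- s | a z] => [|z [|]]//= _.
have zI : a z by have := mem_head z [::]; rewrite -E mem_filter => /andP[].
have zs : z \in s by have := mem_head z [::]; rewrite -E mem_filter => /andP[].
move: zI; rewrite /a mem_set_itv_oc => /andP[xz zy].
pose g := q * \prod_(u <- rem z s) ('X - u%:P).
have pg : p = g * ('X - z%:P).
  by rewrite pE (perm_big _ (perm_to_rem zs))/= big_cons /g mulrCA mulrC.
have zy' : z < y.
  rewrite lt_neqAle zy andbT; apply: contraNneq py => <-.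
  by rewrite pg hornerM hornerXsubC subrr mulr0.
have xy : x <= y by rewrite ltW// (lt_trans xz).
have gxy : 0 < g.[x] * g.[y].
  rewrite ltNge; apply/negP => /(polyrcf.poly_ivt xy)[u].
  rewrite in_itv/= => /andP[xu uy] gu.
  have xu' : x < u.
    rewrite lt_neqAle xu andbT; apply: contraNneq px => ->.
    by rewrite pg hornerM (eqP gu) mul0r.
  have : u \in rem z s.
    by move: gu; rewrite /g rootM (negbTE (qr u))/= root_prod_XsubC.
  have : ~~ has a (rem z s).
    have := perm_filter a (perm_to_rem zs); rewrite E => /perm_size/=.
    have -> : a z by rewrite /a mem_set_itv_oc xz zy.
    by move=> /= [] /esym /eqP; rewrite size_filter -leqn0 leqNgt -has_count.
  by move=> /hasPn h /h; rewrite /a mem_set_itv_oc xu' uy.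
move: gxy; rewrite pg !(hornerM g) !hornerXsubC mulrACA => gxy; rewrite pmulr_rlt0//.
by rewrite nmulr_rlt0 ?subr_gt0// subr_lt0.
Qed.

(** Either the two roots coincide, and the derivative vanishes at the same point, or Rolle's theorem
    gives a zero of it between them. *)
Lemma nroots_ge2 p x y : p != 0 -> (1 < nroots p `]x, y]%classic)%N ->
  exists z z', [/\ x <= z <= y, x <= z' <= y, p.[z] = 0 & p^`().[z'] = 0].
Proof.
move=> p0; have [s [q [pE qr]]] := real_roots_decomp p0.
rewrite (nroots_count _ pE qr).
set a := fun z => z \in _; rewrite -size_filter.
case E : [seq z <- s | a z] => [|z1 [|z2 l]]//= _.
have Hin z : z \in [seq z <- s | a z] -> x <= z <= y.
  by rewrite mem_filter /a mem_set_itv_oc => /andP[/andP[/ltW -> ->]].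
have H1 : x <= z1 <= y by apply: Hin; rewrite E mem_head.
have H2 : x <= z2 <= y by apply: Hin; rewrite E !inE eqxx orbT.
pose g := q * \prod_(u <- l ++ [seq z <- s | predC a z]) ('X - u%:P).
have pg : p = g * ('X - z1%:P) * ('X - z2%:P).
  have -> : p = q * \prod_(u <- [seq z <- s | a z] ++ [seq z <- s | predC a z]) ('X - u%:P).
    by rewrite pE; congr (_ * _); apply: perm_big; rewrite perm_sym perm_filterC.
  rewrite E/= !big_cons /g; ring.
have [z12|z12] := eqVneq z1 z2.
  exists z1, z1; split => //; first by rewrite pg z12 hornerM hornerXsubC subrr mulr0.
  by rewrite pg z12 !derivM !hornerE subrr; ring.
have pz1 : p.[z1] = 0 by rewrite pg !hornerE subrr; ring.
have pz2 : p.[z2] = 0 by rewrite pg !hornerE subrr; ring.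
case: (ltgtP z1 z2) z12 => // [lt|lt] _.
  have [|c] := polyrcf.poly_rolle (p := p) lt; first by rewrite pz1 pz2.
  rewrite in_itv/= => /andP[c1 c2] pc; exists z1, c; split => //.
  by move: H1 H2 => /andP[? ?] /andP[? ?]; apply/andP; split; lra.
have [|c] := polyrcf.poly_rolle (p := p) lt; first by rewrite pz1 pz2.
rewrite in_itv/= => /andP[c1 c2] pc; exists z1, c; split => //.
by move: H1 H2 => /andP[? ?] /andP[? ?]; apply/andP; split; lra.
Qed.

Lemma poly_deriv_lipschitz p (a b M x y : R) :
  (forall c, a <= c <= b -> `|p^`().[c]| <= M) -> a <= x <= b -> a <= y <= b ->
  `|p.[x] - p.[y]| <= M * `|x - y|.
Proof.
move=> pM; wlog xy : x y / x < y.
  move=> H Hx Hy; case: (ltgtP x y) => [lt|lt|->]; first exact: H.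
    by rewrite distrC [`|x - y|]distrC; exact: H.
  by rewrite !subrr normr0 mulr0.
move=> /andP[ax xb] /andP[ay yb]; rewrite distrC [`|x - y|]distrC.
have [c cxy ->] := polyrcf.poly_mvt p xy.
rewrite normrM ler_wpM2r// pM//.
move: cxy; rewrite in_itv/= => /andP[c1 c2]; apply/andP; split; lra.
Qed.

(** With two roots in the cell the derivative vanishes somewhere, so it is at most [M * (y - x)]
    throughout; as [p] vanishes too, it is at most [M * (y - x) ^+ 2]. This exceptional case is
    charged the maximal count [n]. *)
Lemma nroots_cell p (x y M : R) (n : nat) : x <= y ->
  p.[x] != 0 -> p.[y] != 0 -> (nroots p `]x, y]%classic <= n)%N ->
  (forall c, x <= c <= y -> `|p^`()^`().[c]| <= M) ->
  (nroots p `]x, y]%classic <= (p.[x] * p.[y] < 0)%R +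
    n * ((`|p.[x]| <= M * (y - x) ^+ 2) && (`|p^`().[x]| <= M * (y - x)))%R)%N.
Proof.
move=> xy px py Nn pM.
have p0 : p != 0 by apply: contraNneq px => ->; rewrite horner0.
case E : (nroots _ _) Nn => [|[|k]] //.
  by rewrite (nroots_eq1_sign px py E).
move=> Nn; have : (1 < nroots p `]x, y]%classic)%N by rewrite E.
move=> /(nroots_ge2 p0)[z [z' [zI zI' pz pz']]].
have xI : x <= x <= y by rewrite lexx.
have M0 : 0 <= M by rewrite (le_trans _ (pM x xI)).
have D0 : 0 <= y - x by rewrite subr_ge0.
have dp c : x <= c <= y -> `|p^`().[c]| <= M * (y - x).
  move=> cI; rewrite -[p^`().[c]]subr0 -pz'.
  rewrite (le_trans (poly_deriv_lipschitz pM cI zI'))// ler_wpM2l//.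
  by move: cI zI' => /andP[? ?] /andP[? ?]; rewrite ler_norml; apply/andP; split; lra.
rewrite dp// andbT -[p.[x]]subr0 -pz.
rewrite (le_trans (poly_deriv_lipschitz dp xI zI)) ?muln1 ?(leq_trans Nn) ?leq_addl//.
rewrite expr2 mulrA ler_wpM2l ?mulr_ge0//.
by move: zI => /andP[? ?]; rewrite ler_norml; apply/andP; split; lra.
Qed.

End root_counting.

(** * Gram determinants of the coefficient vectors and the variance of the index *)

Section lagrange_identity.
Context {R : realType}.
Implicit Types (u v : nat -> R).

(** Lagrange's identity: the expanded squares give every product twice. *)
Lemma gram_sum n u v :
  gram n u v = 2^-1 * \sum_(i < n) \sum_(j < n) (u i * v j - u j * v i) ^+ 2.
Proof.
have E : \sum_(i < n) \sum_(j < n) (u i * v j - u j * v i) ^+ 2 =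
   dotn n u u * dotn n v v + dotn n v v * dotn n u u - 2 * (dotn n u v * dotn n u v).
  rewrite /dotn !big_distrlr /= mulr_sumr -big_split -sumrB/=.
  apply: eq_bigr => i _; rewrite mulr_sumr -big_split -sumrB/=.
  by apply: eq_bigr => j _; ring.
by rewrite E /gram; field.
Qed.

(** The minor occurs twice in the double sum, for [(k, l)] and for [(l, k)], which compensates the
    factor 1/2. *)
Lemma gram_ge_pair n u v k l : (k < n)%N -> (l < n)%N ->
  (u k * v l - u l * v k) ^+ 2 <= gram n u v.
Proof.
move=> kn ln; have [->|kl] := eqVneq k l.
  rewrite subrr expr0n gram_sum mulr_ge0// sumr_ge0// => i _.
  by rewrite sumr_ge0// => j _; rewrite sqr_ge0.
pose K := Ordinal kn; pose L := Ordinal ln.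
have KL : L != K by rewrite -val_eqE/= eq_sym.
rewrite gram_sum (bigD1 K)//= (bigD1 L (P := [pred i | i != K]))//=.
have pos (Q : pred 'I_n) i : 0 <= \sum_(j < n | Q j) (u i * v j - u j * v i) ^+ 2.
  by rewrite sumr_ge0// => j _; rewrite sqr_ge0.
rewrite (bigD1 L)//= [X in _ + (X + _)](bigD1 K)//=.
have h1 := pos (fun j => j != L) k; have h2 := pos (fun j => j != K) l.
have h3 : 0 <= \sum_(i < n | (i != K) && (i != L)) \sum_(j < n) (u i * v j - u j * v i) ^+ 2.
  by rewrite sumr_ge0// => i _; exact: pos xpredT _.
have e : (u l * v k - u k * v l) ^+ 2 = (u k * v l - u l * v k) ^+ 2 by ring.
rewrite /= in h1 h2 h3; lra.
Qed.

(** Factoring out [expR (- z)] leaves [expR (2 * z) - 1], which is at least [2 * z]. Together with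
    the companion bound this compares a squared hyperbolic sine with its squared argument. *)
Lemma expR_diff_sqr_ge (z e : R) : `|z| <= e ->
  expR (- (2 * e)) * (2 * z) ^+ 2 <= (expR z - expR (- z)) ^+ 2.
Proof.
wlog z0 : z / 0 <= z.
  move=> H; case: (lerP 0 z) => [|/ltW]; first exact: H.
  rewrite -oppr_ge0 -normrN => z0 /(H _ z0); rewrite opprK.
  by rewrite mulrN sqrrN -[(expR (- z) - _) ^+ 2]sqrrN opprB.
rewrite ger0_norm// => ze.
have h : 2 * z <= expR (2 * z) - 1 by have := expR_ge1Dx (2 * z); lra.
have -> : expR z - expR (- z) = expR (- z) * (expR (2 * z) - 1).
  by rewrite mulrBr mulr1 -expRD; congr (expR _ - _); ring.
rewrite [leRHS]exprMn ler_pM ?expR_ge0 ?sqr_ge0//.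
  by rewrite expr2 -expRD ler_expR; lra.
by rewrite ler_pXn2r ?nnegrE//; lra.
Qed.

Lemma expR_diff_sqr_le (z e : R) : `|z| <= e ->
  (expR z - expR (- z)) ^+ 2 <= expR (2 * e) * (2 * z) ^+ 2.
Proof.
wlog z0 : z / 0 <= z.
  move=> H; case: (lerP 0 z) => [|/ltW]; first exact: H.
  rewrite -oppr_ge0 -normrN => z0 /(H _ z0); rewrite opprK.
  by rewrite mulrN sqrrN -[(expR (- z) - _) ^+ 2]sqrrN opprB.
rewrite ger0_norm// => ze.
have h : 1 - expR (- (2 * z)) <= 2 * z by have := expR_ge1Dx (- (2 * z)); lra.
have h0 : 0 <= 1 - expR (- (2 * z)).
  by rewrite subr_ge0 -[leRHS]expR0 ler_expR; lra.
have -> : expR z - expR (- z) = expR z * (1 - expR (- (2 * z))).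
  by rewrite mulrBr mulr1 -expRD; congr (_ - expR _); ring.
rewrite [leLHS]exprMn ler_pM ?sqr_ge0//.
  by rewrite expr2 -expRD ler_expR; lra.
by rewrite ler_pXn2r ?nnegrE//; lra.
Qed.

(* The moments of the weights [c m ^+ 2 * x ^+ (2 * m)] at [x = expR (- y / 2)]. *)
Definition wmoment (c : nat -> R) n j (y : R) : R :=
  \sum_(m < n.+1) m%:R ^+ j * c m ^+ 2 * expR (- (m%:R * y)).

Definition wvar c n y : R :=
  wmoment c n 2 y / wmoment c n 0 y - (wmoment c n 1 y / wmoment c n 0 y) ^+ 2.

Definition monomials (c : nat -> R) (x : R) : nat -> R := fun m => c m * x ^+ m.

Lemma expRXn (n : nat) (y : R) : expR (- (n%:R * y)) = expR (- y / 2) ^+ n * expR (- y / 2) ^+ n.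
Proof. by rewrite -exprMn -expRD -expRM_natl; congr expR; field. Qed.

(** The product of the two powers of index [m] is [expR (- m * (y1 + y2) / 2)]: only the midpoint
    enters. *)
Lemma dotn_monomials c n (y1 y2 : R) :
  dotn n.+1 (monomials c (expR (- y1 / 2))) (monomials c (expR (- y2 / 2))) =
  wmoment c n 0 ((y1 + y2) / 2).
Proof.
apply: eq_bigr => m _; rewrite /monomials expr0 mul1r mulrACA -expr2; congr (_ * _).
by rewrite -exprMn -expRD -expRM_natl; congr expR; field.
Qed.

(** Lagrange's identity for the vectors [u m] and [m * u m]; this is the variance, up to
    [wmoment c n 0 y ^+ 2], as a sum over pairs of indices. *)
Lemma wmoment_gram c n y :
  wmoment c n 0 y * wmoment c n 2 y - wmoment c n 1 y ^+ 2 =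
  2^-1 * \sum_(i < n.+1) \sum_(j < n.+1)
     (c i ^+ 2 * expR (- (i%:R * y))) * (c j ^+ 2 * expR (- (j%:R * y))) * (i%:R - j%:R) ^+ 2.
Proof.
pose u (m : nat) := c m * expR (- y / 2) ^+ m.
pose v (m : nat) := m%:R * u m.
have <- : gram n.+1 u v = wmoment c n 0 y * wmoment c n 2 y - wmoment c n 1 y ^+ 2.
  rewrite /gram; congr (_ * _ - _ ^+ 2); apply: eq_bigr => m _; rewrite /v /u expRXn; ring.
rewrite gram_sum; congr (_ * _); apply: eq_bigr => i _; apply: eq_bigr => j _.
by rewrite /v /u !expRXn; ring.
Qed.

Lemma wmoment_gram_ge0 c n y :
  0 <= wmoment c n 0 y * wmoment c n 2 y - wmoment c n 1 y ^+ 2.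
Proof.
rewrite wmoment_gram mulr_ge0// sumr_ge0// => i _; rewrite sumr_ge0// => j _.
by apply: mulr_ge0 (sqr_ge0 _); apply: mulr_ge0; rewrite mulr_ge0 ?sqr_ge0 ?expR_ge0.
Qed.

(** In each minor a factor [expR (- (i + j) * y / 2)] splits off, and what remains depends on [h]
    and on [i - j] only. *)
Lemma gram_monomials_sum c n (y h : R) :
  gram n.+1 (monomials c (expR (- (y + h) / 2))) (monomials c (expR (- (y - h) / 2))) =
  2^-1 * \sum_(i < n.+1) \sum_(j < n.+1)
     (c i ^+ 2 * expR (- (i%:R * y))) * (c j ^+ 2 * expR (- (j%:R * y))) *
     (expR ((i%:R - j%:R) * h / 2) - expR (- ((i%:R - j%:R) * h / 2))) ^+ 2.
Proof.
rewrite gram_sum; congr (_ * _); apply: eq_bigr => i _; apply: eq_bigr => j _.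
rewrite /monomials -!expRM_natl.
set p := expR (_ * _ / 2); set q := expR (- (_ * _ / 2)).
pose r := expR (- ((i%:R + j%:R) * y / 2)).
have ab : expR (i%:R * (- (y + h) / 2)) * expR (j%:R * (- (y - h) / 2)) = r * q.
  by rewrite /r /q -!expRD; congr expR; field.
have ef : expR (j%:R * (- (y + h) / 2)) * expR (i%:R * (- (y - h) / 2)) = r * p.
  by rewrite /r /p -!expRD; congr expR; field.
have rr : r ^+ 2 = expR (- (i%:R * y)) * expR (- (j%:R * y)).
  by rewrite expr2 /r -!expRD; congr expR; field.
rewrite mulrACA ab [c j * _ * _]mulrACA ef.
transitivity (c i ^+ 2 * c j ^+ 2 * r ^+ 2 * (p - q) ^+ 2); first by ring.
by rewrite rr; ring.
Qed.

Lemma natr_dist_le (n : nat) (i j : 'I_n.+1) : `|i%:R - j%:R| <= n%:R :> R.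
Proof.
have hi : i%:R <= n%:R :> R by rewrite ler_nat -ltnS.
have hj : j%:R <= n%:R :> R by rewrite ler_nat -ltnS.
have := ler0n R i; have := ler0n R j.
by rewrite ler_norml => h1 h2; apply/andP; split; lra.
Qed.

(** Term by term against [wmoment_gram]: as [|i - j| <= n], each squared difference of exponentials
    is [((i - j) * h) ^+ 2] up to a factor between [expR (- (n * h))] and [expR (n * h)]. For fixed
    [n] these factors tend to 1 with the step. *)
Lemma gram_monomials_bounds c n (y h : R) : 0 <= h ->
  let D := wmoment c n 0 y * wmoment c n 2 y - wmoment c n 1 y ^+ 2 in
  let g := gram n.+1 (monomials c (expR (- (y + h) / 2))) (monomials c (expR (- (y - h) / 2))) in
  expR (- (n%:R * h)) * h ^+ 2 * D <= g <= expR (n%:R * h) * h ^+ 2 * D.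
Proof.
move=> h0 /=; rewrite wmoment_gram gram_monomials_sum.
have E k : k * h ^+ 2 * (2^-1 * \sum_(i < n.+1) \sum_(j < n.+1)
     c i ^+ 2 * expR (- (i%:R * y)) * (c j ^+ 2 * expR (- (j%:R * y))) * (i%:R - j%:R) ^+ 2) =
   2^-1 * \sum_(i < n.+1) \sum_(j < n.+1)
     c i ^+ 2 * expR (- (i%:R * y)) * (c j ^+ 2 * expR (- (j%:R * y))) *
     (k * (2 * ((i%:R - j%:R) * h / 2)) ^+ 2).
  rewrite mulrCA; congr (_ * _); rewrite mulr_sumr; apply: eq_bigr => i _.
  rewrite mulr_sumr; apply: eq_bigr => j _; by field.
have ez (i j : 'I_n.+1) : `|(i%:R - j%:R) * h / 2| <= n%:R * h / 2.
  rewrite !normrM (ger0_norm h0) (ger0_norm (x := 2^-1))// ler_wpM2r// ler_wpM2r//.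
  exact: natr_dist_le.
have e2 : n%:R * h = 2 * (n%:R * h / 2) by field.
have pos i j : 0 <= c i ^+ 2 * expR (- (i%:R * y)) * (c j ^+ 2 * expR (- (j%:R * y))).
  by apply: mulr_ge0; rewrite mulr_ge0 ?sqr_ge0 ?expR_ge0.
rewrite !E; apply/andP; split; rewrite ler_wpM2l// ler_sum// => i _;
  rewrite ler_sum// => j _; rewrite ler_wpM2l// e2.
- exact: expR_diff_sqr_ge.
- exact: expR_diff_sqr_le.
Qed.

Lemma wmoment_term_ge0 (c : nat -> R) m j y : 0 <= m%:R ^+ j * c m ^+ 2 * expR (- (m%:R * y)).
Proof. by apply: mulr_ge0 (expR_ge0 _); apply: mulr_ge0 (sqr_ge0 _); exact: exprn_ge0. Qed.

Lemma wmoment_ge0 c n j y : 0 <= wmoment c n j y.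
Proof. by apply: sumr_ge0 => m _; exact: wmoment_term_ge0. Qed.

Lemma wmoment0_gt0 c n k y : (k <= n)%N -> c k != 0 -> 0 < wmoment c n 0 y.
Proof.
move=> kn ck; rewrite /wmoment (bigD1 (Ordinal (kn : (k < n.+1)%N)))//= ltr_wpDr//.
  by apply: sumr_ge0 => m _; exact: wmoment_term_ge0.
by rewrite mulr_gt0 ?expR_gt0// mul1r exprn_even_gt0.
Qed.

Lemma wvar_ge0 c n y : 0 <= wvar c n y.
Proof.
have [w0|w0] := eqVneq (wmoment c n 0 y) 0.
  by rewrite /wvar w0 invr0 !mulr0 expr0n subrr.
have -> : wvar c n y = (wmoment c n 0 y * wmoment c n 2 y - wmoment c n 1 y ^+ 2) /
   wmoment c n 0 y ^+ 2 by rewrite /wvar; field.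
by rewrite divr_ge0 ?sqr_ge0// wmoment_gram_ge0.
Qed.

End lagrange_identity.

(** * Means of functions that may fail to be measurable *)

Section upper_mean.
Context d (T : measurableType d) (R : realType) (P : probability T R).
Implicit Types (F G : T -> R) (B C : R).

(* Root counts are not known to be measurable, and [\int] of a non-measurable function is a lower integral; they are therefore bounded by measurable majorants. *)
Definition upper_mean F B := forall e, 0 < e -> exists H : T -> R,
  [/\ measurable_fun setT H, (forall w, 0 <= H w), (forall w, F w <= H w) &
      (\int[P]_w (H w)%:E <= (B + e)%:E)%E].

(** For nonnegative functions the integral is the supremum over simple functions lying below, and
    this is monotone as it stands. *)
Lemma ge0_le_integral_nonmeasurable (f g : T -> \bar R) :
  (forall w, 0 <= f w)%E -> (forall w, f w <= g w)%E ->
  (\int[P]_w f w <= \int[P]_w g w)%E.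
Proof.
move=> f0 fg; have g0 w : (0 <= g w)%E by exact: le_trans (f0 w) (fg w).
rewrite !ge0_integralTE//; apply: ge_ereal_sup => _ [h hf <-].
apply: ereal_sup_ubound; exists h => //= x; exact: le_trans (hf x) (fg x).
Qed.

Lemma upper_mean_integral F B : (forall w, 0 <= F w) -> upper_mean F B ->
  (\int[P]_w (F w)%:E <= B%:E)%E.
Proof.
move=> F0 FB; apply/lee_addgt0Pr => e e0.
have [H [mH H0 FH HB]] := FB e e0.
rewrite -EFinD (le_trans _ HB)//.
by apply: ge0_le_integral_nonmeasurable => w; rewrite lee_fin.
Qed.

Lemma upper_meanD F1 F2 F B1 B2 : upper_mean F1 B1 -> upper_mean F2 B2 ->
  (forall w, F w <= F1 w + F2 w) -> upper_mean F (B1 + B2).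
Proof.
move=> F1B F2B FF e e0; have e2 : 0 < e / 2 by rewrite divr_gt0.
have [H1 [mH1 H10 FH1 HB1]] := F1B _ e2; have [H2 [mH2 H20 FH2 HB2]] := F2B _ e2.
exists (fun w => H1 w + H2 w); split.
- exact: measurable_funD.
- by move=> w; rewrite addr_ge0.
- by move=> w; rewrite (le_trans (FF w))// lerD.
- under eq_integral do rewrite EFinD.
  rewrite ge0_integralD//; last 4 first.
  + by move=> w _; rewrite lee_fin.
  + exact/measurable_EFinP.
  + by move=> w _; rewrite lee_fin.
  + exact/measurable_EFinP.
  have -> : B1 + B2 + e = (B1 + e / 2) + (B2 + e / 2) by field.
  by rewrite EFinD leeD.
Qed.

Lemma upper_mean_le F B C : B <= C -> upper_mean F B -> upper_mean F C.
Proof.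
move=> BC FB e e0; have [H [mH H0 FH HB]] := FB e e0; exists H; split => //.
by rewrite (le_trans HB)// lee_fin lerD2r.
Qed.

Lemma upper_mean_mono F G B : (forall w, F w <= G w) -> upper_mean G B -> upper_mean F B.
Proof.
move=> FG GB e e0; have [H [mH H0 FH HB]] := GB e e0; exists H; split => // w.
exact: le_trans (FG w) (FH w).
Qed.

Lemma upper_mean_approx F B :
  (forall e, 0 < e -> upper_mean F (B + e)) -> upper_mean F B.
Proof.
move=> h e e0; have e2 : 0 < e / 2 by rewrite divr_gt0.
have [H [mH H0 FH HB]] := h _ e2 _ e2; exists H; split => //.
by rewrite (le_trans HB)// lee_fin; lra.
Qed.

Lemma upper_mean_measurable F B : measurable_fun setT F -> (forall w, 0 <= F w) ->
  (\int[P]_w (F w)%:E <= B%:E)%E -> upper_mean F B.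
Proof.
move=> mF F0 FB e e0; exists F; split => //.
by rewrite (le_trans FB)// lee_fin lerDl ltW.
Qed.

Lemma upper_mean_cst B : 0 <= B -> upper_mean (cst B) B.
Proof.
move=> B0; apply: upper_mean_measurable => //.
rewrite (_ : (fun w => _) = cst B%:E)//.
by rewrite integral_cst//= probability_setT mule1.
Qed.

Lemma upper_mean_indic A k B : measurable A -> 0 <= k -> (P A <= B%:E)%E ->
  upper_mean (fun w => k * \1_A w) (k * B).
Proof.
move=> mA k0 AB; apply: upper_mean_measurable.
- by apply: measurable_funM => //; exact: measurable_indic.
- by move=> w; rewrite mulr_ge0.
- under eq_integral do rewrite EFinM.
  rewrite ge0_integralZl//; last exact/measurable_EFinP/measurable_indic.
  have -> : (\int[P]_x (\1_A x)%:E = P A)%E.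
    by have := @integral_indic _ T R P setT measurableT _ mA; rewrite setIT.
  by rewrite EFinM lee_wpmul2l// lee_fin.
Qed.

Lemma upper_mean_sum n (F : nat -> T -> R) (B : nat -> R) :
  (forall i, (i < n)%N -> upper_mean (F i) (B i)) ->
  upper_mean (fun w => \sum_(i < n) F i w) (\sum_(i < n) B i).
Proof.
elim: n => [|n IH] FB.
  rewrite big_ord0; apply: upper_mean_mono (upper_mean_cst (lexx 0)) => w.
  by rewrite big_ord0.
rewrite big_ord_recr/=; apply: upper_meanD (IH _) (FB n _) _ => //.
- by move=> i i_n; apply: FB; exact: ltnW.
- by move=> w; rewrite big_ord_recr.
Qed.

Lemma lower_mean_sum_indic n (A : nat -> set T) (p : nat -> R) F :
  (forall w, 0 <= F w) -> (forall i, (i < n)%N -> measurable (A i)) ->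
  (forall i, (i < n)%N -> (p i)%:E <= P (A i))%E ->
  (forall w, \sum_(i < n) \1_(A i) w <= F w) ->
  ((\sum_(i < n) p i)%:E <= \int[P]_w (F w)%:E)%E.
Proof.
move=> F0 mA pA AF.
apply: (@le_trans _ _ (\int[P]_w (\sum_(i < n) (\1_(A i) w)%:E))%E); last first.
  apply: ge0_le_integral_nonmeasurable => w; first by apply: sume_ge0 => i _; rewrite lee_fin.
  by rewrite sumEFin lee_fin.
rewrite ge0_integral_sum//; last first.
  by move=> i; apply/measurable_EFinP/measurable_indic; exact: mA.
rewrite -sumEFin; apply: lee_sum => i _.
have -> : (\int[P]_x (\1_(A i) x)%:E = P (A i))%E.
  by have := @integral_indic _ T R P setT measurableT _ (mA i (ltn_ord i)); rewrite setIT.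
exact: pA.
Qed.

Lemma measurable_set_gt F B : measurable_fun setT F -> measurable [set w | B < F w].
Proof.
move=> mF; rewrite (_ : [set w | _] = F @^-1` `]B, +oo[%classic).
  by rewrite -[X in measurable X]setTI; apply: mF.
by apply/seteqP; split => w /=; rewrite in_itv/= andbT.
Qed.

End upper_mean.

(** * Counting the roots of a random polynomial on a grid *)

Section real_random_poly.
Context d (T : measurableType d) (R : realType) (P : probability T R)
  (xi : nat -> {RV P >-> R}).
Hypothesis xi_iid : iid_standard_gaussian xi.
Notation L := (lincomb xi).
Implicit Types (c : nat -> R) (n k : nat).

Definition real_poly c n (w : T) : {poly R} := \poly_(m < n.+1) (c m * xi m w).

Lemma horner_real_poly c n w x : (real_poly c n w).[x] = L n.+1 (monomials c x) w.
Proof.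
rewrite /real_poly horner_poly; apply: eq_bigr => m _; rewrite /monomials; ring.
Qed.

Definition dmonomials c (x : R) : nat -> R := fun m => m%:R * c m * x ^+ m.-1.

Lemma horner_real_poly_deriv c n w x : (real_poly c n w)^`().[x] = L n.+1 (dmonomials c x) w.
Proof.
rewrite /real_poly poly_def raddf_sum horner_sum; apply: eq_bigr => m _ /=.
by rewrite derivZ derivXn hornerZ hornerMn hornerXn /dmonomials -mulr_natl; ring.
Qed.

(** Dominates the second derivative on [[-1, 1]], with [m ^+ 2] in place of [m * (m - 1)]. *)
Definition poly_bound c n w := \sum_(m < n.+1) m%:R ^+ 2 * (`|c m| * `|xi m w|).

Lemma measurable_poly_bound c n : measurable_fun setT (poly_bound c n).
Proof.
apply: measurable_sum => m; apply: measurable_funM => //; apply: measurable_funM => //.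
by apply: measurableT_comp.
Qed.

Lemma real_poly_deriv2_bound c n w x : `|x| <= 1 ->
  `|(real_poly c n w)^`()^`().[x]| <= poly_bound c n w.
Proof.
move=> x1; rewrite /real_poly poly_def !raddf_sum horner_sum (le_trans (ler_norm_sum _ _ _))//.
apply: ler_sum => m _ /=; rewrite !derivZ derivXn derivMn derivXn !hornerZ !hornerMn hornerXn.
have -> : x ^+ m.-1.-1 *+ m.-1 *+ m = m%:R * (m.-1%:R * x ^+ m.-1.-1).
  by rewrite -[LHS]mulr_natl -[X in _ * X]mulr_natl.
rewrite !normrM !normr_nat normrX [leRHS]mulrC ler_wpM2l ?mulr_ge0// expr2 ler_wpM2l//.
rewrite -[leRHS]mulr1 ler_pM ?exprn_ge0 ?ler_nat ?leq_pred//.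
by rewrite exprn_ile1.
Qed.

Lemma size_real_poly c n w : (size (real_poly c n w) <= n.+1)%N.
Proof. exact: size_poly. Qed.

Lemma nroots_real_poly_le c n w S : (nroots (real_poly c n w) S <= n)%N.
Proof.
rewrite (leq_trans (nroots_le_size _ _))//.
by have := size_real_poly c n w; case: size.
Qed.

(** The cell estimate [nroots_cell] applies to all cells outside two events, a root at some grid
    point and [M < poly_bound c n w]. There the degree bound [n] is used; the first event is null
    and the second costs [n * e]. *)
Lemma upper_mean_nroots_partition c n (x : nat -> R) K M (A B : nat -> R) e :
  {homo x : i j / (i <= j)%N >-> i <= j} -> 0 <= x 0%N -> (forall i, x i <= 1) ->
  (forall i, (i < K)%N -> P [set w | L n.+1 (monomials c (x i)) w *
     L n.+1 (monomials c (x i.+1)) w < 0]%R <= (A i)%:E)%E ->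
  (forall i, (i < K)%N -> P [set w |
      `|L n.+1 (monomials c (x i)) w| <= M * (x i.+1 - x i) ^+ 2 /\
      `|L n.+1 (dmonomials c (x i)) w| <= M * (x i.+1 - x i)]%R <= (B i)%:E)%E ->
  (forall i, (i <= K)%N -> 0 < dotn n.+1 (monomials c (x i)) (monomials c (x i))) ->
  (P [set w | M < poly_bound c n w]%R <= e%:E)%E ->
  upper_mean P (fun w => (nroots (real_poly c n w) `]x 0%N, x K]%classic)%:R)
    (\sum_(i < K) A i + n%:R * \sum_(i < K) B i + n%:R * e).
Proof.
move=> xm x0 x1 hA hB hdot he.
pose S i := [set w | L n.+1 (monomials c (x i)) w * L n.+1 (monomials c (x i.+1)) w < 0].
pose W i := [set w | `|L n.+1 (monomials c (x i)) w| <= M * (x i.+1 - x i) ^+ 2 /\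
      `|L n.+1 (dmonomials c (x i)) w| <= M * (x i.+1 - x i)].
pose Z i := [set w | L n.+1 (monomials c (x i)) w = 0].
pose E := [set w | M < poly_bound c n w].
have mE : measurable E by apply: measurable_set_gt; exact: measurable_poly_bound.
have n0 : 0 <= n%:R :> R by [].
have u1 : upper_mean P (fun w => \sum_(i < K) 1 * \1_(S i) w) (\sum_(i < K) 1 * A i).
  apply: (@upper_mean_sum _ _ _ _ _ (fun i w => 1 * \1_(S i) w) (fun i => 1 * A i)) => i iK.
  by apply: upper_mean_indic => //; [exact: measurable_lincomb_sign_change|exact: hA].
have u2 : upper_mean P (fun w => \sum_(i < K) n%:R * \1_(W i) w) (\sum_(i < K) n%:R * B i).
  apply: (@upper_mean_sum _ _ _ _ _ (fun i w => n%:R * \1_(W i) w) (fun i => n%:R * B i)) => i iK.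
  by apply: upper_mean_indic => //; [exact: measurable_lincomb_box|exact: hB].
have u3 : upper_mean P (fun w => \sum_(i < K.+1) n%:R * \1_(Z i) w) (\sum_(i < K.+1) n%:R * 0).
  apply: (@upper_mean_sum _ _ _ _ _ (fun i w => n%:R * \1_(Z i) w) (fun i => n%:R * 0)) => i iK.
  apply: upper_mean_indic => //; first exact: measurable_lincomb_eq0.
  by rewrite (prob_lincomb_eq0 xi_iid)//; exact: hdot.
have u4 : upper_mean P (fun w => n%:R * \1_E w) (n%:R * e) by apply: upper_mean_indic.
have -> : \sum_(i < K) A i + n%:R * \sum_(i < K) B i + n%:R * e =
   \sum_(i < K) 1 * A i + \sum_(i < K) n%:R * B i + (\sum_(i < K.+1) n%:R * 0 + n%:R * e).
  have -> : \sum_(i < K.+1) n%:R * 0 = 0 :> R by rewrite big1// => i _; rewrite mulr0.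
  by rewrite add0r -!mulr_sumr mul1r.
apply: upper_meanD (upper_meanD u1 u2 (fun=> lexx _)) (upper_meanD u3 u4 (fun=> lexx _)) _ => w.
have s1 : 0 <= \sum_(i < K) 1 * \1_(S i) w :> R by apply: sumr_ge0 => i _; rewrite mulr_ge0.
have s2 : 0 <= \sum_(i < K) n%:R * \1_(W i) w :> R by apply: sumr_ge0 => i _; rewrite mulr_ge0.
have s3 : 0 <= \sum_(i < K.+1) n%:R * \1_(Z i) w :> R by apply: sumr_ge0 => i _; rewrite mulr_ge0.
have s4 : 0 <= n%:R * \1_E w :> R by rewrite mulr_ge0.
have Nn : (nroots (real_poly c n w) `]x 0%N, x K]%classic)%:R <= n%:R :> R.
  by rewrite ler_nat nroots_real_poly_le.
have [Ew|nE] := pselect (E w).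
  by move: s4; rewrite indicE mem_set// mulr1 => s4; lra.
have [[i iZ]|nZ] := pselect (exists i : 'I_K.+1, Z i w).
  have : n%:R <= \sum_(i < K.+1) n%:R * \1_(Z i) w :> R.
    rewrite (bigD1 i)//= indicE mem_set// mulr1 lerDl.
    by apply: sumr_ge0 => j _; rewrite mulr_ge0.
  lra.
suff : (nroots (real_poly c n w) `]x 0%N, x K]%classic)%:R <=
   \sum_(i < K) 1 * \1_(S i) w + \sum_(i < K) n%:R * \1_(W i) w :> R.
  by move=> h; rewrite (le_trans h)// lerDl addr_ge0.
rewrite nroots_partition// natr_sum -big_split/=; apply: ler_sum => i _.
have hz (j : nat) : (j <= K)%N -> (real_poly c n w).[x j] != 0.
  move=> jK; apply/eqP => h; apply: nZ; exists (Ordinal (jK : (j < K.+1)%N)).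
  by rewrite /Z/= -horner_real_poly.
have xi1 : x i <= x i.+1 by exact: xm.
have pM z : x i <= z <= x i.+1 -> `|(real_poly c n w)^`()^`().[z]| <= M.
  move=> /andP[z1 z2]; apply: le_trans (real_poly_deriv2_bound _ _ _ _) _.
    by rewrite ger0_norm ?(le_trans z2)// (le_trans _ z1)// (le_trans x0)// xm.
  by rewrite leNgt; apply/negP.
have := nroots_cell xi1 (hz _ (ltnW (ltn_ord i))) (hz _ (ltn_ord i)) (nroots_real_poly_le _ _ _ _) pM.
rewrite -(ler_nat R) natrD natrM => h; apply: le_trans h _.
rewrite mul1r lerD// ?ler_wpM2l//.
  rewrite indicE ler_nat; case: (boolP (_ < 0)) => // h1.
  by rewrite mem_set// /S/= -!horner_real_poly.
rewrite indicE ler_nat; case: (boolP (_ && _)) => // /andP[h1 h2].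
by rewrite mem_set// /W/= -horner_real_poly -horner_real_poly_deriv.
Qed.

(** The cells are disjoint, and each one with a sign change contains a root. *)
Lemma lower_mean_nroots_partition c n (x : nat -> R) K (A : nat -> R) (S : set R) :
  {homo x : i j / (i <= j)%N >-> i <= j} -> `]x 0%N, x K]%classic `<=` S ->
  (forall i, (i < K)%N -> (A i)%:E <= P [set w | L n.+1 (monomials c (x i)) w *
     L n.+1 (monomials c (x i.+1)) w < 0]%R)%E ->
  ((\sum_(i < K) A i)%:E <= \int[P]_w (nroots (real_poly c n w) S)%:R%:E)%E.
Proof.
move=> xm xS hA.
apply: (@lower_mean_sum_indic _ _ _ P K (fun i => [set w | L n.+1 (monomials c (x i)) w *
     L n.+1 (monomials c (x i.+1)) w < 0]) A) => //.
- by move=> i _; exact: measurable_lincomb_sign_change.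
- move=> w; apply: (@le_trans _ _ (nroots (real_poly c n w) `]x 0%N, x K]%classic)%:R).
    rewrite nroots_partition// natr_sum; apply: ler_sum => i _.
    rewrite indicE ler_nat; case: (boolP (_ \in _)) => //; rewrite inE/= -!horner_real_poly.
    by move=> h; apply: nroots_sign_change => //; exact: xm.
  by rewrite ler_nat nroots_subset.
Qed.

End real_random_poly.

(** * Kac-Rice inequalities from fine grids *)

Section root_density.
Context d (T : measurableType d) (R : realType) (P : probability T R)
  (xi : nat -> {RV P >-> R}).
Hypothesis xi_iid : iid_standard_gaussian xi.
Notation L := (lincomb xi).
Implicit Types (c : nat -> R) (n k : nat).

Lemma continuous_expRM (k : R) : continuous (fun h : R => expR (k * h)).
Proof.
move=> h; apply: (@continuous_comp _ _ _ (fun h => k * h) expR).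
  exact: mulrl_continuous.
exact: continuous_expR.
Qed.

(** Serves to choose the number [K] of cells once the whole error is a continuous function [psi] of
    the step. *)
Lemma small_step (psi : R -> R) (D e : R) : {for 0, continuous psi} -> 0 <= D -> 0 < e ->
  exists2 K : nat, (0 < K)%N & `|psi (D / K%:R) - psi 0| <= e.
Proof.
move=> cpsi D0 e0.
have /cvgrPdist_le/(_ _ e0) := cpsi.
move=> /nbhs_ballP[r /= r0 hr].
pose K := (Num.truncn (D / r)).+1.
exists K => //; rewrite distrC; apply: hr; rewrite /ball/= sub0r normrN.
rewrite ger0_norm ?divr_ge0// ltr_pdivrMr// mulrC -ltr_pdivrMr//.
exact: truncnS_gt.
Qed.

Lemma wvar_le c n y : wvar c n y <= n%:R ^+ 2.
Proof.
rewrite /wvar (@le_trans _ _ (wmoment c n 2 y / wmoment c n 0 y)) ?gerBl ?sqr_ge0//.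
have [->|w0] := eqVneq (wmoment c n 0 y) 0; first by rewrite invr0 mulr0 sqr_ge0.
rewrite ler_pdivrMr; last by rewrite lt_neqAle eq_sym w0 wmoment_ge0.
rewrite /wmoment mulr_sumr; apply: ler_sum => m _.
rewrite expr0 mul1r -mulrA ler_wpM2r//; first by apply: mulr_ge0 (expR_ge0 _); exact: sqr_ge0.
by rewrite ler_pXn2r ?nnegrE// ler_nat -ltnS.
Qed.

(** The dot product at [y + h] and [y - h] is [wmoment c n 0 y]; dividing the Gram bounds by its
    square produces [wvar c n y]. *)
Lemma sign_change_tangent c n y h : 0 <= h -> 0 < wmoment c n 0 y ->
  let u := monomials c (expR (- (y + h) / 2)) in
  let v := monomials c (expR (- (y - h) / 2)) in
  let t := Num.sqrt (gram n.+1 u v) / dotn n.+1 u v in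
  expR (- (n%:R * h)) * h ^+ 2 * wvar c n y <= t ^+ 2 <= expR (n%:R * h) * h ^+ 2 * wvar c n y.
Proof.
move=> h0 w0 /=; set u := monomials c (expR (- (y + h) / 2)).
set v := monomials c (expR (- (y - h) / 2)); set t := Num.sqrt (gram n.+1 u v) / dotn n.+1 u v.
have := gram_monomials_bounds c n y h0; rewrite /= -/u -/v.
set D := _ - _ => /andP[g1 g2].
have dE : dotn n.+1 u v = wmoment c n 0 y by rewrite dotn_monomials; congr wmoment; field.
have D0 : 0 <= D by exact: wmoment_gram_ge0.
have g0 : 0 <= gram n.+1 u v.
  by rewrite (le_trans _ g1)// !mulr_ge0 ?expR_ge0 ?sqr_ge0.
have tE : t ^+ 2 = gram n.+1 u v / wmoment c n 0 y ^+ 2.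
  by rewrite /t dE expr_div_n sqr_sqrtr.
have VE : wvar c n y = D / wmoment c n 0 y ^+ 2.
  by rewrite /wvar /D; field; rewrite gt_eqF.
have H b : b * (D / wmoment c n 0 y ^+ 2) = b * D / wmoment c n 0 y ^+ 2 by rewrite mulrA.
by rewrite tE VE !H; apply/andP; split; rewrite ler_pM2r ?invr_gt0 ?exprn_gt0.
Qed.

Section partition.
Variables (c : nat -> R) (n k : nat) (y0 y1 : R).
Hypotheses (kn : (k.+2 <= n)%N) (ck1 : c k.+1 != 0) (ck2 : c k.+2 != 0).
Hypotheses (y10 : 0 <= y1) (y01 : y1 <= y0).

(** Equidistant in [y] and descending from [y0] to [y1], so that [xx] ascends. Capping the index at
    [K] freezes the sequence from there on, which makes it monotone on all of [nat]. *)
Let yy K i := y0 - (minn i K)%:R * ((y0 - y1) / K%:R).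
Let xx K i := expR (- yy K i / 2).

Let yy0 K : yy K 0 = y0. Proof. by rewrite /yy min0n mul0r subr0. Qed.

Let yyK K : (0 < K)%N -> yy K K = y1.
Proof. by move=> K0; rewrite /yy minnn mulrC divfK ?pnatr_eq0 ?gt_eqF// opprB addrC subrK. Qed.

Let step_ge0 K : 0 <= (y0 - y1) / K%:R. Proof. by rewrite divr_ge0// subr_ge0. Qed.

Let yyS K i : (i < K)%N -> yy K i.+1 = yy K i - (y0 - y1) / K%:R.
Proof.
move=> iK; rewrite /yy (minn_idPl iK) (minn_idPl (ltnW iK)) -addn1 natrD; ring.
Qed.

Let yy_mono K : {homo yy K : i j / (i <= j)%N >-> j <= i}.
Proof.
move=> i j ij; rewrite /yy lerD2l lerN2 ler_wpM2r// ler_nat leq_min geq_minr andbT.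
by rewrite (leq_trans (geq_minl _ _)).
Qed.

Let yy_itv K i : (0 < K)%N -> (i <= K)%N -> y1 <= yy K i <= y0.
Proof.
by move=> K0 iK; rewrite -{1}(yyK K0) -{1}(yy0 K) !yy_mono.
Qed.

Let xx_mono K : {homo xx K : i j / (i <= j)%N >-> i <= j}.
Proof. by move=> i j ij; rewrite /xx ler_expR ler_pM2r// lerN2 yy_mono. Qed.

Let yy_ge0 K i : (0 < K)%N -> 0 <= yy K i.
Proof.
move=> K0; have [iK|/ltnW Ki] := leqP i K.
  by have /andP[h _] := yy_itv K0 iK; exact: le_trans h.
by have := yyK K0; rewrite /yy minnn (minn_idPr Ki) => ->.
Qed.

Let xx_step K i : (0 < K)%N -> 0 <= xx K i.+1 - xx K i <= (y0 - y1) / K%:R.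
Proof.
move=> K0; rewrite subr_ge0 xx_mono//=.
have [iK|Ki] := ltnP i K; last first.
  by rewrite /xx /yy (minn_idPr Ki) (minn_idPr (leqW Ki)) subrr.
have ya := yy_ge0 i.+1 K0.
have h : xx K i.+1 - xx K i = xx K i.+1 * (1 - expR (- ((y0 - y1) / K%:R / 2))).
  rewrite mulrBr mulr1 /xx -expRD; congr (_ - expR _); rewrite (yyS iK); field.
  by rewrite pnatr_eq0 gt_eqF.
have x1 : xx K i.+1 <= 1 by rewrite -expR0 ler_expR; lra.
have s0 := step_ge0 K.
have e1 : 1 - expR (- ((y0 - y1) / K%:R / 2)) <= (y0 - y1) / K%:R.
  by have := expR_ge1Dx (- ((y0 - y1) / K%:R / 2)); lra.
have e0 : 0 <= 1 - expR (- ((y0 - y1) / K%:R / 2)).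
  by rewrite subr_ge0 -[leRHS]expR0 ler_expR; lra.
by rewrite h -[leRHS]mul1r ler_pM ?expR_ge0.
Qed.

(** Midpoint of a cell: its ends get the symmetric form of [sign_change_tangent], with half the step
    as [h]. *)
Let mid K i := yy K i - (y0 - y1) / K%:R / 2.

Let midE K i : (i < K)%N ->
  (xx K i = expR (- (mid K i + (y0 - y1) / K%:R / 2) / 2)) *
  (xx K i.+1 = expR (- (mid K i - (y0 - y1) / K%:R / 2) / 2)).
Proof.
move=> iK; rewrite /xx (yyS iK) /mid; split; congr (expR (- _ / 2)).
  by rewrite subrK.
by move: ((y0 - y1) / K%:R) => q; field.
Qed.

Let w0gt0 y : 0 < wmoment c n 0 y. Proof. exact: wmoment0_gt0 kn ck2. Qed.

Let dot_gt0 K i : 0 < dotn n.+1 (monomials c (xx K i)) (monomials c (xx K i)).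
Proof. by rewrite dotn_monomials. Qed.

Let dot2_gt0 K i : (i < K)%N -> 0 < dotn n.+1 (monomials c (xx K i)) (monomials c (xx K i.+1)).
Proof. by move=> iK; rewrite dotn_monomials. Qed.

Let mid_itv K i : (i < K)%N -> yy K i.+1 <= mid K i <= yy K i.
Proof. by move=> iK; rewrite /mid (yyS iK); have := step_ge0 K; lra. Qed.

(** The minor of the indices [k.+1] and [k.+2] is [c k.+1 * c k.+2 * x ^+ (k.+1 + k.+1)], and [x] is
    smallest at [y0]. The bound is thus common to all grid points, and it makes [prob_small_box]
    effective. *)
Let gram_dmonomials_ge K i : (i <= K)%N -> (0 < K)%N ->
  (`|c k.+1 * c k.+2| * expR (- y0 / 2) ^+ (k.+1 + k.+1)) ^+ 2 <=
  gram n.+1 (monomials c (xx K i)) (dmonomials c (xx K i)).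
Proof.
move=> iK K0.
have k1 : (k.+1 < n.+1)%N by rewrite ltnS ltnW.
have k2 : (k.+2 < n.+1)%N by rewrite ltnS.
apply: le_trans (gram_ge_pair (monomials c (xx K i)) (dmonomials c (xx K i)) k1 k2).
have -> : monomials c (xx K i) k.+1 * dmonomials c (xx K i) k.+2 -
  monomials c (xx K i) k.+2 * dmonomials c (xx K i) k.+1 =
  c k.+1 * c k.+2 * xx K i ^+ (k.+1 + k.+1).
  have -> : (k.+1 + k.+1 = k.+2 + k)%N by rewrite addnS.
  rewrite /monomials /dmonomials /= exprD !exprS.
  have -> : k.+2%:R = k.+1%:R + 1 :> R by rewrite natr1.
  ring.
rewrite -[leRHS]real_normK ?num_real// ler_pXn2r ?nnegrE ?mulr_ge0 ?exprn_ge0 ?expR_ge0//.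
rewrite [leRHS]normrM ler_wpM2l// normrX ger0_norm ?expR_ge0//.
rewrite lerXn2r ?nnegrE ?expR_ge0// ler_expR ler_pM2r// lerN2.
by have /andP[] := yy_itv K0 iK.
Qed.

(** The Kac-Rice upper bound, with [G] in the place of a primitive of [g]. Each cell is charged the
    larger end value of [g], whereas the increments of [G] control only the smaller one; by
    monotonicity the excess telescopes to [h * (g y1 - g y0)]. *)
Lemma upper_mean_density (g G : R -> R) :
  (forall y, y1 <= y <= y0 -> wvar c n y <= g y ^+ 2) ->
  (forall y, y1 <= y <= y0 -> 0 <= g y) ->
  (forall a b, y1 <= a -> a <= b -> b <= y0 -> g b <= g a) ->
  (forall a b, y1 <= a -> a <= b -> b <= y0 -> (b - a) * g b <= G b - G a) ->
  upper_mean P (fun w => (nroots (real_poly xi c n w)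
      `]expR (- y0 / 2), expR (- y1 / 2)]%classic)%:R) ((G y0 - G y1) / (2 * pi)).
Proof.
move=> Vg g0 gmono gG; apply: upper_mean_approx => e e0.
set D := y0 - y1.
have D0 : 0 <= D by rewrite subr_ge0.
have pi0 := @pi_gt0 R.
(* The event of probability [e'] may cost [n] roots, hence [e / 2] in all. *)
pose e' := e / 2 / n%:R.
have n0 : 0 < n%:R :> R by rewrite ltr0n (leq_trans _ kn).
have e'0 : 0 < e' by rewrite !divr_gt0.
have [M M0 hM] := prob_tail P (measurable_poly_bound xi c n) e'0.
pose kap := `|c k.+1 * c k.+2| * expR (- y0 / 2) ^+ (k.+1 + k.+1).
have kap0 : 0 < kap by rewrite mulr_gt0 ?exprn_gt0 ?expR_gt0// normr_gt0 mulf_neq0.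
(* The whole bound as a function of the step: first the sign changes with the telescoped excess,
   then the bad cells, [K] terms of order [h ^+ 3] with [K * h = D], each charged [n] roots. At 0 it
   is the claimed value. *)
pose psi h := expR (n%:R * h) * (G y0 - G y1 + h * (g y1 - g y0)) / (2 * pi) +
   n%:R * (4 * M ^+ 2 * D / kap * h ^+ 2).
have cpsi : {for 0, continuous psi}.
  apply: cvgD; apply: cvgM; first apply: cvgM.
  - exact: continuous_expRM.
  - by apply: cvgD; [exact: cvg_cst|apply: cvgM; [exact: cvg_id|exact: cvg_cst]].
  - exact: cvg_cst.
  - exact: cvg_cst.
  - by apply: cvgM; [exact: cvg_cst|exact: exprn_continuous].
have e2 : 0 < e / 2 by rewrite divr_gt0.
have [K K0 hK] := small_step cpsi D0 e2.
set h := D / K%:R in hK.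
have h0 : 0 <= h by exact: step_ge0.
pose A i := expR (n%:R * h) * (h * g (yy K i.+1)) / (2 * pi).
(* The bound of [prob_small_box] for sides [M * h ^+ 2] and [M * h], with [kap] below the square
   root of the Gram determinant. *)
pose B (i : nat) := 4 * M ^+ 2 * h ^+ 3 / kap.
have xK : xx K K = expR (- y1 / 2) by rewrite /xx yyK.
have x0 : xx K 0 = expR (- y0 / 2) by rewrite /xx yy0.
rewrite -xK -x0.
apply: upper_mean_le; last first.
apply: (@upper_mean_nroots_partition _ _ _ _ _ xi_iid c n (xx K) K M A B e').
- exact: xx_mono.
- exact: expR_ge0.
- by move=> i; rewrite -expR0 ler_expR; have := yy_ge0 i K0; lra.
- move=> i iK; have /andP[_ up] := prob_sign_change xi_iid (dot2_gt0 iK).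
  apply: (le_trans up); rewrite lee_fin /A.
  have hh : 0 <= h / 2 by rewrite divr_ge0.
  have := sign_change_tangent hh (w0gt0 (mid K i)).
  rewrite -!(midE iK) -/h /=; set t := Num.sqrt _ / _ => /andP[_ t2].
  have /andP[m1 m2] := mid_itv iK.
  have /andP[i1 i2] := yy_itv K0 iK; have /andP[i3 i4] := yy_itv K0 (ltnW iK).
  have mI : y1 <= mid K i <= y0 by rewrite (le_trans i1 m1) (le_trans m2 i4).
  have gi : 0 <= g (yy K i.+1) by apply: g0; rewrite i1.
  have tb : t <= expR (n%:R * h) * (h / 2 * g (yy K i.+1)).
    have b0 : 0 <= expR (n%:R * h) * (h / 2 * g (yy K i.+1)).
      by rewrite mulr_ge0 ?expR_ge0// mulr_ge0.
    have [|t0] := lerP t 0; first by move=> /le_trans; apply.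
    rewrite -(@ler_pXn2r _ 2) ?nnegrE ?(ltW t0)// (le_trans t2)//.
    have -> : (expR (n%:R * h) * (h / 2 * g (yy K i.+1))) ^+ 2 =
      expR (n%:R * h) ^+ 2 * (h / 2) ^+ 2 * g (yy K i.+1) ^+ 2 by ring.
    rewrite ler_pM//.
    + by apply: mulr_ge0 (sqr_ge0 _); exact: expR_ge0.
    + exact: wvar_ge0.
    + rewrite ler_wpM2r ?sqr_ge0// expr2 -expRD ler_expR.
      have : 0 <= n%:R * h by rewrite mulr_ge0.
      have -> : n%:R * (h / 2) = n%:R * h / 2 by ring.
      lra.
    + have gm : g (mid K i) <= g (yy K i.+1) by apply: (gmono _ _ i1 m1); exact: le_trans m2 i4.
      by rewrite (le_trans (Vg _ mI))// lerXn2r ?nnegrE// g0.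
  have -> : expR (n%:R * h) * (h * g (yy K i.+1)) / (2 * pi) =
      expR (n%:R * h) * (h / 2 * g (yy K i.+1)) / pi.
    by move: pi pi0 => p p0; field; rewrite !gt_eqF.
  by rewrite ler_pM2r ?invr_gt0.
- move=> i iK; set De := xx K i.+1 - xx K i.
  have /andP[d0 dh] := xx_step i K0; rewrite -/De in d0 dh.
  have gk := gram_dmonomials_ge (ltnW iK) K0; rewrite -/kap in gk.
  have g1 : 0 < gram n.+1 (monomials c (xx K i)) (dmonomials c (xx K i)).
    by rewrite (lt_le_trans _ gk)// exprn_gt0.
  apply: (le_trans (prob_small_box xi_iid _ _ g1)).
  + by rewrite mulr_ge0 ?sqr_ge0 ?ltW.
  + by rewrite mulr_ge0// ltW.
  + rewrite lee_fin /B ler_pM ?invr_ge0 ?sqrtr_ge0//.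
    * by rewrite !mulr_ge0 ?sqr_ge0// ltW.
    * have -> : 4 * (M * De ^+ 2) * (M * De) = 4 * M ^+ 2 * De ^+ 3 by ring.
      rewrite ler_pM2l; last by rewrite mulr_gt0// exprn_gt0.
      by rewrite lerXn2r ?nnegrE.
    * rewrite lef_pV2 ?posrE ?sqrtr_gt0//.
      by rewrite -(ger0_norm (ltW kap0)) -sqrtr_sqr ler_wsqrtr.
- by move=> i iK; exact: dot_gt0.
- exact: hM.
have psi0 : psi 0 = (G y0 - G y1) / (2 * pi).
  by rewrite /psi mulr0 expR0 mul0r expr0n/= !mulr0 !addr0 mul1r.
move: hK; rewrite psi0 ler_distl => /andP[_ hK].
have -> : n%:R * e' = e / 2 by rewrite /e' mulrC divfK// gt_eqF.
suff : \sum_(i < K) A i + n%:R * \sum_(i < K) B i <= psi h by rewrite -/h in hK; lra.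
rewrite /psi lerD//.
  rewrite /A -mulr_suml -mulr_sumr ler_pM2r ?invr_gt0 ?mulr_gt0// ler_pM2l ?expR_gt0//.
  have -> : h * (g y1 - g y0) = \sum_(i < K) h * (g (yy K i.+1) - g (yy K i)).
    rewrite -mulr_sumr; congr (_ * _).
    by rewrite -{1}(yyK K0) -{1}(yy0 K) -(big_mkord xpredT (fun i => g (yy K i.+1) - g (yy K i))) telescope_sumr.
  have -> : G y0 - G y1 = \sum_(i < K) (G (yy K i) - G (yy K i.+1)).
    rewrite -{1}(yyK K0) -{1}(yy0 K) -opprB.
    rewrite -(telescope_sumr (fun i => G (yy K i)) (leq0n K)) big_mkord -sumrN.
    by apply: eq_bigr => i _; rewrite opprB.
  rewrite -big_split/=; apply: ler_sum => i _.
  have iK := ltn_ord i.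
  have /andP[i1 i2] := yy_itv K0 iK; have /andP[i3 i4] := yy_itv K0 (ltnW iK).
  have := gG _ _ i1 (yy_mono K (leqnSn i)) i4.
  have -> : yy K i - yy K i.+1 = h by rewrite (yyS iK) opprB addrC subrK.
  lra.
rewrite ler_wpM2l// /B sumr_const card_ord -[leLHS]mulr_natl.
have -> : 4 * M ^+ 2 * D / kap * h ^+ 2 = K%:R * (4 * M ^+ 2 * h ^+ 3 / kap).
  have -> : D = K%:R * h by rewrite /h mulrC divfK// pnatr_eq0 gt_eqF.
  by field; rewrite gt_eqF.
by [].
Qed.

(** Against the upper bound, a sign change loses the factor [1 + t ^+ 2]. Since
    [wvar c n y <= n%:R ^+ 2], it is at most a common [Q], which tends to 1 with the step. *)
Lemma lower_mean_density (g G : R -> R) (S : set R) :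
  `]expR (- y0 / 2), expR (- y1 / 2)]%classic `<=` S ->
  (forall y, y1 <= y <= y0 -> g y ^+ 2 <= wvar c n y) ->
  (forall y, y1 <= y <= y0 -> 0 <= g y) ->
  (forall a b, y1 <= a -> a <= b -> b <= y0 -> g b <= g a) ->
  (forall a b, y1 <= a -> a <= b -> b <= y0 -> G b - G a <= (b - a) * g a) ->
  (((G y0 - G y1) / (2 * pi))%:E <=
    \int[P]_w (nroots (real_poly xi c n w) S)%:R%:E)%E.
Proof.
move=> subS Vg g0 gmono gG; apply/lee_addgt0Pr => e e0.
set D := y0 - y1.
have D0 : 0 <= D by rewrite subr_ge0.
have pi0 := @pi_gt0 R.
pose psi h := expR (- (n%:R * h)) * (G y0 - G y1 - h * (g y1 - g y0)) /
   (2 * pi * (1 + expR (n%:R * h) * h ^+ 2 * n%:R ^+ 2)).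
have cpsi : {for 0, continuous psi}.
  apply: cvgM; first apply: cvgM.
  - under eq_fun do rewrite -mulNr; rewrite -mulNr; exact: continuous_expRM.
  - apply: cvgD; first exact: cvg_cst.
    by apply: cvgN; apply: cvgM; [exact: cvg_id|exact: cvg_cst].
  - apply: cvgV; first by rewrite expr0n/= mulr0 mul0r addr0 mulr1 mulf_neq0// gt_eqF.
    apply: cvgM; first exact: cvg_cst.
    apply: cvgD; first exact: cvg_cst.
    apply: cvgM; last exact: cvg_cst.
    by apply: cvgM; [exact: continuous_expRM|exact: exprn_continuous].
have [K K0 hK] := small_step cpsi D0 e0.
set h := D / K%:R in hK.
have h0 : 0 <= h by exact: step_ge0.
pose Q := 1 + expR (n%:R * h) * h ^+ 2 * n%:R ^+ 2.
have Q0 : 0 < Q by rewrite ltr_pwDl// mulr_ge0 ?mulr_ge0 ?expR_ge0 ?sqr_ge0.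
pose A i := expR (- (n%:R * h)) * (h * g (yy K i)) / (2 * pi * Q).
have xK : xx K K = expR (- y1 / 2) by rewrite /xx yyK.
have x0 : xx K 0 = expR (- y0 / 2) by rewrite /xx yy0.
rewrite -xK -x0 in subS.
have low : ((\sum_(i < K) A i)%:E <= \int[P]_w (nroots (real_poly xi c n w) S)%:R%:E)%E.
  apply: (lower_mean_nroots_partition (xx_mono K) subS) => i iK.
  have /andP[lo _] := prob_sign_change xi_iid (dot2_gt0 iK).
  apply: le_trans lo; rewrite lee_fin /A.
  have hh : 0 <= h / 2 by rewrite divr_ge0.
  have := sign_change_tangent hh (w0gt0 (mid K i)).
  rewrite -!(midE iK) -/h /=; set t := Num.sqrt _ / _ => /andP[t1 t2].
  have tge0 : 0 <= t by rewrite divr_ge0 ?sqrtr_ge0// ltW// dot2_gt0.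
  have /andP[m1 m2] := mid_itv iK.
  have /andP[i1 i2] := yy_itv K0 iK; have /andP[i3 i4] := yy_itv K0 (ltnW iK).
  have mI : y1 <= mid K i <= y0 by rewrite (le_trans i1 m1) (le_trans m2 i4).
  have gi : 0 <= g (yy K i) by apply: g0; rewrite i3.
  have nh : 0 <= n%:R * h by rewrite mulr_ge0.
  have nh2 : n%:R * (h / 2) = n%:R * h / 2 by ring.
  have tb : expR (- (n%:R * h)) * (h / 2 * g (yy K i)) <= t.
    rewrite -(@ler_pXn2r _ 2) ?nnegrE//; last by rewrite mulr_ge0 ?expR_ge0// mulr_ge0.
    rewrite (le_trans _ t1)//.
    have -> : (expR (- (n%:R * h)) * (h / 2 * g (yy K i))) ^+ 2 =
      expR (- (n%:R * h)) ^+ 2 * (h / 2) ^+ 2 * g (yy K i) ^+ 2 by ring.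
    rewrite ler_pM ?sqr_ge0//.
    + by apply: mulr_ge0; exact: sqr_ge0.
    + by rewrite ler_wpM2r ?sqr_ge0// expr2 -expRD ler_expR nh2; lra.
    + have gm : g (yy K i) <= g (mid K i) by apply: (gmono _ _ _ m2 i4); exact: le_trans i1 m1.
      by rewrite (le_trans _ (Vg _ mI))// lerXn2r ?nnegrE// g0.
  have tQ : 1 + t ^+ 2 <= Q.
    rewrite lerD2l (le_trans t2)// ler_pM ?wvar_ge0 ?wvar_le//.
      by rewrite mulr_ge0 ?expR_ge0 ?sqr_ge0.
    rewrite ler_pM ?expR_ge0 ?sqr_ge0//; first by rewrite ler_expR nh2; lra.
    by rewrite lerXn2r ?nnegrE//; lra.
  have -> : expR (- (n%:R * h)) * (h * g (yy K i)) / (2 * pi * Q) =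
      expR (- (n%:R * h)) * (h / 2 * g (yy K i)) / (pi * Q).
    by move: pi pi0 => p p0; field; rewrite !gt_eqF.
  have T0 : 0 < 1 + t ^+ 2 by rewrite ltr_pwDl// sqr_ge0.
  rewrite ler_pM//.
  + by rewrite mulr_ge0 ?expR_ge0// mulr_ge0.
  + by rewrite invr_ge0 mulr_ge0// ltW.
  + by rewrite lef_pV2 ?posrE ?mulr_gt0// ler_wpM2l// ltW.
have psi0 : psi 0 = (G y0 - G y1) / (2 * pi).
  by rewrite /psi !mulr0 oppr0 expR0 mul0r expr0n/= !mulr0 mul0r addr0 subr0 mul1r mulr1.
move: hK; rewrite psi0 ler_distl => /andP[hK _].
have sum : psi h <= \sum_(i < K) A i.
  rewrite /psi /A -mulr_suml -mulr_sumr -/Q ler_pM2r ?invr_gt0 ?mulr_gt0// ler_pM2l ?expR_gt0//.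
  have -> : h * (g y1 - g y0) = \sum_(i < K) h * (g (yy K i.+1) - g (yy K i)).
    rewrite -mulr_sumr; congr (_ * _).
    by rewrite -{1}(yyK K0) -{1}(yy0 K) -(big_mkord xpredT (fun i => g (yy K i.+1) - g (yy K i))) telescope_sumr.
  have -> : G y0 - G y1 = \sum_(i < K) (G (yy K i) - G (yy K i.+1)).
    rewrite -{1}(yyK K0) -{1}(yy0 K) -opprB.
    rewrite -(telescope_sumr (fun i => G (yy K i)) (leq0n K)) big_mkord -sumrN.
    by apply: eq_bigr => i _; rewrite opprB.
  rewrite -sumrB; apply: ler_sum => i _.
  have iK := ltn_ord i.
  have /andP[i1 i2] := yy_itv K0 iK; have /andP[i3 i4] := yy_itv K0 (ltnW iK).
  have := gG _ _ i1 (yy_mono K (leqnSn i)) i4.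
  have -> : yy K i - yy K i.+1 = h by rewrite (yyS iK) opprB addrC subrK.
  lra.
rewrite -leeBlDr// (le_trans _ low)// lee_fin; lra.
Qed.

End partition.
End root_density.

(** * Rolle's theorem with multiplicities *)

Section rolle_multiplicity.
Context {R : realType}.
Implicit Types (p : {poly R}).

Lemma nroots_eq0 p (S : set R) : (forall z, S z -> ~~ root p z) -> nroots p S = 0%N.
Proof. by move=> h; rewrite /nroots fsbig1// => z Sz; rewrite mupNroot// h. Qed.

Lemma sum_count_mem (s l : seq R) : uniq s ->
  (\sum_(z <- s) count_mem z l)%N = count (mem s) l.
Proof.
elim: s => [|z s IH] /=; first by rewrite big_nil (eq_count (a2 := pred0)) ?count_pred0.
move=> /andP[zs us]; rewrite big_cons IH// -count_predUI.
rewrite (eq_count (a1 := predI _ _) (a2 := pred0)) ?count_pred0 ?addn0//.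
by move=> x /=; case: eqP => // ->; rewrite (negbTE zs).
Qed.

Lemma sum_mup_le_nroots p (S : set R) s : p != 0 -> uniq s -> (forall z, z \in s -> S z) ->
  (\sum_(z <- s) mup z p <= nroots p S)%N.
Proof.
move=> p0 us sS; have [l [q [pE qr]]] := real_roots_decomp p0.
rewrite (nroots_count _ pE qr).
rewrite (eq_bigr (fun z => count_mem z l)) => [|z _]; last by rewrite pE mup_decomp.
rewrite sum_count_mem//; apply: sub_count => z /= zs; apply: mem_set; exact: sS.
Qed.

(** By the product rule, differentiation leaves [m] of the [m.+1] equal linear factors. *)
Lemma mup_deriv p z : p^`() != 0 -> (mup z p <= (mup z p^`()).+1)%N.
Proof.
move=> p'0; have p0 : p != 0 by apply: contraNneq p'0 => ->; rewrite deriv0.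
case E : (mup z p) => [//|m]; rewrite ltnS mup_geq//.
have : (m.+1 <= mup z p)%N by rewrite E.
rewrite mup_geq// => /dvdpP[q ->].
rewrite derivM dvdp_add//; first by rewrite dvdp_mull// exprS dvdp_mull.
by rewrite dvdp_mull// deriv_exp derivXsubC mul1r /= -mulr_natl dvdp_mull.
Qed.

(** One zero of the derivative is taken strictly between each two consecutive points, hence new and
    different from the others; the joint [uniq] allows both lists to be counted together. *)
Lemma rolle_interlacing p z (s : seq R) : path <%R z s -> all (root p) (z :: s) ->
  exists s', [/\ size s' = size s, uniq (z :: s ++ s'), all (root p^`()) s' &
    all (fun u => z < u <= last z s) s'].
Proof.
elim: s z => [|u s IH] z; first by exists [::].
rewrite [path _ _ _]/= [all _ _]/= => /andP[zu us] /and3P[rz ru rs].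
have [|s' [ss us' rs' bs']] := IH u us; first by rewrite /= ru.
have := @polyrcf.rolle R z u p zu.
rewrite (rootP rz) (rootP ru) => /(_ erefl) [v]; rewrite in_itv/= => /andP[zv vu] pv.
have ul : u <= last u s by case: (s) us => //= t s0 /andP[ut /(order_path_min lt_trans)/allP h];
  case: s0 h => [|t' s0] h/=; [exact: ltW|apply/ltW/(lt_trans ut)/h; exact: mem_last].
exists (v :: s'); split.
- by rewrite /= ss.
- have zs : {in u :: s, forall x, u <= x}.
    by move=> x; rewrite inE => /predU1P[->//|xs]; apply/ltW; move/(order_path_min lt_trans)/allP : us => /(_ _ xs).
  have bs : {in s', forall x, u < x} by move=> x /(allP bs')/andP[].
  have all_u : {in u :: s ++ s', forall x, u <= x}.
    move=> x; rewrite -cat_cons mem_cat => /orP[/zs//|/bs/ltW//].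
  have perm : perm_eq (z :: (u :: s) ++ v :: s') (z :: v :: u :: s ++ s').
    by rewrite perm_cons -[v :: s']cat1s -[v :: _]cat1s perm_catCA.
  move: (perm_uniq perm) => /= ->; rewrite inE negb_or lt_eqF//=.
  have hz : z \notin u :: s ++ s'.
    by apply/negP => /all_u; rewrite leNgt zu.
  have hv : v \notin u :: s ++ s'.
    by apply/negP => /all_u; rewrite leNgt vu.
  by rewrite hz hv; exact: us'.
- by rewrite /= rs' andbT; apply/rootP.
- rewrite /= zv (le_trans (ltW vu) ul)/=.
  by apply: sub_all bs' => x /andP[ux ->]; rewrite (lt_trans zu ux).
Qed.

(** At each distinct root the derivative loses at most one multiplicity, while Rolle's theorem
    supplies a further zero in each gap; there is one gap fewer than there are distinct roots. *)
Lemma nroots_rolle p (a b : R) :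
  (nroots p `]a, b]%classic <= (nroots p^`() `]a, b]%classic).+1)%N.
Proof.
have [->|p0] := eqVneq p 0; first by rewrite nroots0.
have [l [q [pE qr]]] := real_roots_decomp p0.
(* A vanishing derivative means that [p] is a nonzero constant and has no root. *)
have [p'0|p'0] := eqVneq p^`() 0.
  rewrite nroots_eq0// => z _; apply/negP => pz.
  have : (0 < mup z p)%N by rewrite mup_geq// expr1 dvdp_XsubCl.
  have : (size p <= 1)%N.
    rewrite leqNgt; apply/negP => p1.
    have : p^`()`_(size p).-2 = 0 by rewrite p'0 coef0.
    rewrite coef_deriv prednK -?subn1 ?subn_gt0//; apply/eqP; rewrite mulrn_eq0.
    by rewrite subn1 -/(lead_coef p) lead_coef_eq0 (negbTE p0) orbF -subn1 subn_eq0 -ltnNge.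
  move=> /size1_polyC pc; move: pz; rewrite pc rootC => /eqP c0.
  by move: p0; rewrite pc c0 eqxx.
pose s := sort <=%R (undup [seq z <- l | z \in `]a, b]%classic]).
have us : uniq s by rewrite sort_uniq undup_uniq.
have ms z : (z \in s) = (a < z <= b) && root p z.
  rewrite mem_sort mem_undup mem_filter mem_set_itv_oc; congr (_ && _).
  by rewrite pE rootM (negbTE (qr z))/= root_prod_XsubC.
have -> : nroots p `]a, b]%classic = (\sum_(z <- s) mup z p)%N.
  rewrite (eq_bigr (fun z => count_mem z l)) => [|z _]; last by rewrite pE mup_decomp.
  rewrite (nroots_count _ pE qr) sum_count_mem//; apply: eq_in_count => z zl /=.
  by rewrite mem_sort mem_undup mem_filter zl andbT.
have : sorted <%R s by rewrite lt_sorted_uniq_le us; exact: (sort_sorted le_total).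
case E : s => [|z t]; first by rewrite big_nil.
move=> zt; have rp : all (root p) (z :: t).
  by apply/allP => x; rewrite -E ms => /andP[].
have [s' [ss us' rs' bs']] := rolle_interlacing zt rp.
have inS : {in z :: t ++ s', forall x, a < x <= b}.
  move=> x; rewrite -cat_cons mem_cat -E => /orP[|/(allP bs')/andP[zx xl]].
    by rewrite ms => /andP[].
  have : z \in s by rewrite E mem_head.
  have : last z t \in s by rewrite E mem_last.
  rewrite !ms => /andP[/andP[_ h1] _] /andP[/andP[h2 _] _].
  by rewrite (lt_trans h2)//= (le_trans xl).
have := @sum_mup_le_nroots p^`() `]a, b]%classic _ p'0 us' _.
rewrite -cat_cons big_cat/= => h.
have {}h : (\sum_(x <- z :: t) mup x p^`() + size s' <= nroots p^`() `]a, b]%classic)%N.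
  apply: leq_trans (h _); last by move=> x; rewrite -cat_cons => /inS hx; rewrite /= in_itv.
  rewrite leq_add2l -sum1_size big_seq [leqRHS]big_seq; apply: leq_sum => x /(allP rs') rx.
  by rewrite mup_geq// expr1 dvdp_XsubCl.
apply: leq_trans (_ : (size (z :: t) + \sum_(x <- z :: t) mup x p^`()) <= _)%N.
  by rewrite -sum1_size -big_split/=; apply: leq_sum => x _; rewrite mup_deriv.
by rewrite /= -ss addSn ltnS addnC.
Qed.

Lemma nroots_rolle_iter p k (a b : R) :
  (nroots p `]a, b]%classic <= k + nroots p^`(k) `]a, b]%classic)%N.
Proof.
elim: k => [|k IH]; first by rewrite derivn0.
by rewrite (leq_trans IH)// addSnnS leq_add2l derivnS nroots_rolle.
Qed.

End rolle_multiplicity.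

(** * Passing to a derivative, and roots near zero *)

Section shift.
Context d (T : measurableType d) (R : realType) (P : probability T R)
  (xi : nat -> {RV P >-> R}).
Hypothesis xi_iid : iid_standard_gaussian xi.

Lemma iid_shift k : iid_standard_gaussian (fun m => xi (m + k)).
Proof.
have [ind law] := xi_iid; split; last by move=> m; exact: law.
move=> J A uJ mA.
pose A' j := A (j - k)%N.
have := ind (map (addn^~ k) J) A' _ (fun j => mA (j - k)%N).
rewrite map_inj_uniq ?uJ; last exact: addIn.
rewrite !big_map => /(_ isT); rewrite /A'.
by under eq_bigr do rewrite addnK; under [in RHS]eq_bigr do rewrite addnK.
Qed.

(** Coefficients of the [k]-th derivative, in which the variables are shifted too; [iid_shift] keeps
    their law. *)
Definition deriv_coef k (c : nat -> R) m : R := c (m + k)%N * ((m + k) ^_ k)%:R.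

Lemma real_poly_derivn c n k w : (k <= n)%N ->
  (real_poly xi c n w)^`(k) = real_poly (fun m => xi (m + k)) (deriv_coef k c) (n - k) w.
Proof.
move=> kn; apply/polyP => i; rewrite coef_derivn !coef_poly addnC -mulr_natr.
have -> : (i < (n - k).+1)%N = (i + k < n.+1)%N by rewrite -subSn// ltn_subRL addnC.
by case: ifP; rewrite ?mul0r// /deriv_coef => _; ring.
Qed.

End shift.

Section near_zero.
Context d (T : measurableType d) (R : realType) (P : probability T R).
Implicit Types (xi : nat -> {RV P >-> R}) (c : nat -> R).

(** Let [k] be the first index with [c k != 0]. Off an event where the sum [F] of all absolute terms
    exceeds [M], a root in []0, r]] forces [|c k * xi k|] below [r * M], which is unlikely for small
    [r]. Here [r] may depend on [n] and on the coefficients: it only closes the gap that a finite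
    grid in [y] leaves at [x = 0]. *)
Lemma upper_mean_small_root xi c n (e : R) : iid_standard_gaussian xi ->
  (exists2 k, (k <= n)%N & c k != 0) -> 0 < e ->
  exists2 r, 0 < r & upper_mean P (fun w => (nroots (real_poly xi c n w) `]0, r]%classic)%:R) e.
Proof.
move=> xi_iid exk e0.
have exk' : exists k, (k <= n)%N && (c k != 0) by case: exk => k kn ck; exists k; rewrite kn.
case: (ex_minnP exk') => k /andP[kn ck] kmin {exk exk'}.
pose F w := \sum_(m < n.+1) `|c m * xi m w|.
have mF : measurable_fun setT F.
  by apply: measurable_sum => m; apply: measurableT_comp => //; exact: measurable_funM.
pose N : R := n.+1%:R.
have N0 : 0 < N by rewrite ltr0n.
have e2 : 0 < e / 2 / N by rewrite !divr_gt0.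
have [M M0 hM] := prob_tail P mF e2.
have ack : 0 < `|c k| by rewrite normr_gt0.
(* The second entry makes the small-ball bound [2 * r * M / |c k|] at most [e / 2 / N]; the first
   one gives powers of [z] at most 1. *)
pose r := Num.min 1 (e / 2 / N * `|c k| / (2 * M)).
have r0 : 0 < r by rewrite lt_min ltr01/=; apply: divr_gt0; apply: mulr_gt0.
have r1 : r <= 1 by rewrite ge_min lexx.
have rM : r <= e / 2 / N * `|c k| / (2 * M) by rewrite ge_min lexx orbT.
pose u (m : nat) : R := if m == k then c k else 0.
have uE w : lincomb xi n.+1 u w = c k * xi k w.
  rewrite /lincomb (bigD1 (Ordinal (kn : (k < n.+1)%N)))//= /u eqxx big1 ?addr0// => i.
  by rewrite -val_eqE/= => /negbTE ->; rewrite mul0r.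
have uu : dotn n.+1 u u = c k ^+ 2.
  rewrite /dotn (bigD1 (Ordinal (kn : (k < n.+1)%N)))//= /u eqxx big1 ?addr0// => i.
  by rewrite -val_eqE/= => /negbTE ->; rewrite mul0r.
pose E1 := [set w | `|lincomb xi n.+1 u w| <= r * M].
pose E2 := [set w | M < F w].
have mE2 : measurable E2 by exact: measurable_set_gt.
have P1 : (P E1 <= (e / 2 / N)%:E)%E.
  have uu0 : 0 < dotn n.+1 u u by rewrite uu exprn_even_gt0.
  have rM0 : 0 <= r * M by rewrite mulr_ge0 ?ltW.
  apply: (le_trans (prob_small_ball xi_iid rM0 uu0)).
  rewrite lee_fin uu sqrtr_sqr ler_pdivrMr//.
  have : r * (2 * M) <= e / 2 / N * `|c k| by rewrite -ler_pdivlMr// mulr_gt0.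
  by rewrite mulrCA.
have u1 := upper_mean_indic (measurable_lincomb_le xi n.+1 u (r * M)) (ltW N0) P1.
have u2 := upper_mean_indic mE2 (ltW N0) hM.
exists r => //.
have -> : e = N * (e / 2 / N) + N * (e / 2 / N) by field; rewrite gt_eqF.
apply: upper_meanD u1 u2 _ => w.
have [Ew|nE1] := pselect (E1 w).
  rewrite [X in _ <= _ * X + _]indicE mem_set// mulr1 (@le_trans _ _ N)//.
    by rewrite ler_nat (leq_trans (nroots_real_poly_le _ _ _ _ _)).
  by rewrite lerDl; apply: mulr_ge0 => //; exact: ltW.
have [Ew|nE2] := pselect (E2 w).
  rewrite [X in _ <= _ + _ * X]indicE mem_set// mulr1 (@le_trans _ _ N)//.
    by rewrite ler_nat (leq_trans (nroots_real_poly_le _ _ _ _ _)).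
  by rewrite lerDr; apply: mulr_ge0 => //; exact: ltW.
rewrite nroots_eq0; first by apply: addr_ge0; apply: mulr_ge0 => //; exact: ltW.
move=> z /=; rewrite in_itv/= => /andP[z0 zr]; apply/negP => /rootP pz.
apply: nE1; rewrite /E1/= uE.
have FM : F w <= M by rewrite leNgt; apply/negP.
have zk : 0 < z ^+ k by rewrite exprn_gt0.
(* The root equation expresses the term of index [k] through the others: those before it vanish by
   minimality, and those after it contain a factor [z ^+ k.+1]. *)
suff : `|c k * xi k w| * z ^+ k <= F w * z * z ^+ k.
  rewrite ler_pM2r// => /le_trans; apply; rewrite mulrC.
  by apply: ler_pM => //; [exact: ltW|apply: sumr_ge0 => i _; exact: normr_ge0].
have Ek : c k * xi k w * z ^+ k = - \sum_(i < n.+1 | i != k :> nat) c i * xi i w * z ^+ i.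
  apply/eqP; rewrite -addr_eq0; apply/eqP.
  by rewrite -[RHS]pz /real_poly horner_poly [RHS](bigD1 (Ordinal (kn : (k < n.+1)%N)))//=.
have -> : `|c k * xi k w| * z ^+ k = `|c k * xi k w * z ^+ k|.
  by rewrite [in RHS]normrM [`|z ^+ k|]gtr0_norm.
rewrite Ek normrN (le_trans (ler_norm_sum _ _ _))// /F -mulrA mulr_suml.
rewrite [leRHS](bigID (fun i : 'I_n.+1 => i != k :> nat))/= ler_wpDr//.
  by apply: sumr_ge0 => i _; rewrite mulr_ge0// mulr_ge0 ?ltW.
apply: ler_sum => i ik; rewrite normrM.
have [ltik|leki] := ltnP i k.
  have -> : c i = 0.
    apply/eqP; apply: contraTT ltik => ci; rewrite -leqNgt; apply: kmin.
    by rewrite ci andbT -ltnS.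
  by rewrite !mul0r normr0 !mul0r.
rewrite ler_wpM2l// [`|z ^+ i|]gtr0_norm ?exprn_gt0// -exprS.
have {}leki : (k.+1 <= i)%N by rewrite ltn_neqAle eq_sym ik.
rewrite -(subnK leki) exprD ger_pMl ?exprn_gt0//.
by apply: exprn_ile1; [exact: ltW|exact: le_trans zr r1].
Qed.

(** The majorant [C * expR (- y / 2)] is integrable at infinity. A grid stops at a finite [y0],
    which is taken so large that the remaining interval lies in []0, r]], where roots are rare. *)
Lemma upper_mean_near_zero xi c n k (y1 C : R) : iid_standard_gaussian xi ->
  (k.+2 <= n)%N -> c k.+1 != 0 -> c k.+2 != 0 -> 0 <= y1 -> 0 <= C ->
  (forall y, y1 <= y -> wvar c n y <= (C * expR (- y / 2)) ^+ 2) ->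
  upper_mean P (fun w => (nroots (real_poly xi c n w) `]0, expR (- y1 / 2)]%classic)%:R) C.
Proof.
move=> xi_iid kn ck1 ck2 y10 C0 hV; apply: upper_mean_approx => e e0.
have [|r r0 hr] := @upper_mean_small_root xi c n e xi_iid _ e0.
  by exists k.+2.
pose y0 := Num.max y1 (- 2 * ln r).
have y01 : y1 <= y0 by rewrite le_max lexx.
have xr : expR (- y0 / 2) <= r.
  rewrite -[leRHS](lnK (r0 : r \is Num.pos)) ler_expR.
  have : - 2 * ln r <= y0 by rewrite le_max lexx orbT.
  lra.
have := @upper_mean_density _ _ _ _ xi xi_iid c n k y0 y1 kn ck1 ck2 y10 y01
  (fun y => C * expR (- y / 2)) (fun y => - (2 * C * expR (- y / 2))).
have H1 : forall y, y1 <= y <= y0 -> wvar c n y <= (C * expR (- y / 2)) ^+ 2.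
  by move=> y /andP[y1y _]; exact: hV.
have H2 : forall y, y1 <= y <= y0 -> 0 <= C * expR (- y / 2).
  by move=> y _; rewrite mulr_ge0 ?expR_ge0.
have H3 : forall a b, y1 <= a -> a <= b -> b <= y0 -> C * expR (- b / 2) <= C * expR (- a / 2).
  by move=> a b _ ab _; rewrite ler_wpM2l// ler_expR ler_pM2r// lerN2.
have H4 : forall a b, y1 <= a -> a <= b -> b <= y0 -> (b - a) * (C * expR (- b / 2)) <=
   - (2 * C * expR (- b / 2)) - - (2 * C * expR (- a / 2)).
  move=> a b _ ab _.
  have -> : expR (- a / 2) = expR (- b / 2) * expR ((b - a) / 2).
    by rewrite -expRD; congr expR; field.
  have h := expR_ge1Dx ((b - a) / 2).
  have h2 : 0 <= C * expR (- b / 2) by rewrite mulr_ge0 ?expR_ge0.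
  have := ler_wpM2l h2 h; move: (expR (- b / 2)) h2 (expR ((b - a) / 2)) => q h2 s.
  rewrite mulrDr mulr1 => hs.
  have -> : - (2 * C * q) - - (2 * C * (q * s)) = 2 * (C * q * s) - 2 * (C * q) by ring.
  have -> : (b - a) * (C * q) = 2 * (C * q * ((b - a) / 2)) by field.
  lra.
move=> /(_ H1 H2 H3 H4) um.
have pi0 := @pi_gt0 R; have pi2 := @pi_ge2 R.
have um' : upper_mean P (fun w => (nroots (real_poly xi c n w)
   `]expR (- y0 / 2), expR (- y1 / 2)]%classic)%:R) C.
  apply: upper_mean_le um; rewrite ler_pdivrMr ?mulr_gt0//.
  have e1 : expR (- y1 / 2) <= 1 by rewrite -[leRHS]expR0 ler_expR; lra.
  have e2 := expR_ge0 (- y0 / 2 : R).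
  have : C * expR (- y1 / 2) <= C by rewrite -[leRHS]mulr1 ler_wpM2l.
  have : 0 <= C * expR (- y0 / 2) by rewrite mulr_ge0.
  have : C <= C * pi by rewrite -[leLHS]mulr1 ler_wpM2l//; lra.
  lra.
apply: upper_meanD um' hr _ => w; rewrite -natrD ler_nat addnC.
apply: leq_trans (nroots_setU_le _ _ _); apply: nroots_subset => z /=.
rewrite !in_itv/= => /andP[z0 zy]; case: (leP z (expR (- y0 / 2))) => h.
  by left; rewrite z0 (le_trans h).
by right; rewrite zy.
Qed.

(** Rolle's theorem costs at most [k] roots, and [c k.+1], [c k.+2] yield the coefficients of index
    1 and 2 of the derivative. *)
Lemma upper_mean_near_zero_derivn xi c n k (y1 C : R) : iid_standard_gaussian xi ->
  (k.+2 <= n)%N -> c k.+1 != 0 -> c k.+2 != 0 -> 0 <= y1 -> 0 <= C ->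
  (forall y, y1 <= y -> wvar (deriv_coef k c) (n - k) y <= (C * expR (- y / 2)) ^+ 2) ->
  upper_mean P (fun w => (nroots (real_poly xi c n w) `]0, expR (- y1 / 2)]%classic)%:R)
   (k%:R + C).
Proof.
move=> xi_iid kn ck1 ck2 y10 C0 hV.
have kn' : (2 <= n - k)%N by rewrite ltn_subRL addn1.
have ff m : (m + k)%N ^_ k != 0%N by rewrite -lt0n ffact_gt0 leq_addl.
have dn0 m : c (m + k)%N != 0 -> deriv_coef k c m != 0.
  by move=> cm; rewrite /deriv_coef mulf_neq0// pnatr_eq0 ff.
have := upper_mean_near_zero (iid_shift xi_iid k) kn' (dn0 1%N ck1) (dn0 2%N ck2) y10 C0 hV.
move=> /(upper_meanD (upper_mean_cst P (ler0n R k))); apply => w.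
rewrite -natrD ler_nat -real_poly_derivn; first exact: nroots_rolle_iter.
by rewrite ltnW// ltnW.
Qed.

End near_zero.

(** * Exponentially damped power sums *)

Section power_sums.
Context {R : realType}.
Implicit Types (r : nat -> R) (b e y : R) (n m : nat).

(** Truncated polylogarithm of order [- b] at [expR (- y)]; with [b = 2 * rho + j] it models
    [wmoment c n j y]. *)
Definition powsum b n y : R := \sum_(m < n) m.+1%:R `^ b * expR (- (m.+1%:R * y)).

Lemma powsum_term_ge0 b m y : 0 <= m.+1%:R `^ b * expR (- (m.+1%:R * y)) :> R.
Proof. by rewrite mulr_ge0 ?powR_ge0 ?expR_ge0. Qed.

Lemma powsum_ge0 b n y : 0 <= powsum b n y.
Proof. by apply: sumr_ge0 => m _; exact: powsum_term_ge0. Qed.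

Lemma powsum_mono b n n' y : (n <= n')%N -> powsum b n y <= powsum b n' y.
Proof.
move=> nn'; rewrite /powsum (big_ord_widen _ (fun m => m.+1%:R `^ b * expR (- (m.+1%:R * y))) nn').
rewrite [leRHS](bigID (fun m : 'I_n' => (m < n)%N))/= lerDl.
by apply: sumr_ge0 => m _; exact: powsum_term_ge0.
Qed.

Lemma sum_truncated_le n M (x : nat -> R) : (forall m, 0 <= x m) ->
  \sum_(m < n) (if (m < M)%N then x m else 0) <= \sum_(m < M) x m.
Proof.
move=> x0; rewrite -big_mkcond/=; case: (leqP M n) => [Mn|/ltnW nM].
  by rewrite (big_ord_narrow Mn).
rewrite [leRHS](bigID (fun m : 'I_M => (m < n)%N))/=.
rewrite [leLHS](eq_bigl (fun m : 'I_n => true)) => [|m]; last by rewrite (leq_trans _ nM).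
by rewrite (big_ord_widen _ x nM) lerDl sumr_ge0.
Qed.

(** From some [M] on the errors are below [e]. The terms before [M] are bounded by a constant that
    depends neither on [n] nor on [y]. *)
Lemma powsum_perturb r b e : r @ \oo --> (0 : R) -> 0 < e ->
  exists2 C, 0 <= C & forall n y (q : nat -> R), 0 <= y -> (forall m, (m < n)%N -> `|q m| <= r m) ->
    `|\sum_(m < n) q m * (m.+1%:R `^ b * expR (- (m.+1%:R * y)))| <= e * powsum b n y + C.
Proof.
move=> r0 e0; have /cvgrPdist_le/(_ _ e0) [M _ hM] := r0.
exists (\sum_(m < M) `|r m| * m.+1%:R `^ b).
  by apply: sumr_ge0 => m _; rewrite mulr_ge0 ?powR_ge0.
move=> n y q y0 qr; rewrite (le_trans (ler_norm_sum _ _ _))//.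
pose x (m : nat) := `|r m| * m.+1%:R `^ b.
apply: (@le_trans _ _ (\sum_(m < n) (e * (m.+1%:R `^ b * expR (- (m.+1%:R * y))) +
    (if (m < M)%N then x m else 0)))); last first.
  rewrite big_split/= -mulr_sumr lerD2l; apply: sum_truncated_le => m.
  by rewrite /x mulr_ge0 ?powR_ge0.
apply: ler_sum => m _; have p0 := powsum_term_ge0 b m y.
rewrite normrM (ger0_norm p0); have qm := qr _ (ltn_ord m).
case: ltnP => mM; last first.
  rewrite addr0 ler_wpM2r// (le_trans qm)//.
  by have := hM m mM; rewrite sub0r normrN => /(le_trans (ler_norm _)).
apply: (@le_trans _ _ (x m)); last by rewrite lerDr mulr_ge0// ltW.
rewrite /x ler_pM// ?(le_trans qm) ?ler_norm// -[leRHS]mulr1 ler_wpM2l ?powR_ge0//.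
by rewrite -[leRHS]expR0 ler_expR oppr_le0 mulr_ge0.
Qed.

(** After division by a power of [m.+1] this is the difference quotient at 1 of the power function
    with exponent [b], for the increment [- m.+1%:R^-1]. *)
Lemma powR_diff_ratio b : 0 < b ->
  (fun m : nat => m.+1%:R `^ (1 - b) * (m.+1%:R `^ b - m%:R `^ b) - b : R) @ \oo --> (0 : R).
Proof.
move=> b0.
have H : h^-1 *: (((fun x : R => x `^ b) \o shift 1) (h *: (1 : R)) - powR 1 b) @[h --> (0 : R)^'] --> b.
  have [h1 h2] := @is_derive1_powR R b 1 ltr01.
  by rewrite powR1 mulr1 in h2; rewrite -[X in _ --> X]h2; exact: h1.
apply/cvgrPdist_le => e e0.
have /cvgrPdist_le/(_ _ e0) := H; rewrite near_withinE => /nbhs_ballP[r /= r0 hr].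
exists (Num.truncn r^-1) => // m /= rm.
have m1 : r^-1 < m.+1%:R by rewrite (lt_le_trans (truncnS_gt _))// ler_nat.
have m0 : 0 < m.+1%:R :> R by rewrite ltr0n.
have hne : - (m.+1%:R)^-1 != 0 :> R by rewrite oppr_eq0 invr_eq0 gt_eqF.
suff <- : (- (m.+1%:R)^-1)^-1 *: (((- (m.+1%:R)^-1 *: 1 : R) + 1) `^ b - 1 `^ b) =
    m.+1%:R `^ (1 - b) * (m.+1%:R `^ b - m%:R `^ b) :> R.
  rewrite sub0r normrN distrC; apply: hr hne.
  by rewrite /ball/= sub0r opprK gtr0_norm ?invr_gt0// invf_plt ?posrE.
rewrite powR1 /GRing.scale/= mulr1 invrN invrK.
have -> : m%:R `^ b = m.+1%:R `^ b * (- (m.+1%:R)^-1 + 1) `^ b :> R.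
  rewrite -powRM//; first last.
    by rewrite addrC subr_ge0 invf_le1// ler1n.
    congr (_ `^ _); rewrite mulrDr mulrN mulfV ?gt_eqF// mulr1 -natr1; ring.
have E : m.+1%:R `^ (1 - b) * m.+1%:R `^ b = m.+1%:R :> R.
  by rewrite -powRD ?subrK ?powRr1 ?ltW// gt_eqF ?implybT.
set X := (_ + 1) `^ b.
transitivity (- (m.+1%:R `^ (1 - b) * m.+1%:R `^ b) * (X - 1)); first by rewrite E.
ring.
Qed.

Lemma powR_diff_le b : 0 < b -> exists2 C : R, 0 < C &
  forall m, m.+1%:R `^ b - m%:R `^ b <= C * m.+1%:R `^ (b - 1).
Proof.
move=> b0; have /cvg_seq_bounded[M [_ hM]] : cvgn (fun m : nat => m.+1%:R `^ (1 - b) * (m.+1%:R `^ b - m%:R `^ b) - b : R).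
  by apply/cvg_ex; exists 0; exact: powR_diff_ratio.
have M1 : M < `|M| + 1 by rewrite (le_lt_trans (ler_norm _))// ltrDl.
exists (`|M| + 1 + b); first by rewrite addr_gt0// (le_lt_trans _ M1)// ltrDl.
move=> m; have m0 : 0 < m.+1%:R :> R by rewrite ltr0n.
have := hM _ M1 m I => /=; rewrite ler_norml => /andP[_]; rewrite lerBlDr => h.
have -> : m.+1%:R `^ b - m%:R `^ b = (m.+1%:R `^ (1 - b) * (m.+1%:R `^ b - m%:R `^ b)) * m.+1%:R `^ (b - 1) :> R.
  rewrite mulrAC -powRD; last by rewrite (gt_eqF m0) implybT.
  have -> : 1 - b + (b - 1) = 0 :> R by ring.
  by rewrite powRr0 mul1r.
by rewrite ler_wpM2r ?powR_ge0.
Qed.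

Lemma powR_expRN_small b e : 0 < e ->
  exists2 A : R, 1 <= A & forall z, A <= z -> z `^ b * expR (- z) <= e.
Proof.
move=> e0; pose k := Num.truncn `|b|.
have bk : b <= k.+1%:R by rewrite (le_trans (ler_norm _))// ltW// truncnS_gt.
pose F : R := (k.+2)`!%:R.
exists (1 + F / e); first by rewrite lerDl divr_ge0// ltW.
move=> z zA; have z1 : 1 <= z by rewrite (le_trans _ zA)// lerDl divr_ge0// ltW.
have z0 : 0 < z by rewrite (lt_le_trans ltr01).
have F0 : 0 < F by rewrite ltr0n fact_gt0.
rewrite expRN ler_pdivrMr ?expR_gt0// (le_trans (ler_powR z1 bk))// powR_mulrn; last exact: ltW.
have h := expR_ge1Dxn k.+1 (ltW z0).
apply: (@le_trans _ _ (e * (z ^+ k.+2 / F))); last first.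
  by rewrite ler_pM2l// (le_trans _ h)// lerDr.
rewrite (exprS z k.+1) -[leLHS]mul1r.
have -> : e * (z * z ^+ k.+1 / F) = e * z / F * z ^+ k.+1 by field; rewrite gt_eqF.
rewrite ler_pM2r ?exprn_gt0// ler_pdivlMr// mul1r mulrC -ler_pdivrMr//.
by rewrite (le_trans _ zA)// lerDr.
Qed.

(** For the indices up to [Q], the integer part of [1 / y], the exponential is at least [expR (-1)];
    by [powR_diff_le] what is left dominates a telescoping sum, the power [b] of [Q]. Moreover
    [Q >= 1 / (2 * y)], and [1 <= n%:R * y] ensures [Q <= n]. *)
Lemma powsum_ge b : 0 < b -> exists2 k : R, 0 < k &
  forall n y, 0 < y <= 1 -> 1 <= n%:R * y -> k * y `^ (- b) <= powsum (b - 1) n y.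
Proof.
move=> b0; have [C C0 hC] := powR_diff_le b0.
exists (C^-1 * expR (-1) * 2^-1 `^ b).
  by rewrite !mulr_gt0 ?invr_gt0 ?expR_gt0 ?powR_gt0// invr_gt0.
move=> n y /andP[y0 y1] ny; pose Q := Num.truncn y^-1.
have yV : 1 <= y^-1 by rewrite invf_ge1.
have Q1 : (1 <= Q)%N by rewrite truncn_gt0.
have Qy : Q%:R <= y^-1 by rewrite truncn_le invr_ge0 ltW.
have Qy2 : y^-1 < Q.+1%:R by exact: truncnS_gt.
have Qn : (Q <= n)%N.
  rewrite -(ler_nat R) (le_trans Qy)// -[y^-1]mul1r ler_pdivrMr//.
have : C^-1 * expR (-1) * Q%:R `^ b <= powsum (b - 1) n y.
  apply: le_trans (powsum_mono _ _ Qn).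
  have -> : Q%:R `^ b = \sum_(m < Q) (m.+1%:R `^ b - m%:R `^ b) :> R.
    rewrite -(big_mkord xpredT (fun m => m.+1%:R `^ b - m%:R `^ b)) telescope_sumr//.
    by rewrite powR0 ?subr0// gt_eqF.
  rewrite mulr_sumr; apply: ler_sum => m _.
  apply: (@le_trans _ _ (C^-1 * expR (-1) * (C * m.+1%:R `^ (b - 1)))).
    by rewrite ler_pM2l// mulr_gt0 ?invr_gt0 ?expR_gt0.
  have -> : C^-1 * expR (-1) * (C * m.+1%:R `^ (b - 1)) = m.+1%:R `^ (b - 1) * expR (-1).
    by move: (expR _) (_ `^ _) => u v; field; rewrite gt_eqF.
  rewrite ler_wpM2l ?powR_ge0// ler_expR lerN2 -ler_pdivlMr// mul1r.
  by rewrite (le_trans _ Qy)// ler_nat.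
apply: le_trans; rewrite -[leLHS]mulrA ler_wpM2l//; first by rewrite mulr_ge0 ?expR_ge0// invr_ge0 ltW.
have -> : y `^ (- b) = y^-1 `^ b.
  by rewrite -powR_inv1 ?ltW// -powRrM mulN1r.
have yV0 := le_trans ler01 yV.
have h2 : 0 <= 2^-1 :> R by [].
have -> : 2^-1 `^ b * y^-1 `^ b = (2^-1 * y^-1) `^ b by rewrite powRM.
apply: (ge0_ler_powR (ltW b0)); rewrite ?nnegrE ?mulr_ge0//.
by rewrite mulrC ler_pdivrMr// (le_trans (ltW Qy2))// mulr_natr mulr2n -natrD ler_nat -addn1 leq_add2l.
Qed.

End power_sums.

(** * Asymptotics of the power sums for small [y] *)

Section power_sum_asymptotics.
Context {R : realType}.
Implicit Types (b e y : R) (n m : nat).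

Lemma powsumS b n y :
  powsum b n.+1 y = powsum b n y + n.+1%:R `^ b * expR (- (n.+1%:R * y)).
Proof. by rewrite /powsum big_ord_recr. Qed.

Lemma one_sub_expRN_bounds y : 0 <= y ->
  0 <= 1 - expR (- y) <= y /\ y - (1 - expR (- y)) <= y * (1 - expR (- y)).
Proof.
move=> y0; have h1 := expR_ge1Dx (- y).
have h2 : expR (- y) <= 1 by rewrite -[leRHS]expR0 ler_expR oppr_le0.
have h3 : (1 + y) * expR (- y) <= 1.
  by rewrite expRN ler_pdivrMr ?expR_gt0// mul1r expR_ge1Dx.
by split; [apply/andP; split|]; lra.
Qed.

Lemma powsum_abel b n y : 0 < b -> (1 - expR (- y)) * powsum b n y =
  \sum_(m < n) (m.+1%:R `^ b - m%:R `^ b) * expR (- (m.+1%:R * y)) -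
  n%:R `^ b * expR (- (n.+1%:R * y)).
Proof.
move=> b0; elim: n => [|n IH].
  by rewrite /powsum !big_ord0 mulr0 powR0 ?gt_eqF// mul0r subr0.
rewrite powsumS big_ord_recr/= mulrDr IH.
have -> : expR (- (n.+2%:R * y)) = expR (- y) * expR (- (n.+1%:R * y)).
  by rewrite -expRD -natr1; congr expR; ring.
ring.
Qed.

(** By [powsum_ge] the sum exceeds a multiple of a negative power of [y], hence any constant once
    [y] is small. *)
Lemma powsum_absorb b (C e : R) : 0 < b -> 0 < e -> exists2 d, 0 < d <= 1 &
  forall n y, 0 < y <= d -> 1 <= n%:R * y -> C <= e * powsum (b - 1) n y.
Proof.
move=> b0 e0; have [k k0 hk] := powsum_ge b0.
have C1 : 0 < `|C| + 1 by rewrite ltr_pwDr.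
pose t := e * k / (`|C| + 1); have t0 : 0 < t by rewrite divr_gt0// mulr_gt0.
exists (Num.min 1 (t `^ b^-1)); first by rewrite lt_min ltr01 powR_gt0// ge_min lexx.
move=> n y /andP[y0]; rewrite le_min => /andP[y1 yt] ny.
have yb : y `^ b <= t.
  have -> : t = (t `^ b^-1) `^ b by rewrite -powRrM mulVf ?powRr1 ?gt_eqF ?ltW.
  by apply: (ge0_ler_powR (ltW b0)); rewrite ?nnegrE ?powR_ge0// ltW.
have yb0 : 0 < y `^ b by rewrite powR_gt0.
apply: (@le_trans _ _ (e * (k * y `^ (- b)))); last first.
  by rewrite ler_pM2l// hk// y0.
rewrite powRN mulrA ler_pdivlMr//.
apply: (@le_trans _ _ (`|C| * t)).
  apply: (@le_trans _ _ (`|C| * y `^ b)); last by rewrite ler_wpM2l.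
  by rewrite ler_wpM2r ?powR_ge0// ler_norm.
rewrite /t mulrA ler_pdivrMr// mulrC ler_pM2l ?mulr_gt0//.
by rewrite lerDl.
Qed.

(** Summation by parts produces differences asymptotic to [b] times the power [b - 1], and
    [1 - expR (- y)] is [y] to first order. The boundary term at [n] is negligible because
    [n%:R * y >= A]. *)
Lemma powsum_recur b e : 0 < b -> 0 < e -> exists d A, [/\ 0 < d <= 1, 1 <= A &
  forall n y, 0 < y <= d -> A <= n%:R * y ->
    `|y * powsum b n y - b * powsum (b - 1) n y| <= e * powsum (b - 1) n y].
Proof.
move=> b0 e0; pose e' := e / 4; have e'0 : 0 < e' by rewrite divr_gt0.
have [k k0 hk] := powsum_ge b0.
have rc : (fun m : nat => `|m.+1%:R `^ (1 - b) * (m.+1%:R `^ b - m%:R `^ b) - b| : R) @ \oo --> (0 : R).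
  by rewrite -[X in _ --> X](normr0 R); apply: cvg_norm; exact: powR_diff_ratio.
have [C C0 hC] := powsum_perturb (b - 1) rc e'0.
have [d /andP[d0 d1] hd] := powsum_absorb C b0 e'0.
have [A A1 hA] := powR_expRN_small b (mulr_gt0 e'0 k0).
have D0 : 0 < b + 3 * e' by rewrite addr_gt0// mulr_gt0.
exists (Num.min d (e' / (b + 3 * e'))), A; split => //.
  by rewrite lt_min d0 divr_gt0//= ge_min d1.
move=> n y /andP[y0]; rewrite le_min => /andP[yd ye] Any.
have ny1 : 1 <= n%:R * y by rewrite (le_trans A1).
have ny0 : 0 < n%:R * y by rewrite (lt_le_trans ltr01).
have S0 := powsum_ge0 (b - 1) n y.
pose q (m : nat) := m.+1%:R `^ (1 - b) * (m.+1%:R `^ b - m%:R `^ b) - b.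
have hq := hC n y q (ltW y0) (fun m _ => lexx _).
have qE : \sum_(m < n) (m.+1%:R `^ b - m%:R `^ b) * expR (- (m.+1%:R * y)) =
    b * powsum (b - 1) n y + \sum_(m < n) q m * (m.+1%:R `^ (b - 1) * expR (- (m.+1%:R * y))).
  rewrite mulr_sumr -big_split/=; apply: eq_bigr => m _.
  have m0 : 0 < m.+1%:R :> R by rewrite ltr0n.
  have E : m.+1%:R `^ (1 - b) * m.+1%:R `^ (b - 1) = 1 :> R.
    rewrite -powRD; last by rewrite (gt_eqF m0) implybT.
    by have -> : 1 - b + (b - 1) = 0 :> R; [ring|rewrite powRr0].
  rewrite /q; set D := _ - _ `^ b; set X := m.+1%:R `^ (1 - b) in E *.
  set Y := m.+1%:R `^ (b - 1) in E *; set Z := expR _.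
  transitivity ((X * Y) * D * Z); first by rewrite E mul1r.
  ring.
have tail : n%:R `^ b * expR (- (n.+1%:R * y)) <= e' * powsum (b - 1) n y.
  apply: (@le_trans _ _ (n%:R `^ b * expR (- (n%:R * y)))).
    by rewrite ler_wpM2l ?powR_ge0// ler_expR lerN2 ler_wpM2r ?ltW// ltr_nat.
  apply: (@le_trans _ _ (e' * (k * y `^ (- b)))); last first.
    by rewrite ler_pM2l// hk// y0 (le_trans yd).
  have := hA _ Any; rewrite powRM ?(ltW y0)// => h.
  rewrite powRN mulrA ler_pdivlMr ?powR_gt0//.
  by apply: le_trans h; rewrite mulrAC.
have tail0 : 0 <= n%:R `^ b * expR (- (n.+1%:R * y)) by rewrite mulr_ge0 ?powR_ge0 ?expR_ge0.
have := powsum_abel n y b0; rewrite qE.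
have [/andP[u0 u1] u2] := one_sub_expRN_bounds (ltW y0).
have Sb0 := powsum_ge0 b n y.
have Cle : C <= e' * powsum (b - 1) n y by apply: hd => //; rewrite y0.
move: hq tail tail0 u0 u1 u2 => /=.
have eE : e = 4 * e' by rewrite /e' mulrC divfK.
pose u : R := 1 - expR (- y); rewrite -/u.
set Q := \sum_(m < n) _; set tl := n%:R `^ b * _.
move: (powsum b n y) (powsum (b - 1) n y) S0 Sb0 Cle => Sb S S0 Sb0 Cle hq tl1 tl0 u0 u1 u2 E.
clear - b0 y0 e'0 D0 ye eE S0 Sb0 Cle hq tl1 tl0 u0 u1 u2 E; clearbody e' u Q tl.
have uS : `|u * Sb - b * S| <= 3 * e' * S.
  rewrite E; move: hq; rewrite !ler_norml => /andP[q1 q2]; apply/andP; split; lra.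
have uS2 : u * Sb <= (b + 3 * e') * S.
  by move: uS; rewrite ler_norml => /andP[_]; lra.
have : (y - u) * Sb <= e' * S.
  apply: (@le_trans _ _ (y * (u * Sb))); first by rewrite mulrA ler_wpM2r.
  apply: (@le_trans _ _ (y * ((b + 3 * e') * S))); first by rewrite ler_wpM2l// ltW.
  rewrite mulrA ler_wpM2r//; move: ye; rewrite ler_pdivlMr//.
have : 0 <= (y - u) * Sb by rewrite mulr_ge0// subr_ge0.
rewrite eE; move: uS; rewrite !ler_norml => /andP[h1 h2] h3 h4.
have p0 : 0 <= e' * S by rewrite mulr_ge0// ltW.
apply/andP; split; lra.
Qed.

Lemma powsum0_bounds n y : 0 < y ->
  1 - y - expR (- (n%:R * y)) <= y * powsum 0 n y <= 1.
Proof.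
move=> y0; have E : (1 - expR (- y)) * powsum 0 n y = expR (- y) - expR (- (n.+1%:R * y)).
  elim: n => [|n IH]; first by rewrite /powsum big_ord0 mulr0 mul1r subrr.
  rewrite powsumS mulrDr IH powRr0 mul1r.
  have -> : expR (- (n.+2%:R * y)) = expR (- y) * expR (- (n.+1%:R * y)).
    by rewrite -expRD -natr1; congr expR; ring.
  ring.
have [/andP[u0 u1] u2] := one_sub_expRN_bounds (ltW y0).
have S0 := powsum_ge0 0 n y.
apply/andP; split.
  apply: (@le_trans _ _ ((1 - expR (- y)) * powsum 0 n y)); last by rewrite ler_wpM2r.
  rewrite E; have h1 := expR_ge1Dx (- y).
  have : expR (- (n.+1%:R * y)) <= expR (- (n%:R * y)).
    by rewrite ler_expR lerN2 ler_wpM2r ?ltW// ltr_nat.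
  lra.
have e0 := expR_gt0 (- y).
have : y * expR (- y) <= 1 - expR (- y) by lra.
move=> h; rewrite -(ler_pM2l e0) mulr1.
apply: (@le_trans _ _ ((1 - expR (- y)) * powsum 0 n y)).
  by rewrite mulrA [expR _ * y]mulrC ler_wpM2r.
by rewrite E gerBl expR_ge0.
Qed.

Lemma harmonic_ln_bounds n : ln n.+1%:R <= \sum_(m < n) m.+1%:R^-1 :> R /\
  \sum_(m < n.+1) m.+1%:R^-1 <= 1 + ln n.+1%:R :> R.
Proof.
have step m : ln m.+2%:R - ln m.+1%:R <= m.+1%:R^-1 :> R.
  have m0 : 0 < m.+1%:R :> R by rewrite ltr0n.
  rewrite -ln_div ?posrE ?ltr0n//.
  have -> : m.+2%:R / m.+1%:R = 1 + m.+1%:R^-1 :> R.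
    by rewrite -natr1; field; rewrite gt_eqF.
  by apply: le_ln1Dx; rewrite (lt_trans (ltrN10 _))// invr_gt0.
have step2 m : m.+2%:R^-1 <= ln m.+2%:R - ln m.+1%:R :> R.
  have m0 : 0 < m.+1%:R :> R by rewrite ltr0n.
  have m2 : 0 < m.+2%:R :> R by rewrite ltr0n.
  rewrite -lerN2 opprB -ln_div ?posrE ?ltr0n//.
  have -> : m.+1%:R / m.+2%:R = 1 + (- m.+2%:R^-1) :> R.
    have -> : m.+1%:R = m.+2%:R - 1 :> R by rewrite -[m.+2%:R]natr1 addrK.
    by move: (m.+2%:R) m2 => z z0; field; rewrite gt_eqF.
  apply: le_ln1Dx; rewrite ltrN2 invf_lt1// ltr1n//.
split.
  elim: n => [|n IH]; first by rewrite big_ord0 ln1.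
  by rewrite big_ord_recr/= (le_trans _ (lerD IH (step n)))// addrC subrK.
elim: n => [|n IH]; first by rewrite big_ord1 ln1 invr1 addr0.
by rewrite big_ord_recr/= (le_trans (lerD IH (step2 n)))// -addrA lerD2l addrC subrK.
Qed.

(** Up to [Q], the integer part of [1 / y], it is a harmonic sum with a loss of at most
    [Q * y <= 1]. Beyond it the reciprocals are at most [y], and the rest is bounded by
    [y * powsum 0 n y <= 1]. *)
Lemma powsumN1_bounds n y : 0 < y <= 1 -> 1 <= n%:R * y ->
  ln y^-1 - 1 <= powsum (-1) n y <= ln y^-1 + 2.
Proof.
move=> /andP[y0 y1] ny; pose Q := Num.truncn y^-1.
have yV : 1 <= y^-1 by rewrite invf_ge1.
have yV0 : 0 < y^-1 by rewrite invr_gt0.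
have Q1 : (1 <= Q)%N by rewrite truncn_gt0.
have Qy : Q%:R <= y^-1 by rewrite truncn_le ltW.
have Qy2 : y^-1 < Q.+1%:R by exact: truncnS_gt.
have Qn : (Q <= n)%N.
  by rewrite -(ler_nat R) (le_trans Qy)// -[y^-1]mul1r ler_pdivrMr.
have iE m : m.+1%:R `^ (-1) = m.+1%:R^-1 :> R by rewrite powR_inv1.
have m0 m : 0 < m.+1%:R :> R by rewrite ltr0n.
have [low _] := harmonic_ln_bounds Q.
have upp : \sum_(m < Q) m.+1%:R^-1 <= 1 + ln Q%:R :> R.
  by case: (Q) Q1 => // q _; have [] := harmonic_ln_bounds q.
apply/andP; split.
  apply: (@le_trans _ _ (\sum_(m < Q) (m.+1%:R^-1 - y))).
    rewrite sumrB sumr_const card_ord -mulr_natl lerB//.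
      by apply: le_trans low; rewrite ler_ln ?posrE// ltW.
    by rewrite -ler_pdivlMr// mul1r.
  apply: le_trans (powsum_mono _ _ Qn); apply: ler_sum => m _; rewrite iE.
  have -> : m.+1%:R^-1 - y = m.+1%:R^-1 * (1 + - (m.+1%:R * y)).
    by move: (m.+1%:R) (m0 m) => z z0; field; rewrite gt_eqF.
  by rewrite ler_wpM2l ?invr_ge0// expR_ge1Dx.
apply: (@le_trans _ _ (\sum_(m < n) ((if (m < Q)%N then m.+1%:R^-1 else 0) +
    y * (m.+1%:R `^ 0 * expR (- (m.+1%:R * y)))))).
  apply: ler_sum => m _; rewrite iE powRr0 mul1r; case: ltnP => mQ.
    apply: ler_wpDr; first by rewrite mulr_ge0 ?expR_ge0 ?ltW.
    rewrite -[leRHS]mulr1 ler_wpM2l ?invr_ge0//.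
    by rewrite -[leRHS]expR0 ler_expR oppr_le0 mulr_ge0// ltW.
  rewrite add0r ler_wpM2r ?expR_ge0//.
  by rewrite -[leRHS]invrK lef_pV2 ?posrE// (le_trans (ltW Qy2))// ler_nat ltnS.
rewrite big_split/= -mulr_sumr.
have /andP[_ h0] := powsum0_bounds n y0; rewrite /powsum in h0.
have h1 := @sum_truncated_le R n Q (fun m => m.+1%:R^-1) (fun m => _).
have {}h1 := h1 (fun m => ltac:(by rewrite invr_ge0)).
have h2 : ln Q%:R <= ln y^-1 by rewrite ler_ln ?posrE// ltr0n.
apply: (@le_trans _ _ ((1 + ln Q%:R) + 1)); last by lra.
by rewrite lerD// (le_trans h1).
Qed.

End power_sum_asymptotics.

(** * Comparison of the weighted moments with power sums *)

Section weighted_moments.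
Context {R : realType}.
Implicit Types (a c : nat -> R) (b e y rho : R) (n m j : nat).

(** Assumption-B for a single row of real coefficients. *)
Definition coef_asymp rho a c n : Prop :=
  forall m, (m <= n)%N -> `|(maxn m 1)%:R `^ (- rho) * `|c m| - 1| <= a m.

Lemma coef_sqr_asymp rho a c n m : coef_asymp rho a c n -> (m < n)%N ->
  `|m.+1%:R `^ (- (2 * rho)) * c m.+1 ^+ 2 - 1| <= a m.+1 * (2 + a m.+1).
Proof.
move=> h mn; have := h _ mn; rewrite (maxn_idPl _)//.
have -> : m.+1%:R `^ (- (2 * rho)) * c m.+1 ^+ 2 = (m.+1%:R `^ (- rho) * `|c m.+1|) ^+ 2.
  rewrite exprMn real_normK ?num_real//; congr (_ * _).
  rewrite -powR_mulrn ?powR_ge0// -powRrM; congr (_ `^ _); ring.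
move: (_ * `|_|) (a m.+1) => u t ut.
have t0 : 0 <= t by exact: le_trans ut.
have -> : u ^+ 2 - 1 = (u - 1) * (2 + (u - 1)) by ring.
rewrite normrM ler_pM// (le_trans (ler_normD _ _))//.
by rewrite ger0_norm// lerD2l.
Qed.

Lemma wmoment_recl c n j y : wmoment c n j y =
  (j == 0%N)%:R * c 0%N ^+ 2 +
  \sum_(m < n) m.+1%:R ^+ j * c m.+1 ^+ 2 * expR (- (m.+1%:R * y)).
Proof. by rewrite /wmoment big_ord_recl/= expr0n mul0r oppr0 expR0 mulr1. Qed.

(** The squared coefficients have relative errors [a m * (2 + a m)], which tend to 0. Index 0 has no
    counterpart in [powsum] and adds [(1 + a 0) ^+ 2] to the constant. *)
Lemma wmoment_powsum rho a j e : a @ \oo --> (0 : R) -> 0 < e ->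
  exists2 C, 0 <= C & forall n c y, coef_asymp rho a c n -> 0 <= y ->
    `|wmoment c n j y - powsum (2 * rho + j%:R) n y| <= e * powsum (2 * rho + j%:R) n y + C.
Proof.
move=> a0 e0; pose r (m : nat) := a m.+1 * (2 + a m.+1).
have r0 : r @ \oo --> (0 : R).
  have a1 : (fun m => a m.+1) @ \oo --> (0 : R) by rewrite (cvg_shiftS a).
  rewrite -[X in _ --> X](mul0r (2 + 0 : R)).
  by apply: cvgM => //; apply: cvgD => //; exact: cvg_cst.
have [C C0 hC] := powsum_perturb (2 * rho + j%:R) r0 e0.
exists (C + (1 + a 0%N) ^+ 2); first by rewrite addr_ge0 ?sqr_ge0.
move=> n c y hc y0.
pose q (m : nat) := m.+1%:R `^ (- (2 * rho)) * c m.+1 ^+ 2 - 1.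
have hq := hC n y q y0 (fun m mn => coef_sqr_asymp hc mn).
have c0 : c 0%N ^+ 2 <= (1 + a 0%N) ^+ 2.
  have := hc 0%N (leq0n _); rewrite powR1 mul1r => h.
  have a00 : 0 <= a 0%N by exact: le_trans h.
  rewrite -real_normK ?num_real// lerXn2r ?nnegrE ?addr_ge0//.
  by move: h; rewrite ler_norml => /andP[_]; rewrite lerBlDl.
rewrite wmoment_recl -addrA {1}/powsum -sumrB addrC.
rewrite (eq_bigr (fun m : 'I_n => q m * (m.+1%:R `^ (2 * rho + j%:R) * expR (- (m.+1%:R * y))))); last first.
  move=> m _; have m0 : 0 < m.+1%:R :> R by rewrite ltr0n.
  have E : m.+1%:R `^ (- (2 * rho)) * m.+1%:R `^ (2 * rho) = 1 :> R.
    rewrite -powRD; last by rewrite (gt_eqF m0) implybT.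
    by have -> : - (2 * rho) + 2 * rho = 0 :> R; [ring|rewrite powRr0].
  rewrite powRD; last by rewrite (gt_eqF m0) implybT.
  rewrite powR_mulrn ?ler0n// /q; set X := _ `^ - _ in E *; set Y := _ `^ (2 * rho) in E *.
  set Z := expR _; set D := m.+1%:R ^+ j.
  transitivity (D * c m.+1 ^+ 2 * Z * (X * Y) - Y * D * Z); last by ring.
  by rewrite E mulr1.
rewrite (le_trans (ler_normD _ _))// addrA lerD//.
rewrite normrM ger0_norm// ger0_norm ?sqr_ge0//.
by apply: le_trans c0; case: (j == 0%N); rewrite ?mul1r// mul0r sqr_ge0.
Qed.

Lemma wmoment_equiv rho a j e : a @ \oo --> (0 : R) -> 0 < e -> 0 < 2 * rho + j%:R + 1 ->
  exists2 d, 0 < d <= 1 & forall n c y, coef_asymp rho a c n -> 0 < y <= d -> 1 <= n%:R * y ->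
    `|wmoment c n j y - powsum (2 * rho + j%:R) n y| <= e * powsum (2 * rho + j%:R) n y.
Proof.
move=> a0 e0 b0; have e2 : 0 < e / 2 by rewrite divr_gt0.
have [C C0 hC] := wmoment_powsum rho j a0 e2.
have [d d01 hd] := powsum_absorb C b0 e2.
exists d => // n c y hc yd ny; have /andP[y0 _] := yd.
have := hd n y yd ny; rewrite addrK => hd'.
by apply: le_trans (hC n c y hc (ltW y0)) _; lra.
Qed.

(** The recursion of the power sums, carried over to the moments: their successive quotients are
    those of a gamma law of scale [1 / y]. *)
Lemma wmoment_ratio rho a j e : a @ \oo --> (0 : R) -> 0 < e -> 0 < 2 * rho + j%:R + 1 ->
  exists d A, [/\ 0 < d <= 1, 1 <= A & forall n c y, coef_asymp rho a c n -> 0 < y <= d -> A <= n%:R * y ->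
    `|y * wmoment c n j.+1 y - (2 * rho + j%:R + 1) * wmoment c n j y| <= e * wmoment c n j y].
Proof.
move=> a0 e0 b0; set b := 2 * rho + j%:R + 1 in b0 *.
pose e' := Num.min 2^-1 (e / (4 * b + 8)).
have e'0 : 0 < e' by rewrite lt_min invr_gt0 ltr0n/= divr_gt0// addr_gt0// mulr_gt0.
have e'1 : e' <= 2^-1 by rewrite ge_min lexx.
have e'2 : e' * (4 * b + 8) <= e.
  by rewrite -ler_pdivlMr ?addr_gt0 ?mulr_gt0// ge_min lexx orbT.
have bS : 2 * rho + j.+1%:R = b by rewrite /b -natr1; ring.
have b1 : b - 1 = 2 * rho + j%:R by rewrite /b addrK.
have b0' : 0 < 2 * rho + j.+1%:R + 1 by rewrite bS addr_gt0.
have [d1 /andP[d10 d11] h1] := wmoment_equiv a0 e'0 b0.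
have [d2 /andP[d20 d21] h2] := wmoment_equiv a0 e'0 b0'.
have [d3 [A [/andP[d30 d31] A1 h3]]] := powsum_recur b0 e'0.
exists (Num.min d1 (Num.min d2 d3)), A; split => //.
  by rewrite !lt_min d10 d20 d30 ge_min d11.
move=> n c y hc /andP[y0]; rewrite !le_min => /and3P[yd1 yd2 yd3] Any.
have ny : 1 <= n%:R * y by exact: le_trans Any.
have := h1 n c y hc _ ny; rewrite y0 => /(_ yd1).
have := h2 n c y hc _ ny; rewrite y0 bS => /(_ yd2).
have := h3 n y _ Any; rewrite y0 b1 => /(_ yd3).
have := powsum_ge0 b n y; have := powsum_ge0 (2 * rho + j%:R) n y.
move: (powsum b n y) (powsum _ n y) (wmoment c n j.+1 y) (wmoment c n j y) => Y X W1 W0 X0 Y0 H3 H2 H1.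
have XW : X <= 2 * W0.
  have : e' * X <= 2^-1 * X by rewrite ler_wpM2r.
  by move: H1; rewrite ler_norml => /andP[]; lra.
have -> : y * W1 - b * W0 = y * (W1 - Y) + (y * Y - b * X) - b * (W0 - X) by ring.
apply: (@le_trans _ _ (y * (e' * Y) + e' * X + b * (e' * X))).
  rewrite (le_trans (ler_normB _ _))// lerD//; last by rewrite normrM gtr0_norm// ler_pM2l.
  rewrite (le_trans (ler_normD _ _))// lerD//.
  by rewrite normrM gtr0_norm// ler_pM2l.
have yY : y * Y <= (b + 2^-1) * X.
  have : e' * X <= 2^-1 * X by rewrite ler_wpM2r.
  by move: H3; rewrite ler_norml => /andP[_]; lra.
have H : y * (e' * Y) <= e' * ((b + 2^-1) * X) by rewrite mulrCA ler_pM2l.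
have W00 : 0 <= W0 by lra.
have : e' * ((2 * b + 3) * X) <= e' * ((2 * b + 3) * (2 * W0)).
  by rewrite ler_pM2l// ler_pM2l// addr_gt0// mulr_gt0.
have : e' * (4 * b + 8) * W0 <= e * W0 by rewrite ler_wpM2r.
have : 0 <= e' * X by rewrite mulr_ge0// ltW.
have : 0 <= e' * W0 by rewrite mulr_ge0// ltW.
lra.
Qed.

End weighted_moments.

(** * The variance for small [y] *)

Section variance_asymptotics.
Context {R : realType}.
Implicit Types (a c : nat -> R) (b e y rho : R) (n m j : nat).

Lemma norm_le2 (x d : R) : `|x - 1| <= d -> d <= 1 -> `|x| <= 2.
Proof.
by move=> xd d1; rewrite -[x](subrK 1) (le_trans (ler_normD _ _))// normr1; lra.
Qed.

(** With [Wj] for the moments, [y * W1 / W0] is near [b] and [y ^+ 2 * W2 / W0] near [b * (b + 1)];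
    the variance is [b * (b + 1) - b ^+ 2 = b], as for a gamma law of shape [b]. *)
Lemma wvar_asymp_gt rho a e : a @ \oo --> (0 : R) -> 0 < e -> 0 < 2 * rho + 1 ->
  exists d A, [/\ 0 < d <= 1, 1 <= A & forall n c y, coef_asymp rho a c n ->
    0 < wmoment c n 0 y -> 0 < y <= d -> A <= n%:R * y ->
    `|wvar c n y * y ^+ 2 - (2 * rho + 1)| <= e].
Proof.
move=> a0 e0 b0; set b := 2 * rho + 1 in b0 *.
pose e' := Num.min 1 (e / (2 * b + 3)).
have D0 : 0 < 2 * b + 3 by rewrite addr_gt0// mulr_gt0.
have e'0 : 0 < e' by rewrite lt_min ltr01/= divr_gt0.
have e'1 : e' <= 1 by rewrite ge_min lexx.
have e'2 : e' * (2 * b + 3) <= e by rewrite -ler_pdivlMr// ge_min lexx orbT.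
have bE0 : 2 * rho + 0%:R + 1 = b by rewrite /b addr0.
have bE1 : 2 * rho + 1%:R + 1 = b + 1 by rewrite /b.
have b0' : 0 < 2 * rho + 0%:R + 1 by rewrite bE0.
have b1' : 0 < 2 * rho + 1%:R + 1 by rewrite bE1 addr_gt0.
have [d1 [A1 [/andP[d10 d11] A11 h1]]] := wmoment_ratio a0 e'0 b0'.
have [d2 [A2 [/andP[d20 d21] A21 h2]]] := wmoment_ratio a0 e'0 b1'.
exists (Num.min d1 d2), (Num.max A1 A2); split.
- by rewrite lt_min d10 d20 ge_min d11.
- by rewrite le_max A11.
- move=> n c y hc W00 /andP[y0]; rewrite le_min ge_max => /andP[yd1 yd2] /andP[ny1 ny2].
  have := h1 n c y hc _ ny1; rewrite y0 bE0 => /(_ yd1).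
  have := h2 n c y hc _ ny2; rewrite y0 bE1 => /(_ yd2).
  rewrite /wvar; move: (wmoment c n 1 y) (wmoment c n 2 y) (wmoment c n 0 y) W00 => W1 W2 W0 W00 H2 H1.
  have normW x : `|x| * W0 = `|x * W0| by rewrite normrM (gtr0_norm W00).
  set u := y * W1 / W0.
  have hu : `|u - b| <= e'.
    rewrite -(ler_pM2r W00) normW mulrBl /u divfK ?gt_eqF//.
  have hv : `|y ^+ 2 * W2 / W0 - (b + 1) * u| <= e' * u.
    rewrite -(ler_pM2r W00) normW mulrBl.
    have -> : y ^+ 2 * W2 / W0 * W0 - (b + 1) * u * W0 = y * (y * W2 - (b + 1) * W1).
      by rewrite /u; field; rewrite gt_eqF.
    have -> : e' * u * W0 = y * (e' * W1) by rewrite /u; field; rewrite gt_eqF.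
    by rewrite normrM gtr0_norm// ler_pM2l.
  (* The last bracket is [(b + 1) * u - u ^+ 2 - b], written in powers of the small quantity
     [u - b]. *)
  have -> : (W2 / W0 - (W1 / W0) ^+ 2) * y ^+ 2 - b =
    (y ^+ 2 * W2 / W0 - (b + 1) * u) + ((u - b) * (1 - b) - (u - b) ^+ 2).
    by rewrite /u; field; rewrite gt_eqF.
  apply: le_trans e'2.
  move: (_ / W0 - _) hv => v hv; clearbody u; clear - b0 e'0 e'1 hu hv; clearbody e' b.
  rewrite (le_trans (ler_normD _ _))//.
  have h3 : `|(u - b) * (1 - b) - (u - b) ^+ 2| <= e' * (1 + b) + e'.
    rewrite (le_trans (ler_normB _ _))// lerD//.
      by rewrite normrM ler_pM// (le_trans (ler_normB _ _))// normr1 lerD2l ger0_norm// ltW.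
    rewrite normrX; apply: (@le_trans _ _ (e' ^+ 2)); first by rewrite lerXn2r ?nnegrE// ltW.
    by rewrite expr2 ger_pMr.
  have h4 : e' * u <= e' * (b + 1).
    rewrite ler_pM2l//; move: hu; rewrite ler_norml => /andP[_]; lra.
  lra.
Qed.

(** Here [W0] is only logarithmic, asymptotic to [L = ln y^-1], while [y * W1] and [y ^+ 2 * W2] are
    near 1. The squared mean is smaller than [W2 / W0] by a factor of order [L], so that quotient
    alone gives the leading term. *)
Lemma wvar_asymp_eq a e : a @ \oo --> (0 : R) -> 0 < e ->
  exists d A, [/\ 0 < d <= 1, 1 <= A & forall n c y, coef_asymp (- 2^-1) a c n ->
    0 < y <= d -> A <= n%:R * y ->
    `|wvar c n y * (y ^+ 2 * ln y^-1) - 1| <= e].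
Proof.
(* The budget of 14 is 8 + 2 + 3 + 1, for the four terms of the decomposition at the end. *)
move=> a0 e0; pose e' := Num.min 8^-1 (e / 14).
have e'0 : 0 < e' by rewrite lt_min invr_gt0 ltr0n/= divr_gt0.
have e'1 : e' <= 8^-1 by rewrite ge_min lexx.
have e'2 : 14 * e' <= e by rewrite mulrC -ler_pdivlMr// ge_min lexx orbT.
clearbody e'.
set rho : R := - 2^-1.
have rE0 : 2 * rho + 0%:R = -1 by rewrite /rho; field.
have rE1 : 2 * rho + 1%:R = 0 by rewrite /rho; field.
have b1 : 0 < 2 * rho + 1%:R + 1 by rewrite rE1 add0r.
have [C C0 hC] := wmoment_powsum rho 0 a0 e'0.
have [d1 /andP[d10 d11] h1] := wmoment_equiv a0 e'0 b1.
have [d2 [A [/andP[d20 d21] A1 h2]]] := wmoment_ratio a0 e'0 b1.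
(* The first summand lets [e' * L] absorb the additive errors in [W0]; the second gives
   [16 <= e' * L], where 16 bounds the numerator of the squared-mean term. *)
pose L0 : R := (2 * e' + C + 2) / e' + 16 / e'.
have L00 : 0 < L0 by rewrite addr_gt0 ?divr_gt0// addr_gt0// ltr_wpDr// mulr_gt0.
exists (Num.min (Num.min d1 d2) (Num.min e' (expR (- L0)))), (Num.max A e'^-1); split.
- by rewrite !lt_min d10 d20 e'0 expR_gt0 !ge_min d11.
- by rewrite le_max A1.
move=> n c y hc /andP[y0]; rewrite !le_min ge_max => /andP[/andP[yd1 yd2] /andP[ye yL]] /andP[Any eny].
have ny1 : 1 <= n%:R * y by exact: le_trans Any.
have y1 : y <= 1 by exact: le_trans d11.
set L := ln y^-1.
have LL : L0 <= L by rewrite /L lnV ?posrE// lerNr -[leRHS]expRK ler_ln ?posrE ?expR_gt0.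
have L_gt0 : 0 < L by exact: lt_le_trans LL.
have Le1 : 2 * e' + C + 2 <= e' * L.
  by rewrite [leRHS]mulrC -ler_pdivrMr// (le_trans _ LL)// lerDl divr_ge0// ltW.
have Le2 : 16 <= e' * L.
  by rewrite [leRHS]mulrC -ler_pdivrMr// (le_trans _ LL)// lerDr divr_ge0 ?addr_ge0 ?mulr_ge0// ltW.
have y01 : 0 < y <= 1 by rewrite y0.
have /andP[s1 s2] := powsumN1_bounds y01 ny1; rewrite -/L in s1 s2.
have /andP[p1 p2] := powsum0_bounds n y0.
have ez : expR (- (n%:R * y)) <= e'.
  have ny0 : 0 < n%:R * y by exact: lt_le_trans ny1.
  rewrite expRN -[leRHS]invrK lef_pV2 ?posrE ?expR_gt0 ?invr_gt0// (le_trans eny)//.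
  by rewrite (le_trans _ (expR_ge1Dx _))// lerDr.
have := hC n c y hc (ltW y0); rewrite rE0.
have := h1 n c y hc _ ny1; rewrite y0 rE1 => /(_ yd1).
have := h2 n c y hc _ Any; rewrite y0 rE1 add0r mul1r => /(_ yd2).
rewrite /wvar; move: (powsum (-1) n y) (powsum 0 n y) s1 s2 p1 p2 => S0 S1 s1 s2 p1 p2.
move: (wmoment c n 0 y) (wmoment c n 1 y) (wmoment c n 2 y) => W0 W1 W2 H2 H1 H0.
clear - C0 e'0 e'1 e'2 y0 ye ez Le1 Le2 L_gt0 s1 s2 p1 p2 H2 H1 H0; clearbody L.
have hp : `|y * W1 - 1| <= 3 * e'.
  have -> : y * W1 - 1 = y * (W1 - S1) + (y * S1 - 1) by ring.
  have : `|y * (W1 - S1)| <= e' * (y * S1).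
    by rewrite normrM gtr0_norm// mulrCA ler_pM2l.
  have : e' * (y * S1) <= e' * 1 by rewrite ler_pM2l.
  move: (y * S1) p1 p2 (y * (W1 - S1)) => p p1 p2 q h3; rewrite !ler_norml => /andP[h4 h5].
  apply/andP; split; lra.
have hs : `|y ^+ 2 * W2 - y * W1| <= e' * (y * W1).
  have -> : y ^+ 2 * W2 - y * W1 = y * (y * W2 - W1) by ring.
  by rewrite normrM gtr0_norm// mulrCA ler_pM2l.
have hw : `|W0 - L| <= 2 * (e' * L).
  have : e' * S0 <= e' * (L + 2) by rewrite ler_pM2l.
  by move: H0; rewrite !ler_norml => /andP[h3 h4] h5; apply/andP; split; lra.
have eL : e' * L <= 8^-1 * L by rewrite ler_wpM2r// ltW.
have W00 : 0 < W0 by move: hw; rewrite ler_norml => /andP[]; lra.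
have normW x : `|x| * W0 = `|x * W0| by rewrite normrM (gtr0_norm W00).
pose g := L / W0.
have hg : `|g - 1| <= 4 * e'.
  rewrite -(ler_pM2r W00) normW mulrBl /g divfK ?gt_eqF// mul1r distrC.
  apply: (le_trans hw).
  have : e' * L <= e' * (2 * W0).
    by rewrite ler_pM2l//; move: hw; rewrite ler_norml => /andP[]; lra.
  lra.
have -> : (W2 / W0 - (W1 / W0) ^+ 2) * (y ^+ 2 * L) - 1 =
   (y ^+ 2 * W2) * (g - 1) + (y ^+ 2 * W2 - y * W1) + (y * W1 - 1) - (y * W1) ^+ 2 * g ^+ 2 / L.
  by rewrite /g; field; rewrite !gt_eqF.
apply: le_trans e'2.
move: (y * W1) (y ^+ 2 * W2) g hp hs hg => p s g hp hs hg.
clear - hp hs hg e'0 e'1 Le2 L_gt0.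
have p2' : `|p| <= 2 by apply: norm_le2 hp _; lra.
have t2 : `|s - p| <= 2 * e'.
  by apply: (le_trans hs); rewrite mulrC ler_pM2r// (le_trans (ler_norm _)).
have s2' : `|s| <= 2.
  apply: (@norm_le2 _ (5 * e')); last by lra.
  have -> : s - 1 = (s - p) + (p - 1) by ring.
  by rewrite (le_trans (ler_normD _ _))// (le_trans (lerD t2 hp))// -mulrDl; lra.
have g2' : `|g| <= 2 by apply: norm_le2 hg _; lra.
have t1 : `|s * (g - 1)| <= 2 * (4 * e') by rewrite normrM ler_pM.
have t3 : `|p ^+ 2 * g ^+ 2 / L| <= e'.
  have pg2 : `|p * g| <= 2 * 2 by rewrite normrM ler_pM.
  rewrite -exprMn normrM normfV (gtr0_norm L_gt0) ler_pdivrMr// normrX.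
  apply: le_trans Le2; apply: (@le_trans _ _ ((2 * 2) ^+ 2)); last by lra.
  by rewrite lerXn2r ?nnegrE.
rewrite (le_trans (ler_normB _ _))// (le_trans (lerD (ler_normD _ _) (lexx _)))//.
rewrite (le_trans (lerD (lerD (ler_normD _ _) (lexx _)) (lexx _)))//.
lra.
Qed.

End variance_asymptotics.

(** * Bounds on the variance uniform in [n] *)

Section uniform_bounds.
Context {R : realType}.
Implicit Types (a c : nat -> R) (b e y t rho : R) (n m j k D : nat).

(** Half of the decay absorbs the power through a Taylor bound for the exponential, and the other
    half leaves a geometric series. *)
Lemma expsum_le D k t : 0 < t -> exists2 C : R, 0 < C & forall n y, t <= y ->
  \sum_(m < n) (m + k)%:R ^+ D.+1 * expR (- (m%:R * y)) <= C.
Proof.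
move=> t0; pose s := t / 2; have s0 : 0 < s by rewrite divr_gt0.
pose F : R := (D.+1)`!%:R; have F0 : 0 < F by rewrite ltr0n fact_gt0.
pose B := expR (k%:R * s) * F / s ^+ D.+1.
have B0 : 0 < B by rewrite divr_gt0 ?mulr_gt0 ?expR_gt0// exprn_gt0.
have q1 : expR (- s) < 1 by rewrite expR_lt1 oppr_lt0.
have q10 : 0 < 1 - expR (- s) by rewrite subr_gt0.
exists (B / (1 - expR (- s))); first by rewrite divr_gt0.
move=> n y ty.
apply: (@le_trans _ _ (\sum_(m < n) B * expR (- s) ^+ m)).
  apply: ler_sum => m _.
  have h1 : (m + k)%:R ^+ D.+1 * s ^+ D.+1 <= F * expR ((m + k)%:R * s).
    have := @expR_ge1Dxn R ((m + k)%:R * s) D; rewrite mulr_ge0 ?(ltW s0)// => /(_ isT).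
    rewrite exprMn -/F => h; rewrite mulrC -ler_pdivrMl//.
    by apply: le_trans h; rewrite [leLHS]mulrC [s ^+ _ * _]mulrC lerDr.
  have h2 : (m + k)%:R ^+ D.+1 <= B * expR (m%:R * s).
    rewrite -(ler_pM2r (exprn_gt0 D.+1 s0)) (le_trans h1)//.
    rewrite natrD mulrDl expRD /B.
    set u := expR (m%:R * s); set v := expR (k%:R * s); move: (s ^+ D.+1) (exprn_gt0 D.+1 s0) => q q0.
    by rewrite le_eqVlt; apply/orP; left; apply/eqP; field; rewrite gt_eqF.
  apply: (@le_trans _ _ (B * expR (m%:R * s) * expR (- (m%:R * t)))).
    rewrite ler_pM ?expR_ge0 ?exprn_ge0// ler_expR lerN2 ler_wpM2l//.
  rewrite -mulrA -expRD ler_pM2l// -expRM_natl ler_expR /s.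
  by rewrite le_eqVlt; apply/orP; left; apply/eqP; field.
rewrite -mulr_sumr ler_pM2l//.
have E : (1 - expR (- s)) * \sum_(m < n) expR (- s) ^+ m = 1 - expR (- s) ^+ n.
  have := subrXX (1 : R) (expR (- s)) n; rewrite expr1n => ->; congr (_ * _).
  by apply: eq_bigr => i _; rewrite expr1n mul1r.
rewrite -(ler_pM2l q10) E divff ?gt_eqF// gerBl.
Qed.

Lemma coef_sqr_le rho a : a @ \oo --> (0 : R) -> exists2 B : R, 0 < B &
  forall n c m, coef_asymp rho a c n -> (m <= n)%N ->
    c m ^+ 2 <= B * (maxn m 1)%:R `^ (2 * rho).
Proof.
move=> a0; have /cvg_seq_bounded[M [_ hM]] : cvgn a by apply/cvg_ex; exists 0.
have M1 : M < `|M| + 1 by rewrite (le_lt_trans (ler_norm _))// ltrDl.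
set N := `|M| + 1 in M1.
have N0 : 0 < N by rewrite ltr_pwDr.
exists ((1 + N) ^+ 2); first by rewrite exprn_gt0// addr_gt0.
move=> n c m hc mn; have := hc m mn; set x : R := (maxn m 1)%:R.
have x0 : 0 < x by rewrite ltr0n leq_max orbT.
have := hM _ M1 m I => /= /(le_trans (ler_norm _)) aN h.
have {}h : x `^ (- rho) * `|c m| <= 1 + N.
  by move: (le_trans h aN); rewrite ler_norml => /andP[_]; rewrite lerBlDl.
have {}h : `|c m| <= (1 + N) * x `^ rho.
  move: h; rewrite powRN mulrC ler_pdivrMr ?powR_gt0//.
have -> : 2 * rho = rho * 2 by rewrite mulrC.
rewrite powRrM powR_mulrn ?powR_ge0// -exprMn -real_normK ?num_real//.
by rewrite lerXn2r ?nnegrE// mulr_ge0 ?powR_ge0// addr_ge0 ?ltW.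
Qed.

Lemma coef_sqr_le_poly rho a : a @ \oo --> (0 : R) -> exists (B : R) (D : nat), 0 < B /\
  forall n c m, coef_asymp rho a c n -> (m <= n)%N -> c m ^+ 2 <= B * m.+1%:R ^+ D.
Proof.
move=> a0; have [B B0 hB] := coef_sqr_le rho a0.
pose D := (Num.truncn `|2 * rho|).+1; exists B, D; split=> // n c m hc mn.
apply: le_trans (hB n c m hc mn) _; rewrite ler_pM2l//.
have D1 : 2 * rho <= D%:R by rewrite (le_trans (ler_norm _))// ltW// truncnS_gt.
have x1 : 1 <= (maxn m 1)%:R :> R by rewrite ler1n leq_max orbT.
rewrite (le_trans (ler_powR x1 D1))// powR_mulrn ?ler0n// lerXn2r ?nnegrE//.
by rewrite ler_nat geq_max leqnSn.
Qed.

Lemma coef_sqr_ge rho a c n m : coef_asymp rho a c n -> (m <= n)%N -> a m <= 2^-1 ->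
  4^-1 * (maxn m 1)%:R `^ (2 * rho) <= c m ^+ 2.
Proof.
move=> hc mn am; have := hc m mn; set x : R := (maxn m 1)%:R.
have x0 : 0 < x by rewrite ltr0n leq_max orbT.
move=> /le_trans/(_ am); rewrite ler_norml => /andP[h _].
have {}h : 2^-1 <= x `^ (- rho) * `|c m| by lra.
have {}h : 2^-1 * x `^ rho <= `|c m|.
  by move: h; rewrite powRN mulrC ler_pdivlMr ?powR_gt0.
have -> : 2 * rho = rho * 2 by rewrite mulrC.
rewrite powRrM powR_mulrn ?powR_ge0//.
have -> : 4^-1 = 2^-1 ^+ 2 :> R by field.
by rewrite -exprMn -[leRHS]real_normK ?num_real// lerXn2r ?nnegrE// mulr_ge0 ?powR_ge0.
Qed.

Lemma coef_neq0 rho a c n m : coef_asymp rho a c n -> (m <= n)%N -> a m <= 2^-1 -> c m != 0.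
Proof.
move=> hc mn am; have := coef_sqr_ge hc mn am; apply: contraTneq => ->.
by rewrite expr0n/= -ltNge mulr_gt0 ?invr_gt0// powR_gt0// ltr0n leq_max orbT.
Qed.

Lemma wmoment_ge_term c n j m y : (m <= n)%N ->
  m%:R ^+ j * c m ^+ 2 * expR (- (m%:R * y)) <= wmoment c n j y.
Proof.
move=> mn; rewrite /wmoment (bigD1 (Ordinal (mn : (m < n.+1)%N)))//= lerDl.
by apply: sumr_ge0 => i _; exact: wmoment_term_ge0.
Qed.

Lemma wvar_le_ratio c n y : wvar c n y <= wmoment c n 2 y / wmoment c n 0 y.
Proof. by rewrite /wvar gerBl sqr_ge0. Qed.

Lemma wmoment0_ge_unif rho a k : a k <= 2^-1 -> exists2 K : R, 0 < K &
  forall n c y, coef_asymp rho a c n -> (k <= n)%N -> y <= 1 -> K <= wmoment c n 0 y.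
Proof.
move=> ak; exists (4^-1 * (maxn k 1)%:R `^ (2 * rho) * expR (- k%:R)).
  by rewrite !mulr_gt0 ?invr_gt0 ?expR_gt0// powR_gt0// ltr0n leq_max orbT.
move=> n c y hc kn y1; apply: le_trans (wmoment_ge_term c 0 y kn).
rewrite expr0 mul1r ler_pM ?mulr_ge0 ?expR_ge0 ?invr_ge0 ?powR_ge0//.
  exact: coef_sqr_ge hc kn ak.
by rewrite ler_expR lerN2 -[leRHS]mulr1 ler_wpM2l.
Qed.

Lemma wmoment_le_unif rho a j t : a @ \oo --> (0 : R) -> 0 < t -> exists2 C : R, 0 < C &
  forall n c y, coef_asymp rho a c n -> t <= y -> wmoment c n j y <= C.
Proof.
move=> a0 t0; have [B [D [B0 hB]]] := coef_sqr_le_poly rho a0.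
have [C C0 hC] := expsum_le (j + D) 1 t0.
exists (B * C); first by rewrite mulr_gt0.
move=> n c y hc ty; apply: le_trans (_ : B * \sum_(m < n.+1) (m + 1)%:R ^+ (j + D).+1 * expR (- (m%:R * y)) <= _).
  rewrite mulr_sumr /wmoment; apply: ler_sum => m _.
  rewrite mulrA ler_wpM2r ?expR_ge0// addn1.
  apply: (@le_trans _ _ (m.+1%:R ^+ j * (B * m.+1%:R ^+ D))).
    apply: ler_pM; [exact: exprn_ge0|exact: sqr_ge0| |exact: hB hc (ltn_ord m)].
    by rewrite lerXn2r ?nnegrE// ler_nat.
  rewrite mulrCA -exprD ler_pM2l// exprS ler_peMl ?exprn_ge0// ler1n//.
by rewrite ler_pM2l// hC.
Qed.

Lemma wvar_le_unif rho a k t : a @ \oo --> (0 : R) -> a k <= 2^-1 -> 0 < t ->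
  exists2 C : R, 0 < C & forall n c y, coef_asymp rho a c n -> (k <= n)%N ->
    t <= y <= 1 -> wvar c n y <= C ^+ 2.
Proof.
move=> a0 ak t0; have [K K0 hK] := wmoment0_ge_unif rho ak.
have [C C0 hC] := wmoment_le_unif rho 2 a0 t0.
exists (Num.sqrt (C / K)); first by rewrite sqrtr_gt0 divr_gt0.
move=> n c y hc kn /andP[ty y1].
have CK : 0 <= C / K by rewrite divr_ge0// ltW.
rewrite sqr_sqrtr// (le_trans (wvar_le_ratio _ _ _))//.
have W0 := hK n c y hc kn y1.
by rewrite ler_pM ?invr_ge0 ?wmoment_ge0 ?hC// lef_pV2 ?posrE// (lt_le_trans K0).
Qed.

Lemma ffact_le_expn m k : (m ^_ k <= m ^ k)%N.
Proof.
elim: k => [|k IH]; first by rewrite ffactn0.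
by rewrite ffactnSr expnSr leq_mul// leq_subr.
Qed.

Lemma leq_expn2r m n k : (m <= n)%N -> (m ^ k <= n ^ k)%N.
Proof. by case: k => // k mn; rewrite leq_exp2r. Qed.

(** The constant coefficient of the [k]-th derivative is [c k] times a factorial, so the zeroth
    moment is bounded below. The second moment starts at index 1 and so carries a factor
    [expR (- y)]. *)
Lemma wvar_deriv_coef_le rho a k : a @ \oo --> (0 : R) -> a k <= 2^-1 ->
  exists2 C : R, 0 < C & forall n c y, coef_asymp rho a c n -> (k <= n)%N ->
    1 <= y -> wvar (deriv_coef k c) (n - k) y <= (C * expR (- y / 2)) ^+ 2.
Proof.
move=> a0 ak; have [B [D [B0 hB]]] := coef_sqr_le_poly rho a0.
(* The exponent collects [m ^+ 2], the squared coefficient and the squared falling factorial; the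
   base [m + k.+2] dominates each of their bases. *)
have [C C0 hC] := expsum_le (2 + D + 2 * k) (k.+2) (ltr01 : 0 < 1 :> R).
pose K : R := 4^-1 * (maxn k 1)%:R `^ (2 * rho).
have K0 : 0 < K by rewrite mulr_gt0 ?invr_gt0// powR_gt0// ltr0n leq_max orbT.
exists (Num.sqrt (B * C / K)); first by rewrite sqrtr_gt0 divr_gt0// mulr_gt0.
move=> n c y hc kn y1.
have BCK : 0 <= B * C / K by rewrite divr_ge0 ?mulr_ge0// ltW.
rewrite exprMn sqr_sqrtr//.
have -> : expR (- y / 2) ^+ 2 = expR (- y).
  by rewrite expr2 -expRD; congr expR; field.
have W0 : K <= wmoment (deriv_coef k c) (n - k) 0 y.
  apply: le_trans (wmoment_ge_term _ 0 y (leq0n _)).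
  rewrite mul0r oppr0 expR0 mulr1 mul1r /deriv_coef add0n ffactnn exprMn.
  apply: le_trans (coef_sqr_ge hc kn ak) _; rewrite ler_peMr ?sqr_ge0//.
  by rewrite exprn_ege1// ler1n fact_gt0.
apply: le_trans (wvar_le_ratio _ _ _) _.
have W00 : 0 < wmoment (deriv_coef k c) (n - k) 0 y by exact: lt_le_trans W0.
rewrite ler_pdivrMr// wmoment_recl mul0r add0r.
apply: (@le_trans _ _ (B * C * expR (- y))); last first.
  have -> : B * C * expR (- y) = B * C / K * expR (- y) * K.
    by move: (expR _) => u; field; rewrite gt_eqF.
  by rewrite ler_wpM2l// mulr_ge0 ?expR_ge0.
apply: (@le_trans _ _ (B * expR (- y) * \sum_(m < n - k) (m + k.+2)%:R ^+ (2 + D + 2 * k).+1 * expR (- (m%:R * y)))); last first.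
  by rewrite mulrAC ler_wpM2r ?expR_ge0// ler_pM2l// hC.
rewrite mulr_sumr; apply: ler_sum => m _.
have -> : expR (- (m.+1%:R * y)) = expR (- y) * expR (- (m%:R * y)).
  by rewrite -expRD -natr1; congr expR; ring.
have mkn : (m.+1 + k <= n)%N by rewrite addnC -leq_subRL.
have h1 := hB n c _ hc mkn.
have h2 : ((m.+1 + k) ^_ k)%:R ^+ 2 <= (m + k.+2)%:R ^+ (2 * k) :> R.
  rewrite mulnC exprM lerXn2r ?nnegrE ?exprn_ge0// -natrX ler_nat (leq_trans (ffact_le_expn _ _))//.
  have le_base : (m.+1 + k <= m + k.+2)%N by rewrite addSn !addnS.
  exact: leq_expn2r.
have h3 : m.+1%:R ^+ 2 <= (m + k.+2)%:R ^+ 2 :> R.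
  by rewrite lerXn2r ?nnegrE// ler_nat -addn1 leq_add2l.
have x1 : 1 <= (m + k.+2)%:R :> R by rewrite ler1n addnS.
rewrite /deriv_coef exprMn.
apply: (@le_trans _ _ ((m + k.+2)%:R ^+ 2 * (B * (m + k.+2)%:R ^+ D * (m + k.+2)%:R ^+ (2 * k)) * (expR (- y) * expR (- (m%:R * y))))).
  rewrite ler_wpM2r ?mulr_ge0 ?expR_ge0//; apply: ler_pM => //.
  - by apply: mulr_ge0; exact: sqr_ge0.
  apply: ler_pM => //; [exact: sqr_ge0|apply: (le_trans h1)].
  by rewrite ler_pM2l// lerXn2r ?nnegrE// ler_nat !addnS addSn.
rewrite [_ ^+ (2 + D + 2 * k).+1]exprS (exprD _ (2 + D) (2 * k)) (exprD _ 2 D).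
move: (m + k.+2)%:R x1 => x x1.
have : 0 <= x ^+ 2 * x ^+ D * x ^+ (2 * k) * (B * expR (- y) * expR (- (m%:R * y))).
  by rewrite !mulr_ge0 ?exprn_ge0 ?expR_ge0 ?(ltW B0)// (le_trans ler01).
move: (x ^+ 2) (x ^+ D) (x ^+ (2 * k)) (expR _) (expR _) => u v w p q h.
have x10 : 0 <= x - 1 by rewrite subr_ge0.
have := mulr_ge0 x10 h; lra.
Qed.

(** One pair, [(k, k.+1)], is kept from the double sum of [wmoment_gram]; the squared distance of
    its indices is 1. *)
Lemma wvar_ge_unif rho a k : a @ \oo --> (0 : R) -> a k <= 2^-1 -> a k.+1 <= 2^-1 ->
  exists2 K : R, 0 < K & forall n c y, coef_asymp rho a c n -> (k < n)%N ->
    2^-1 <= y <= 1 -> K ^+ 2 <= wvar c n y.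
Proof.
move=> a0 ak ak1; have [C C0 hC] := wmoment_le_unif rho 0 a0 (ltac:(by rewrite invr_gt0) : 0 < 2^-1 :> R).
pose l (m : nat) : R := 4^-1 * (maxn m 1)%:R `^ (2 * rho) * expR (- m%:R).
have l0 m : 0 < l m.
  by rewrite /l !mulr_gt0 ?invr_gt0 ?expR_gt0// powR_gt0// ltr0n leq_max orbT.
exists (Num.sqrt (2^-1 * (l k * l k.+1)) / C).
  by rewrite divr_gt0// sqrtr_gt0 !mulr_gt0 ?invr_gt0.
move=> n c y hc kn /andP[ty y1].
have W00 : 0 < wmoment c n 0 y by apply: (wmoment0_gt0 y kn); exact: coef_neq0 hc kn ak1.
have lb m : (m <= n)%N -> a m <= 2^-1 -> l m <= c m ^+ 2 * expR (- (m%:R * y)).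
  move=> mn am; rewrite /l ler_pM ?expR_ge0 ?mulr_ge0 ?invr_ge0 ?powR_ge0//.
    exact: coef_sqr_ge hc mn am.
  by rewrite ler_expR lerN2 -[leRHS]mulr1 ler_wpM2l.
rewrite expr_div_n sqr_sqrtr ?mulr_ge0 ?invr_ge0 ?(ltW (l0 _))//.
have -> : wvar c n y = (wmoment c n 0 y * wmoment c n 2 y - wmoment c n 1 y ^+ 2) / wmoment c n 0 y ^+ 2.
  by rewrite /wvar; field; rewrite gt_eqF.
have g0 : 2^-1 * (l k * l k.+1) <= wmoment c n 0 y * wmoment c n 2 y - wmoment c n 1 y ^+ 2.
  rewrite wmoment_gram ler_pM2l ?invr_gt0//.
  have ge0 (i j : nat) : 0 <= c i ^+ 2 * expR (- (i%:R * y)) * (c j ^+ 2 * expR (- (j%:R * y))) * (i%:R - j%:R) ^+ 2.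
    by apply: mulr_ge0 (sqr_ge0 _); apply: mulr_ge0; rewrite mulr_ge0 ?sqr_ge0 ?expR_ge0.
  rewrite (bigD1 (Ordinal (ltnW kn : (k < n.+1)%N)))//= ler_wpDr//.
    by apply: sumr_ge0 => i _; apply: sumr_ge0 => j _.
  rewrite (bigD1 (Ordinal (kn : (k.+1 < n.+1)%N)))//= ler_wpDr//.
    by apply: sumr_ge0 => i _.
  have -> : (k%:R - k.+1%:R) ^+ 2 = 1 :> R by rewrite -natr1; ring.
  by rewrite mulr1; apply: ler_pM; rewrite ?lb ?(ltW (l0 _))// ltnW.
rewrite ler_pM ?invr_ge0 ?sqr_ge0//.
  by rewrite !mulr_ge0 ?invr_ge0 ?(ltW (l0 _)).
by rewrite lef_pV2 ?posrE ?exprn_gt0// lerXn2r ?nnegrE ?hC// ltW.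
Qed.

(** As [0 <= b <= 1], the power [b] of [m * y] is at most [1 + m * y], hence at most
    [2 * expR (m * y / 2)]. Half of the decay remains, in a geometric sum. *)
Lemma powsum_le_subunit b n y : 0 <= b <= 1 -> 0 < y -> powsum b n y <= 4 * y `^ (- (b + 1)).
Proof.
move=> /andP[b0 b1] y0; have y2 : 0 < y / 2 by rewrite divr_gt0.
have yb : 0 < y `^ b by rewrite powR_gt0.
apply: (@le_trans _ _ (\sum_(m < n) 2 / y `^ b * (m.+1%:R `^ 0 * expR (- (m.+1%:R * (y / 2)))))).
  apply: ler_sum => m _; rewrite powRr0 mul1r.
  have z0 : 0 < m.+1%:R * y by rewrite mulr_gt0.
  have h : (m.+1%:R * y) `^ b <= 2 * expR (m.+1%:R * (y / 2)).
    have e1 := expR_ge1Dx (m.+1%:R * (y / 2)); rewrite mulrA in e1 *.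
    apply: (@le_trans _ _ (1 + m.+1%:R * y)); last by lra.
    have [z1|/ltW z1] := leP (m.+1%:R * y) 1.
      have z01 : 0 < m.+1%:R * y <= 1 by rewrite z0.
      by have := ger_powR z01 b0; rewrite powRr0; lra.
    by rewrite -[leLHS]add0r lerD// ler1_powR.
  rewrite powRM ?(ltW y0)// -ler_pdivlMr// in h.
  apply: (@le_trans _ _ (2 * expR (m.+1%:R * (y / 2)) / y `^ b * expR (- (m.+1%:R * y)))).
    by rewrite ler_wpM2r ?expR_ge0.
  have -> : - (m.+1%:R * (y / 2)) = m.+1%:R * (y / 2) + - (m.+1%:R * y) by field.
  by rewrite expRD le_eqVlt; apply/orP; left; apply/eqP; ring.
rewrite -mulr_sumr -/(powsum 0 n (y / 2)).
have /andP[_ h] := powsum0_bounds n y2.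
rewrite powRN powRD; last by rewrite (gt_eqF y0) implybT.
rewrite powRr1 ?(ltW y0)//.
apply: (@le_trans _ _ (2 / y `^ b * (2 / y))).
  by rewrite ler_wpM2l ?divr_ge0 ?(ltW yb)// -[2 / y]invf_div -[leRHS]mul1r ler_pdivlMr// mulrC.
by move: (y `^ b) yb => u u0; rewrite le_eqVlt; apply/orP; left; apply/eqP; field; rewrite !gt_eqF.
Qed.

(** The zeroth moment stays bounded below, and the second is dominated by a power sum of exponent
    [th < 1], so their quotient is less singular than [y ^ (- 2)]. *)
Lemma wvar_le_lt rho a k : a @ \oo --> (0 : R) -> a k <= 2^-1 -> 2 * rho + 1 < 0 ->
  exists kap C : R, [/\ 0 < kap <= 1, 0 < C & forall n c y, coef_asymp rho a c n -> (k <= n)%N ->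
    0 < y <= 1 -> wvar c n y <= (C * y `^ (kap - 1)) ^+ 2].
Proof.
move=> a0 ak rho0; have [K K0 hK] := wmoment0_ge_unif rho ak.
have [B B0 hB] := coef_sqr_le rho a0.
(* The maximum with 0 meets the range of [powsum_le_subunit]; [th < 1] is what [rho < - 1 / 2]
   provides, and it makes [kap = (1 - th) / 2] positive. *)
pose th := Num.max 0 (2 * rho + 2).
have th0 : 0 <= th by rewrite le_max lexx.
have th1 : th < 1 by rewrite gt_max ltr01/=; lra.
have thr : 2 * rho + 2 <= th by rewrite le_max lexx orbT.
exists ((1 - th) / 2), (Num.sqrt (4 * B / K)); split.
- by apply/andP; split; lra.
- by rewrite sqrtr_gt0 divr_gt0// mulr_gt0.
move=> n c y hc kn /andP[y0 y1].
have BK : 0 <= 4 * B / K by rewrite divr_ge0 ?mulr_ge0// ltW.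
rewrite exprMn sqr_sqrtr// -powR_mulrn ?powR_ge0// -powRrM.
have -> : ((1 - th) / 2 - 1) * 2 = - (th + 1) by field.
apply: le_trans (wvar_le_ratio _ _ _) _.
have W0 := hK n c y hc kn y1; have W00 := lt_le_trans K0 W0.
have W2 : wmoment c n 2 y <= B * (4 * y `^ (- (th + 1))).
  apply: (@le_trans _ _ (B * powsum th n y)); last first.
    by rewrite ler_pM2l// powsum_le_subunit// th0 ltW.
  rewrite wmoment_recl mul0r add0r mulr_sumr; apply: ler_sum => m _.
  rewrite mulrA ler_wpM2r ?expR_ge0//.
  have := hB n c m.+1 hc (ltn_ord m); rewrite (maxn_idPl _)// => h.
  apply: (@le_trans _ _ (m.+1%:R ^+ 2 * (B * m.+1%:R `^ (2 * rho)))).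
    by rewrite ler_wpM2l ?sqr_ge0.
  rewrite mulrCA ler_pM2l// -powR_mulrn// -powRD; last by rewrite pnatr_eq0 implybT.
  by apply: ler_powR; rewrite ?ler1n// addrC.
rewrite ler_pdivrMr// (le_trans W2)//.
have -> : B * (4 * y `^ (- (th + 1))) = 4 * B / K * y `^ (- (th + 1)) * K.
  by move: (y `^ _) => u; field; rewrite gt_eqF.
by rewrite ler_wpM2l// mulr_ge0 ?powR_ge0.
Qed.

End uniform_bounds.

(** * Increments of the primitives of the density *)

Section primitive_bounds.
Context {R : realType}.
Implicit Types (g G : R -> R) (lo hi : R).

(** The mean value theorem, with the intermediate value of [g] bounded by the end values. It
    supplies the hypotheses on [G] in the density lemmas. *)
Lemma primitive_bounds g G lo hi :
  (forall x, lo <= x <= hi -> is_derive x 1 G (g x)) ->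
  (forall a b, lo <= a -> a <= b -> b <= hi -> g b <= g a) ->
  forall a b, lo <= a -> a <= b -> b <= hi -> (b - a) * g b <= G b - G a <= (b - a) * g a.
Proof.
move=> dG gm a b la ab bh.
have itv x : a <= x <= b -> lo <= x <= hi by move=> /andP[ax xb]; apply/andP; split; lra.
have [||z] := @MVT_segment R G g a b ab.
- by move=> x; rewrite in_itv/= => /andP[ax xb]; apply/dG/itv; rewrite !ltW.
- apply: derivable_within_continuous => x; rewrite in_itv/= => xab.
  by have [] := dG x (itv x xab).
rewrite in_itv/= => /andP[az zb] ->; rewrite [g z * _]mulrC.
have ba : 0 <= b - a by rewrite subr_ge0.
by rewrite !ler_wpM2l// gm//; lra.
Qed.

Lemma ln_primitive lo hi k : 0 < lo -> 0 <= k -> forall a b, lo <= a -> a <= b -> b <= hi ->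
  (b - a) * (k / b) <= k * ln b - k * ln a <= (b - a) * (k / a).
Proof.
move=> lo0 k0; apply: (@primitive_bounds (fun x => k / x) (fun x => k * ln x)).
  move=> x /andP[lox _]; have x0 : 0 < x by exact: lt_le_trans lox.
  by apply: is_deriveZ; exact: is_derive1_ln.
move=> a b la ab _; have a0 : 0 < a by exact: lt_le_trans la.
by rewrite ler_wpM2l// lef_pV2 ?posrE// (lt_le_trans a0).
Qed.

Lemma powR_nincr (r a b : R) : r <= 0 -> 0 < a -> a <= b -> b `^ r <= a `^ r.
Proof.
move=> r0 a0 ab; have b0 : 0 < b by exact: lt_le_trans ab.
rewrite -[r]opprK !(powRN _ (- r)) lef_pV2 ?posrE ?powR_gt0//.
by apply: ge0_ler_powR; rewrite ?nnegrE ?(ltW a0) ?(ltW b0)// oppr_ge0.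
Qed.

Lemma powR_primitive lo hi k C : 0 < lo -> 0 < k <= 1 -> 0 <= C ->
  forall a b, lo <= a -> a <= b -> b <= hi ->
  (b - a) * (C * b `^ (k - 1)) <= C / k * b `^ k - C / k * a `^ k <= (b - a) * (C * a `^ (k - 1)).
Proof.
move=> lo0 /andP[k0 k1] C0; apply: (@primitive_bounds (fun x => C * x `^ (k - 1)) (fun x => C / k * x `^ k)).
  move=> x /andP[lox _]; have x0 : 0 < x by exact: lt_le_trans lox.
  have -> : C * x `^ (k - 1) = (C / k) *: (k * x `^ (k - 1)).
    by rewrite /GRing.scale/= mulrA divfK// gt_eqF.
  by apply: is_deriveZ; exact: is_derive1_powR.
move=> a b la ab _; have a0 : 0 < a by exact: lt_le_trans la.
by rewrite ler_wpM2l// powR_nincr// subr_le0.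
Qed.

(** From [a] to [b] the logarithm drops by at most [b / a - 1]. After squaring, a polynomial
    inequality remains, which holds as [ln b^-1 >= 1]. *)
Lemma mul_sqrt_ln_mono (a b : R) : 0 < a -> a <= b -> 1 <= ln b^-1 ->
  a * Num.sqrt (ln a^-1) <= b * Num.sqrt (ln b^-1).
Proof.
move=> a0 ab Lb; have b0 : 0 < b by exact: lt_le_trans ab.
have La : ln a^-1 <= ln b^-1 + (b / a - 1).
  have -> : ln a^-1 = ln b^-1 + ln (1 + (b / a - 1)).
    have -> : 1 + (b / a - 1) = b / a by ring.
    by rewrite ln_div ?posrE// !lnV ?posrE//; ring.
  rewrite lerD2l le_ln1Dx//.
  have : 1 <= b / a by rewrite ler_pdivlMr// mul1r.
  lra.
have La1 : 1 <= ln a^-1.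
  by rewrite (le_trans Lb)// ler_ln ?posrE ?invr_gt0// lef_pV2.
rewrite -(@ler_pXn2r _ 2) ?nnegrE ?mulr_ge0 ?sqrtr_ge0 ?(ltW a0) ?(ltW b0)//.
rewrite !exprMn !sqr_sqrtr ?(le_trans ler01)//.
apply: (@le_trans _ _ (a ^+ 2 * (ln b^-1 + (b / a - 1)))).
  by rewrite ler_pM2l// exprn_gt0.
have -> : a ^+ 2 * (ln b^-1 + (b / a - 1)) = a ^+ 2 * ln b^-1 + a * (b - a).
  by move: (ln _) => l; field; rewrite gt_eqF.
have : (b - a) * (b + a) * 1 <= (b - a) * (b + a) * ln b^-1.
  by rewrite ler_wpM2l// mulr_ge0 ?subr_ge0// addr_ge0// ltW.
have : 0 <= b * (b - a) by rewrite mulr_ge0 ?subr_ge0// ltW.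
move: (ln b^-1) => l; lra.
Qed.

Lemma sqrt_ln_primitive lo hi k : 0 < lo -> 1 <= ln hi^-1 -> 0 <= k ->
  forall a b, lo <= a -> a <= b -> b <= hi ->
  (b - a) * (k / (b * Num.sqrt (ln b^-1))) <=
  - (2 * k) * Num.sqrt (ln b^-1) - - (2 * k) * Num.sqrt (ln a^-1) <=
  (b - a) * (k / (a * Num.sqrt (ln a^-1))).
Proof.
move=> lo0 Lhi k0.
have lnle x : lo <= x -> x <= hi -> 1 <= ln x^-1.
  move=> lx xh; have x0 := lt_le_trans lo0 lx.
  by rewrite (le_trans Lhi)// ler_ln ?posrE ?invr_gt0 ?lef_pV2 ?posrE// (lt_le_trans x0).
apply: (@primitive_bounds (fun x => k / (x * Num.sqrt (ln x^-1))) (fun x => - (2 * k) * Num.sqrt (ln x^-1))).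
  move=> x /andP[lox xh]; have x0 : 0 < x by exact: lt_le_trans lox.
  have l1 := lnle x lox xh; have l0 : 0 < ln x^-1 by rewrite (lt_le_trans ltr01).
  have s0 : 0 < Num.sqrt (ln x^-1) by rewrite sqrtr_gt0.
  have -> : k / (x * Num.sqrt (ln x^-1)) =
      - (2 * k) *: (- x^-1 *: ((2 * Num.sqrt (ln x^-1))^-1)).
    by rewrite /GRing.scale/=; move: (Num.sqrt _) s0 => s s0; field; rewrite !gt_eqF.
  have xE : ln x^-1 = (- @ln R) x by rewrite lnV ?posrE.
  have d1 : is_derive x 1 (Num.sqrt \o (- @ln R)) (- x^-1 * (2 * Num.sqrt (ln x^-1))^-1).
    have l0' : 0 < (- @ln R) x by rewrite -xE.
    rewrite mulrC xE; exact: (@is_derive1_comp _ Num.sqrt (- @ln R) x _ _ (is_derive1_sqrt l0') (is_deriveN (is_derive1_ln x0))).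
  apply: is_deriveZ.
  apply: (near_eq_is_derive _ d1).
  near=> y; have y0 : 0 < y by near: y; exact: lt_nbhsr.
  by rewrite /= lnV ?posrE.
move=> a b la ab bh; have a0 : 0 < a by exact: lt_le_trans la.
have b0 : 0 < b by exact: lt_le_trans ab.
have lb : 1 <= ln b^-1 by apply: lnle => //; exact: le_trans ab.
have la' : 1 <= ln a^-1 by apply: lnle => //; exact: le_trans bh.
have sp x : 1 <= ln x^-1 -> 0 < Num.sqrt (ln x^-1) :> R.
  by move=> l1; rewrite sqrtr_gt0 (lt_le_trans ltr01).
rewrite ler_wpM2l// lef_pV2 ?posrE ?mulr_gt0 ?sp//.
exact: mul_sqrt_ln_mono.
Unshelve. all: by end_near. Qed.

End primitive_bounds.

(** * From two-sided bounds to the error term *)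

Section asymptotic_ratio.
Context {R : realType}.

(** The equation itself defines [eps]; the two bounds make [E n] finite, and the constant [C], which
    varies with [d], is absorbed by the growth of [l]. *)
Lemma asymptotic_ratio (E : nat -> \bar R) (l : nat -> R) (k : R) : l @ \oo --> +oo ->
  (forall d, 0 < d -> exists C N, forall n, (N <= n)%N ->
     (((k - d) * l n - C)%:E <= E n)%E /\ (E n <= ((k + d) * l n + C)%:E)%E) ->
  exists eps : nat -> R, eps @ \oo --> (0 : R) /\
    \forall n \near \oo, E n = ((k + eps n) * l n)%:E.
Proof.
move=> loo h; exists (fun n => fine (E n) / l n - k); split; last first.
  have [C [N hN]] := h 1 ltr01.
  near=> n; have l0 : 0 < l n by near: n; apply: (cvgryPgt _).1.
  have [|h1 h2] := hN n; first by near: n; exists N.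
  have fE : E n \is a fin_num.
    by rewrite fin_numE; apply/andP; split; apply/eqP => En; move: h1 h2; rewrite En.
  by rewrite addrC subrK divfK ?gt_eqF// fineK.
apply/cvgrPdist_le => e e0.
have e2 : 0 < e / 2 by rewrite divr_gt0.
have [C [N hN]] := h _ e2.
near=> n; have l0 : 0 < l n by near: n; apply: (cvgryPgt _).1.
have lC : 2 * `|C| / e <= l n by near: n; apply: (cvgryPge _).1.
have [|h1 h2] := hN n; first by near: n; exists N.
have fE : E n \is a fin_num.
  by rewrite fin_numE; apply/andP; split; apply/eqP => En; move: h1 h2; rewrite En.
move: h1 h2; rewrite -(fineK fE) !lee_fin; move: (fine (E n)) => x h1 h2 /=.
have {}lC : `|C| <= e / 2 * l n by move: lC; rewrite ler_pdivrMr//; lra.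
have Cn := ler_norm C; have Cn' := ler_norm (- C); rewrite normrN in Cn'.
rewrite sub0r normrN -(ler_pM2r l0) -[X in _ * X <= _](gtr0_norm l0) -normrM.
rewrite mulrBl divfK ?gt_eqF// ler_norml; apply/andP; split; lra.
Unshelve. all: by end_near. Qed.

End asymptotic_ratio.

(** * The three regimes for real coefficients *)

Section expected_real_roots.
Context d (T : measurableType d) (R : realType) (P : probability T R)
  (xi : nat -> {RV P >-> R}).
Hypothesis xi_iid : iid_standard_gaussian xi.
Variables (rho : R) (a : nat -> R) (k : nat).
Hypotheses (a0 : a @ \oo --> (0 : R)) (ak : forall m, (k <= m)%N -> a m <= 2^-1).
Implicit Types (c : nat -> R) (n : nat) (t A B : R).

Let roots c n (S : set R) w : R := (nroots (real_poly xi c n w) S)%:R.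
Let EN c n : \bar R := (\int[P]_w (roots c n `]0, 1[%classic w)%:E)%E.

Let ak0 : a k <= 2^-1. Proof. exact: ak. Qed.
Let ak1 : a k.+1 <= 2^-1. Proof. by apply: ak. Qed.
Let ck1 c n : coef_asymp rho a c n -> (k.+2 <= n)%N -> c k.+1 != 0.
Proof. by move=> hc kn; apply: (coef_neq0 hc (ltnW kn)). Qed.
Let ck2 c n : coef_asymp rho a c n -> (k.+2 <= n)%N -> c k.+2 != 0.
Proof. by move=> hc kn; apply: (coef_neq0 hc kn); apply: ak; lia. Qed.

Let expR_itv_subset t A : 0 < A ->
  `]expR (- t / 2), expR (- A / 2)]%classic `<=` `]0, 1[%classic.
Proof.
move=> A0 z /=; rewrite !in_itv/= => /andP[z1 z2].
rewrite (lt_trans (expR_gt0 _) z1)/= (le_lt_trans z2)// expR_lt1.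
by rewrite pmulr_llt0// oppr_lt0.
Qed.

(** For [y >= 1] the [k]-th derivative has an exponentially decaying density, and on [t <= y <= 1]
    the density is bounded; both bounds are uniform in [n]. *)
Lemma upper_mean_inner t : 0 < t <= 1 -> exists2 C, 0 <= C & forall n c,
  coef_asymp rho a c n -> (k.+2 <= n)%N ->
  upper_mean P (roots c n `]0, expR (- t / 2)]%classic) C.
Proof.
move=> /andP[t0 t1].
have [C1 C10 h1] := wvar_deriv_coef_le rho a0 ak0.
have [C2 C20 h2] := wvar_le_unif rho a0 ak0 t0.
exists (k%:R + C1 + C2); first by rewrite !addr_ge0// ltW.
move=> n c hc kn; have k1 := ck1 hc kn; have k2 := ck2 hc kn.
have kn' : (k <= n)%N by rewrite ltnW// ltnW.
have um1 : upper_mean P (roots c n `]0, expR (- 1 / 2)]%classic) (k%:R + C1).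
  apply: upper_mean_near_zero_derivn => //; first exact: ltW.
  by move=> y y1; apply: h1 hc kn' y1.
have um2 := @upper_mean_density _ _ _ _ xi xi_iid c n k 1 t kn k1 k2 (ltW t0) t1
  (fun=> C2) (fun y => C2 * y).
have {}um2 : upper_mean P (roots c n `]expR (- 1 / 2), expR (- t / 2)]%classic) C2.
  apply: upper_mean_le (um2 _ _ _ _).
  - have pi2 := @pi_ge2 R.
    rewrite ler_pdivrMr ?mulr_gt0 ?pi_gt0//.
    have : 0 <= C2 * t by rewrite mulr_ge0// ltW.
    have : C2 * 2 <= C2 * pi by rewrite ler_pM2l.
    lra.
  - by move=> y y1; exact: h2 hc kn' y1.
  - by move=> y _; exact: ltW.
  - by [].
  - by move=> x y _ xy _; rewrite -mulrBr mulrC.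
apply: upper_meanD um1 um2 _ => w; rewrite /roots -natrD ler_nat.
apply: leq_trans (nroots_setU_le _ _ _); apply: nroots_subset => z /=.
rewrite !in_itv/= => /andP[z0 zy]; case: (leP z (expR (- 1 / 2))) => h.
  by left; rewrite z0.
by right; rewrite zy.
Qed.

(** The range has [y]-length [A / n], and the density there is at most [n / (2 * pi)]. *)
Lemma upper_mean_edge A n c : 0 <= A -> coef_asymp rho a c n -> (k.+2 <= n)%N ->
  upper_mean P (roots c n `]expR (- (A / n%:R) / 2), 1]%classic) A.
Proof.
move=> A0 hc kn; have n0 : 0 < n%:R :> R by rewrite ltr0n (leq_trans _ kn).
have An : 0 <= A / n%:R by rewrite divr_ge0.
have := @upper_mean_density _ _ _ _ xi xi_iid c n k (A / n%:R) 0 kn (ck1 hc kn) (ck2 hc kn)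
  (lexx 0) An (fun=> n%:R) (fun y => n%:R * y).
have -> : expR (- 0 / 2) = 1 :> R by rewrite oppr0 mul0r expR0.
move=> um; apply: upper_mean_le (um _ _ _ _).
- have pi2 := @pi_ge2 R; rewrite mulr0 subr0 [_ * (A / _)]mulrC divfK ?gt_eqF//.
  rewrite ler_pdivrMr ?mulr_gt0 ?pi_gt0//.
  have : A * 2 <= A * pi by rewrite ler_wpM2l.
  lra.
- by move=> y _; exact: wvar_le.
- by [].
- by [].
- by move=> x y _ xy _; rewrite -mulrBr mulrC.
Qed.

Lemma expected_roots_le t A : 0 < t <= 1 -> 0 <= A -> exists2 C, 0 <= C & forall n c B,
  coef_asymp rho a c n -> (k.+2 <= n)%N -> A / n%:R <= t ->
  upper_mean P (roots c n `]expR (- t / 2), expR (- (A / n%:R) / 2)]%classic) B ->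
  (EN c n <= (B + C)%:E)%E.
Proof.
move=> t01 A0; have [C C0 hC] := upper_mean_inner t01.
exists (A + C); first by rewrite addr_ge0.
move=> n c B hc kn At um.
apply: upper_mean_integral; first by move=> w; exact: ler0n.
have um2 := upper_mean_edge A0 hc kn; have um1 := hC n c hc kn.
apply: upper_meanD um (upper_meanD um2 um1 (fun=> lexx _)) _ => w.
rewrite /roots -!natrD ler_nat.
apply: leq_trans (leq_trans (nroots_setU_le _ _ _) (leq_add (leqnn _) (nroots_setU_le _ _ _))).
apply: nroots_subset => z /=; rewrite !in_itv/= => /andP[z0 z1].
have [h1|h1] := leP z (expR (- t / 2)); first by right; right; rewrite z0.
have [h2|h2] := leP z (expR (- (A / n%:R) / 2)); first by left.
by right; left; rewrite ltW.
Qed.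

Let n_large t A : 0 < t -> exists N, forall n, (N <= n)%N ->
  [/\ (k.+2 <= n)%N, 0 < n%:R :> R & A / n%:R <= t].
Proof.
move=> t0; exists (k.+2 + (Num.truncn (A / t)).+1)%N => n Nn.
have kn : (k.+2 <= n)%N by rewrite (leq_trans (leq_addr _ _) Nn).
have n0 : 0 < n%:R :> R by rewrite ltr0n (leq_trans _ kn).
split=> //; rewrite ler_pdivrMr// mulrC -ler_pdivrMr// ltW// (lt_le_trans (truncnS_gt _))// ler_nat.
by rewrite (leq_trans (leq_addl _ _) Nn).
Qed.

(** On the middle range the density is nearly a constant over [y], and its primitive, a logarithm,
    grows by [ln n + O(1)] from [A / n] to [t]. *)
Lemma expected_roots_gt e : 0 < 2 * rho + 1 -> 0 < e -> exists C N, forall n, (N <= n)%N ->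
  forall c, coef_asymp rho a c n ->
  (((Num.sqrt (2 * rho + 1) - e) * (ln n%:R / (2 * pi)) - C)%:E <= EN c n)%E /\
  (EN c n <= ((Num.sqrt (2 * rho + 1) + e) * (ln n%:R / (2 * pi)) + C)%:E)%E.
Proof.
move=> rho0 e0; set b := 2 * rho + 1 in rho0 *; pose s := Num.sqrt b.
have s0 : 0 < s by rewrite sqrtr_gt0.
have ss : s ^+ 2 = b by rewrite sqr_sqrtr// ltW.
have e2 : 0 < e ^+ 2 by rewrite exprn_gt0.
(* Precision [e ^+ 2] for the variance gives [e] for its root: [(s + e) ^+ 2 >= b + e ^+ 2], and
   [(s - e) ^+ 2 <= b - e ^+ 2] when [e <= s]. *)
have [t [A [t01 A1 hV]]] := wvar_asymp_gt a0 e2 rho0.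
have /andP[t0 t1] := t01; have A0 : 0 < A by rewrite (lt_le_trans ltr01).
have [C C0 hC] := expected_roots_le t01 (ltW A0).
have [N hN] := n_large A t0.
(* The maximum keeps the minorant nonnegative when [e] exceeds [s]. *)
pose s' := Num.max 0 (s - e).
have s'0 : 0 <= s' by rewrite le_max lexx.
have se0 : 0 <= s + e by rewrite addr_ge0 ?ltW.
have pi0 := @pi_gt0 R; have ppi : 0 < 2 * pi :> R by rewrite mulr_gt0.
pose C' := s' * (ln A - ln t) / (2 * pi).
have C'0 : 0 <= C'.
  by rewrite divr_ge0 ?(ltW ppi)// mulr_ge0// subr_ge0 (le_trans (ln_le0 t1))// ln_ge0.
exists (C + C'), N => n Nn c hc; have [kn n0 An] := hN n Nn.
have k1 := ck1 hc kn; have k2 := ck2 hc kn.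
have yA : 0 < A / n%:R by rewrite divr_gt0.
have Vb y : A / n%:R <= y <= t -> `|wvar c n y * y ^+ 2 - b| <= e ^+ 2.
  move=> /andP[y1 y2]; have y0 : 0 < y by exact: lt_le_trans y1.
  apply: hV => //; first exact: wmoment0_gt0 kn k2.
  - by rewrite y0.
  - by move: y1; rewrite ler_pdivrMr// mulrC.
have ypos y : A / n%:R <= y <= t -> 0 < y by move=> /andP[y1 _]; exact: lt_le_trans y1.
have lnn : ln (A / n%:R) = ln A - ln n%:R by rewrite ln_div ?posrE.
have n1 : 0 <= ln n%:R :> R by rewrite ln_ge0// ler1n -(ltr0n R).
have gmono q : 0 <= q -> forall x y, A / n%:R <= x -> x <= y -> y <= t -> q / y <= q / x.
  move=> q0 x y x1 xy yt; rewrite ler_wpM2l// lef_pV2 ?posrE//.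
    by apply: lt_le_trans yA _; exact: le_trans xy.
  exact: lt_le_trans x1.
have gpos q : 0 <= q -> forall y, A / n%:R <= y <= t -> 0 <= q / y.
  by move=> q0 y hy; rewrite divr_ge0// ltW// ypos.
split.
- have := @lower_mean_density _ _ _ _ xi xi_iid c n k t (A / n%:R) kn k2 An
    (fun y => s' / y) (fun y => s' * ln y) `]0, 1[%classic.
  move=> lo; apply: le_trans (lo _ _ _ _ _).
  + rewrite lee_fin lnn.
    have -> : (s' * ln t - s' * (ln A - ln n%:R)) / (2 * pi) = s' * (ln n%:R / (2 * pi)) - C'.
      by rewrite /C'; move: (pi) pi0 => p p0; field; rewrite gt_eqF.
    have : (s - e) * (ln n%:R / (2 * pi)) <= s' * (ln n%:R / (2 * pi)).
      by rewrite ler_wpM2r ?divr_ge0 ?(ltW ppi)// le_max lexx orbT.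
    by rewrite -/s; lra.
  + exact: expR_itv_subset.
  + move=> y hy; have y0 := ypos y hy; rewrite expr_div_n ler_pdivrMr ?exprn_gt0//.
    have : s' ^+ 2 <= Num.max 0 (b - e ^+ 2).
      rewrite /s'; case: (leP 0 (s - e)) => h; last by rewrite expr0n/= le_max lexx.
      rewrite le_max -ss; apply/orP; right.
      have : 0 <= 2 * e * (s - e) by rewrite !mulr_ge0// ltW.
      by lra.
    move=> /le_trans; apply; rewrite ge_max mulr_ge0 ?wvar_ge0 ?sqr_ge0//=.
    by have := Vb y hy; rewrite ler_norml => /andP[]; lra.
  + exact: gpos.
  + exact: gmono.
  + by move=> x y h1 h2 h3; have /andP[] := ln_primitive yA s'0 h1 h2 h3.
- have um := @upper_mean_density _ _ _ _ xi xi_iid c n k t (A / n%:R) kn k1 k2 (ltW yA) An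
    (fun y => (s + e) / y) (fun y => (s + e) * ln y).
  apply: le_trans (hC n c _ hc kn An (um _ _ _ _)) _.
  + move=> y hy; have y0 := ypos y hy; rewrite expr_div_n ler_pdivlMr ?exprn_gt0//.
    have := Vb y hy; rewrite ler_norml => /andP[_].
    have : 0 <= 2 * s * e by rewrite !mulr_ge0// ltW.
    by rewrite -ss; lra.
  + exact: gpos.
  + exact: gmono.
  + by move=> x y h1 h2 h3; have /andP[] := ln_primitive yA se0 h1 h2 h3.
  rewrite lee_fin lnn.
  have -> : ((s + e) * ln t - (s + e) * (ln A - ln n%:R)) / (2 * pi) =
      (s + e) * (ln n%:R / (2 * pi)) - (s + e) * (ln A - ln t) / (2 * pi).
    by move: (pi) pi0 => p p0; field; rewrite gt_eqF.
  have : 0 <= (s + e) * (ln A - ln t) / (2 * pi).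
    by rewrite divr_ge0 ?(ltW ppi)// mulr_ge0// subr_ge0 (le_trans (ln_le0 t1))// ln_ge0.
  by rewrite -/s; lra.
Qed.

(** A primitive of the density is [-2] times the root of [ln y^-1], up to [1 / (2 * pi)]; the factor
    2 accounts for the final [1 / pi]. *)
Lemma expected_roots_eq e : rho = - 2^-1 -> 0 < e -> exists C N, forall n, (N <= n)%N ->
  forall c, coef_asymp rho a c n ->
  (((1 - e) * (Num.sqrt (ln n%:R) / pi) - C)%:E <= EN c n)%E /\
  (EN c n <= ((1 + e) * (Num.sqrt (ln n%:R) / pi) + C)%:E)%E.
Proof.
move=> rhoE e0.
have e2 : 0 < e ^+ 2 by rewrite exprn_gt0.
have [t' [A [/andP[t'0 t'1] A1 hV]]] := wvar_asymp_eq a0 e2.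
rewrite -rhoE in hV.
(* With [t <= expR (-1)] one has [ln y^-1 >= 1] on the whole range, as the monotonicity of the
   density requires. *)
pose t := Num.min t' (expR (-1)).
have t0 : 0 < t by rewrite lt_min t'0 expR_gt0.
have tt' : t <= t' by rewrite ge_min lexx.
have t1 : t <= 1 by exact: le_trans t'1.
have t01 : 0 < t <= 1 by rewrite t0.
have Lt : 1 <= ln t^-1.
  rewrite lnV ?posrE// lerNr -[leRHS]expRK ler_ln ?posrE ?expR_gt0//.
  by rewrite ge_min lexx orbT.
have A0 : 0 < A by rewrite (lt_le_trans ltr01).
have [C C0 hC] := expected_roots_le t01 (ltW A0).
have [N hN] := n_large A t0.
pose s := Num.max 0 (1 - e).
have s0 : 0 <= s by rewrite le_max lexx.
have se0 : 0 <= 1 + e by rewrite addr_ge0 ?ltW.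
have pi0 := @pi_gt0 R.
pose C' := s * (Num.sqrt (ln A) + Num.sqrt (ln t^-1)) / pi.
have C'0 : 0 <= C' by rewrite divr_ge0 ?(ltW pi0)// mulr_ge0// addr_ge0 ?sqrtr_ge0.
exists (C + C'), N => n Nn c hc; have [kn n0 An] := hN n Nn.
have k1 := ck1 hc kn; have k2 := ck2 hc kn.
have yA : 0 < A / n%:R by rewrite divr_gt0.
have ypos y : A / n%:R <= y <= t -> 0 < y by move=> /andP[y1 _]; exact: lt_le_trans y1.
have Ly y : A / n%:R <= y <= t -> 1 <= ln y^-1.
  move=> hy; have y0 := ypos y hy; move: hy => /andP[_ y1].
  by rewrite (le_trans Lt)// ler_ln ?posrE ?invr_gt0// lef_pV2 ?posrE.
have sy y : A / n%:R <= y <= t -> 0 < Num.sqrt (ln y^-1).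
  by move=> /Ly h; rewrite sqrtr_gt0 (lt_le_trans ltr01).
have Vb y : A / n%:R <= y <= t -> `|wvar c n y * (y ^+ 2 * ln y^-1) - 1| <= e ^+ 2.
  move=> hy; have y0 := ypos y hy; move: hy => /andP[y1 y2].
  apply: hV => //; first by rewrite y0 (le_trans y2).
  by move: y1; rewrite ler_pdivrMr// mulrC.
have lnn : ln (A / n%:R)^-1 = ln n%:R - ln A by rewrite invf_div ln_div ?posrE.
have n1 : 0 <= ln n%:R :> R by rewrite ln_ge0// ler1n -(ltr0n R).
have lA : 0 <= ln A by rewrite ln_ge0.
have lnA : ln A <= ln n%:R.
  by rewrite ler_ln ?posrE//; move: An; rewrite ler_pdivrMr// => /le_trans; apply; rewrite ger_pMl.
have sq1 : Num.sqrt (ln (A / n%:R)^-1) <= Num.sqrt (ln n%:R).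
  by rewrite ler_wsqrtr// lnn gerBl.
(* Subadditivity of the root: starting at [A / n] instead of [1 / n] costs a constant. *)
have sq2 : Num.sqrt (ln n%:R) <= Num.sqrt (ln (A / n%:R)^-1) + Num.sqrt (ln A).
  rewrite -(@ler_pXn2r _ 2) ?nnegrE ?addr_ge0 ?sqrtr_ge0// sqrrD !sqr_sqrtr ?lnn ?subr_ge0//.
  by rewrite addrAC subrK lerDl mulrn_wge0// mulr_ge0 ?sqrtr_ge0.
have gmono q : 0 <= q -> forall x y, A / n%:R <= x -> x <= y -> y <= t ->
    q / (y * Num.sqrt (ln y^-1)) <= q / (x * Num.sqrt (ln x^-1)).
  move=> q0 x y x1 xy yt.
  have hx : A / n%:R <= x <= t by rewrite x1 (le_trans xy).
  have hy : A / n%:R <= y <= t by rewrite (le_trans x1).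
  rewrite ler_wpM2l// lef_pV2 ?posrE ?mulr_gt0 ?sy ?ypos//.
  by apply: mul_sqrt_ln_mono => //; [exact: ypos hx|exact: Ly hy].
have gpos q : 0 <= q -> forall y, A / n%:R <= y <= t -> 0 <= q / (y * Num.sqrt (ln y^-1)).
  by move=> q0 y hy; rewrite divr_ge0// mulr_ge0 ?sqrtr_ge0// ltW// ypos.
have gsqr q y : A / n%:R <= y <= t ->
    (q / (y * Num.sqrt (ln y^-1))) ^+ 2 = q ^+ 2 / (y ^+ 2 * ln y^-1).
  by move=> hy; rewrite expr_div_n exprMn sqr_sqrtr// (le_trans ler01)// Ly.
have den y : A / n%:R <= y <= t -> 0 < y ^+ 2 * ln y^-1.
  by move=> hy; apply: mulr_gt0; [rewrite exprn_gt0// ypos|exact: lt_le_trans ltr01 (Ly y hy)].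
split.
- have := @lower_mean_density _ _ _ _ xi xi_iid c n k t (A / n%:R) kn k2 An
    (fun y => s / (y * Num.sqrt (ln y^-1))) (fun y => - (2 * s) * Num.sqrt (ln y^-1)) `]0, 1[%classic.
  move=> lo; apply: le_trans (lo _ _ _ _ _).
  + rewrite lee_fin.
    have -> : (- (2 * s) * Num.sqrt (ln t^-1) - - (2 * s) * Num.sqrt (ln (A / n%:R)^-1)) / (2 * pi) =
       s * (Num.sqrt (ln (A / n%:R)^-1) - Num.sqrt (ln t^-1)) / pi.
      by move: (pi) pi0 => p p0; field; rewrite gt_eqF.
    have h1 : (1 - e) * (Num.sqrt (ln n%:R) / pi) <= s * (Num.sqrt (ln n%:R) / pi).
      by rewrite ler_wpM2r ?divr_ge0 ?sqrtr_ge0 ?(ltW pi0)// le_max lexx orbT.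
    have h2 : s * (Num.sqrt (ln n%:R) / pi) - C' <= s * (Num.sqrt (ln (A / n%:R)^-1) - Num.sqrt (ln t^-1)) / pi.
      rewrite /C' -mulrA -[leRHS]mulrA -mulrBr ler_wpM2l// -mulrBl ler_pM2r ?invr_gt0//.
      by lra.
    by lra.
  + exact: expR_itv_subset.
  + move=> y hy; rewrite gsqr// ler_pdivrMr ?den//.
    have : s ^+ 2 <= Num.max 0 (1 - e ^+ 2).
      rewrite /s; case: (leP 0 (1 - e)) => h; last by rewrite expr0n/= le_max lexx.
      rewrite le_max; apply/orP; right.
      have : 0 <= 2 * e * (1 - e) by rewrite !mulr_ge0// ltW.
      by lra.
    move=> /le_trans; apply; rewrite ge_max mulr_ge0 ?wvar_ge0 ?(ltW (den _ hy))//=.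
    by have := Vb y hy; rewrite ler_norml => /andP[]; lra.
  + exact: gpos.
  + exact: gmono.
  + by move=> x y h1 h2 h3; have /andP[] := sqrt_ln_primitive yA Lt s0 h1 h2 h3.
- have um := @upper_mean_density _ _ _ _ xi xi_iid c n k t (A / n%:R) kn k1 k2 (ltW yA) An
    (fun y => (1 + e) / (y * Num.sqrt (ln y^-1))) (fun y => - (2 * (1 + e)) * Num.sqrt (ln y^-1)).
  apply: le_trans (hC n c _ hc kn An (um _ _ _ _)) _.
  + move=> y hy; rewrite gsqr// ler_pdivlMr ?den//.
    by have := Vb y hy; rewrite ler_norml => /andP[_]; lra.
  + exact: gpos.
  + exact: gmono.
  + by move=> x y h1 h2 h3; have /andP[] := sqrt_ln_primitive yA Lt se0 h1 h2 h3.
  rewrite lee_fin.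
  have -> : (- (2 * (1 + e)) * Num.sqrt (ln t^-1) - - (2 * (1 + e)) * Num.sqrt (ln (A / n%:R)^-1)) / (2 * pi) =
     (1 + e) * ((Num.sqrt (ln (A / n%:R)^-1) - Num.sqrt (ln t^-1)) / pi).
    by move: (pi) pi0 => p p0; field; rewrite gt_eqF.
  have : (1 + e) * ((Num.sqrt (ln (A / n%:R)^-1) - Num.sqrt (ln t^-1)) / pi) <=
      (1 + e) * (Num.sqrt (ln n%:R) / pi).
    rewrite ler_wpM2l// ler_pM2r ?invr_gt0//.
    by rewrite (le_trans _ sq1)// gerBl sqrtr_ge0.
  by lra.
Qed.

(** The majorant with exponent [kap - 1] is integrable at 0. From below, the window
    [1 / 2 <= y <= 1] suffices, since the variance has a positive bound there. *)
Lemma expected_roots_lt : 2 * rho + 1 < 0 -> exists C1 C2, [/\ 0 < C1, 0 < C2 &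
  forall n, (k.+2 <= n)%N -> forall c, coef_asymp rho a c n ->
  (C1%:E <= EN c n)%E /\ (EN c n <= C2%:E)%E].
Proof.
move=> rho0; have pi0 := @pi_gt0 R; have pi2 := @pi_ge2 R; have ppi : 0 < 2 * pi :> R by rewrite mulr_gt0.
have t01 : 0 < (1 : R) <= 1 by rewrite ltr01 lexx.
have [K K0 hK] := wvar_ge_unif rho a0 ak0 ak1.
have [kap [B [kap01 B0 hB]]] := wvar_le_lt a0 ak0 rho0.
have [C C0 hC] := expected_roots_le t01 (@ler01 R).
have kap0 : 0 < kap by case/andP: kap01.
have kap1 : kap <= 1 by case/andP: kap01.
exists (K / 2 / (2 * pi)), (B / kap + C); split.
- by rewrite !divr_gt0.
- by rewrite ltr_pwDl// divr_gt0.
move=> n kn c hc; have k1 := ck1 hc kn; have k2 := ck2 hc kn; split.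
- have h2 : 0 <= 2^-1 :> R by [].
  have h21 : 2^-1 <= 1 :> R by rewrite invf_le1// ler1n.
  have := @lower_mean_density _ _ _ _ xi xi_iid c n k 1 2^-1 kn k2 h21 
    (fun y => K) (fun y => K * y) `]0, 1[%classic.
  move=> lo; apply: le_trans (lo _ _ _ _ _).
  + rewrite lee_fin ler_pM2r ?invr_gt0// mulr1 -[X in _ <= X - _]mulr1 -mulrBr ler_pM2l//; lra.
  + exact: expR_itv_subset.
  + by move=> y hy; apply: hK hc (ltnW kn) hy.
  + by move=> y _; exact: ltW.
  + by [].
  + by move=> x y _ xy _; rewrite -mulrBr mulrC.
have n0 : 0 < n%:R :> R by rewrite ltr0n (leq_trans _ kn).
have yA : 0 < 1 / n%:R :> R by rewrite divr_gt0.
have An : 1 / n%:R <= 1 :> R by rewrite ler_pdivrMr// mul1r ler1n -(ltr0n R).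
have prim := @powR_primitive R (1 / n%:R) 1 kap B yA kap01 (ltW B0).
have um := @upper_mean_density _ _ _ _ xi xi_iid c n k 1 (1 / n%:R) kn k1 k2 (ltW yA) An
    (fun y => B * y `^ (kap - 1)) (fun y => B / kap * y `^ kap).
apply: le_trans (hC n c _ hc kn An (um _ _ _ _)) _.
- move=> y /andP[y1 y2]; apply: hB hc _ _; first by rewrite ltnW// ltnW.
  by rewrite (lt_le_trans yA).
- by move=> y _; rewrite mulr_ge0 ?powR_ge0// ltW.
- move=> x y x1 xy y1; have x0 : 0 < x by exact: lt_le_trans x1.
  by rewrite ler_pM2l// powR_nincr// subr_le0.
- by move=> x y h1 h2 h3; have /andP[] := prim x y h1 h2 h3.
rewrite lee_fin lerD2r powR1 mulr1 ler_pdivrMr//.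
have Bk : 0 < B / kap by rewrite divr_gt0.
have : 0 <= B / kap * (1 / n%:R) `^ kap by rewrite mulr_ge0 ?powR_ge0// ltW.
have : B / kap * 1 <= B / kap * (2 * pi) by rewrite ler_pM2l//; lra.
lra.
Qed.

End expected_real_roots.

(** * Reduction of the complex formulation to real polynomials *)

Lemma random_poly_real (d : measure_display) (T : measurableType d)
    (R : realType) (P : probability T R) (c : nat -> nat -> R[i])
    (xi : nat -> {RV P >-> R}) n w :
  (forall m, (m <= n)%N -> c m n \is Num.real) ->
  random_poly c xi n w = map_poly (real_complex R) (real_poly xi (fun m => complex.Re (c m n)) n w).
Proof.
move=> hreal; apply/polyP => m; rewrite coef_map !coef_poly ltnS; case: leqP => [mn|_].
  by rewrite /= rmorphM/= RRe_real// hreal.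
by rewrite raddf0.
Qed.

Lemma expected_nroots_real (d : measure_display) (T : measurableType d)
    (R : realType) (P : probability T R) (c : nat -> nat -> R[i])
    (xi : nat -> {RV P >-> R}) n :
  (forall m, (m <= n)%N -> c m n \is Num.real) ->
  expected_nroots c xi n =
  (\int[P]_w (nroots (real_poly xi (fun m => complex.Re (c m n)) n w) `]0, 1[%classic)%:R%:E)%E.
Proof.
move=> hreal; rewrite /expected_nroots unlock; apply: eq_integral => w _.
by rewrite random_poly_real// nroots_unit_interval.
Qed.

(** On real entries the modulus of [R[i]] is the embedded absolute value, and the order of [R[i]]
    restricts to that of [R]. *)
Lemma assumption_B_coef_asymp (R : realType) (rho : R) (a : nat -> R) (c : nat -> nat -> R[i]) n :
  assumption_B rho a c -> (forall m, (m <= n)%N -> c m n \is Num.real) ->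
  coef_asymp rho a (fun m => complex.Re (c m n)) n.
Proof.
move=> [_ hc] hreal m mn; have := hc m n mn.
have normC (x : R) : `|(x%:C)%C| = (`|x|%:C)%C by rewrite normc_def/= expr0n addr0 sqrtr_sqr.
rewrite -{1}(RRe_real (hreal m mn)) normC.
have -> : (1 : R[i]) = (1%:C)%C by [].
by rewrite -rmorphM -rmorphB/= normC lecR.
Qed.

Theorem theorem1p4 (d : measure_display) (T : measurableType d)
    (R : realType) (P : probability T R)
    (rho : R) (a : nat -> R) (c : nat -> nat -> R[i])
    (xi : nat -> {RV P >-> R})
    (hB : assumption_B rho a c)
    (hreal : forall m n : nat, (m <= n)%N -> c m n \is Num.real)
    (hxi : iid_standard_gaussian xi) :
  [/\ - 2^-1 < rho ->
        exists eps : nat -> R, eps @ \oo --> (0 : R) /\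
          \forall n \near \oo, expected_nroots c xi n =
            ((Num.sqrt (2 * rho + 1) + eps n) / (2 * pi) * ln n%:R)%:E,
      rho = - 2^-1 ->
        exists eps : nat -> R, eps @ \oo --> (0 : R) /\
          \forall n \near \oo, expected_nroots c xi n =
            ((1 + eps n) / pi * Num.sqrt (ln n%:R))%:E
    & rho < - 2^-1 ->
        exists k K : R, [/\ 0 < k, 0 < K &
          \forall n \near \oo,
            (k%:E <= expected_nroots c xi n)%E /\
            (expected_nroots c xi n <= K%:E)%E]].
Proof.
have hreal' n m : (m <= n)%N -> c m n \is Num.real by exact: hreal.
have a0 : a @ \oo --> (0 : R) by case: hB.
have hc n := assumption_B_coef_asymp hB (hreal' n).
have half0 : 0 < 2^-1 :> R by rewrite invr_gt0.
(* As [a] is common to all rows, one [k] serves every [n]: from it on, the coefficients have at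
   least half of their model size. *)
have /cvgrPdist_le/(_ _ half0) [k _ hk] := a0.
have ak m : (k <= m)%N -> a m <= 2^-1.
  by move=> km; have := hk m km; rewrite sub0r normrN; apply: le_trans; exact: ler_norm.
have pi0 := @pi_gt0 R.
have lnoo : (fun n => ln n%:R : R) @ \oo --> +oo.
  apply/cvgryPge => A; near=> n.
  have h : expR A <= n%:R by near: n; exact: nbhs_infty_ger.
  by rewrite -[leLHS]expRK ler_ln ?posrE ?expR_gt0// (lt_le_trans (expR_gt0 A)).
split=> hrho.
- have rho0 : 0 < 2 * rho + 1 by lra.
  have loo : (fun n => ln n%:R / (2 * pi) : R) @ \oo --> +oo.
    by apply/cvgryPge => A; near=> n; rewrite ler_pdivlMr ?mulr_gt0//; near: n; exact: (cvgryPge _).1.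
  have [|eps [e0 he]] := @asymptotic_ratio R (expected_nroots c xi) _ (Num.sqrt (2 * rho + 1)) loo.
    move=> e e0; have [C [N hN]] := expected_roots_gt hxi a0 ak rho0 e0.
    by exists C, N => n Nn; rewrite expected_nroots_real; [exact: hN|exact: hreal'].
  exists eps; split=> //; near=> n; rewrite (near he n)//; congr (_%:E).
  by rewrite mulrCA mulrC.
- have loo : (fun n => Num.sqrt (ln n%:R) / pi : R) @ \oo --> +oo.
    apply/cvgryPge => A; near=> n; rewrite ler_pdivlMr//.
    rewrite (le_trans (ler_norm _))// -sqrtr_sqr ler_wsqrtr//.
    by near: n; exact: (cvgryPge _).1.
  have [|eps [e0 he]] := @asymptotic_ratio R (expected_nroots c xi) _ 1 loo.
    move=> e e0; have [C [N hN]] := expected_roots_eq hxi a0 ak hrho e0.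
    by exists C, N => n Nn; rewrite expected_nroots_real; [exact: hN|exact: hreal'].
  exists eps; split=> //; near=> n; rewrite (near he n)//; congr (_%:E).
  by rewrite mulrCA mulrC.
- have rho0 : 2 * rho + 1 < 0 by lra.
  have [C1 [C2 [C10 C20 hC]]] := expected_roots_lt hxi a0 ak rho0.
  exists C1, C2; split=> //; exists k.+2 => // n /= kn.
  by rewrite expected_nroots_real; [exact: hC|exact: hreal'].
Unshelve. all: by end_near. Qed.
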